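(* Let $p\ge 2$ be an even integer, let $A>0$, and let $m:\mathbb{R}^n\to\mathbb{C}$ be a $(p,p)$ Fourier multiplier supported in $\mathbb{R}^{n-1}\times[-A,A]$. Suppose that, for every $t>0$, $T_{S_t m}\in\mathcal{R}$. Then, for every $t\ge t_0=\frac{(p-2)A}{4}$, $$|||S_t m|||_{p,p}\le \binom{p}{p/2}^{\frac1p}\left(|||m_+|||_{p,p}\,|||m_-|||_{p,p}\right)^{\frac12}.$$
   Context: Write $x=(x',x_n)\in\mathbb{R}^{n-1}\times\mathbb{R}$. For a function $m$ on $\mathbb{R}^n$ put $m_+(x)=m(x)\chi_{\{x_n>0\}}$, $m_-(x)=m(x)\chi_{\{x_n<0\}}$ (the hyperplane $x_n=0$ being a null set), and for $t\ge 0$ let $S_t m(x)=m_+(x',x_n-t)+m_-(x',x_n+t)$. The Fourier transform is $\hat f(y)=\int_{\mathbb{R}^n} e^{-2\pi i x\cdot y}f(x)\,dx$. For $m\in L^\infty(\mathbb{R}^n,\mathbb{C})$ let $T_m f(x)=\int_{\mathbb{R}^n}e^{2\pi i x\cdot y}m(y)\hat f(y)\,dy$, initially defined for $f\in C_0^\infty(\mathbb{R}^n)$; if $T_m$ extends to a bounded operator on $L^p(\mathbb{R}^n)$, $m$ is called a $(p,p)$ Fourier multiplier. $|||m|||_{p,p}$ denotes the operator norm of $T_m$ on the complex-valued space $L^p(\mathbb{R}^n,\mathbb{C})$. $T_m\in\mathcal{R}$ means that $T_m$ maps real-valued functions to real-valued functions. *)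

(* Defs.v *)
From HB Require Import structures.
From mathcomp Require Import all_boot all_order all_algebra.
From mathcomp Require Import all_classical all_reals all_analysis.
From mathcomp Require Import complex.

Set Implicit Arguments.
Unset Strict Implicit.
Unset Printing Implicit Defensive.

Import Order.TTheory GRing.Theory Num.Theory.
Import numFieldNormedType.Exports.

Local Open Scope classical_set_scope.
Local Open Scope ring_scope.
Local Open Scope complex_scope.

(* The sigma-algebra on R^n generated by the coordinate functions, i.e. the
   Borel sets. *)
Definition rV_display : measure_display.
Proof. exact: (measure_tuple_display default_measure_display). Qed.

Section measurable_rV.
Context {R : realType} {n : nat}.

Let coord (i : 'I_n) (x : 'rV[R]_n) : measurableTypeR R := x ord0 i.

Let rV_set0 : g_sigma_preimage coord set0.
Proof. exact: sigma_algebra0. Qed.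

Let rV_setC A : g_sigma_preimage coord A -> g_sigma_preimage coord (~` A).
Proof. exact: sigma_algebraC. Qed.

Let rV_bigcup (F : (set 'rV[R]_n)^nat) :
  (forall i, g_sigma_preimage coord (F i)) ->
  g_sigma_preimage coord (\bigcup_i (F i)).
Proof. exact: sigma_algebra_bigcup. Qed.

HB.instance Definition _ := @isMeasurable.Build rV_display
  'rV[R]_n (g_sigma_preimage coord) rV_set0 rV_setC rV_bigcup.

Lemma measurable_coord (i : 'I_n) :
  measurable_fun [set: 'rV[R]_n] (fun x : 'rV[R]_n => x ord0 i : measurableTypeR R).
Proof.
move=> _ Y mY; rewrite setTI; apply: sub_sigma_algebra => /=.
rewrite -bigcup_seq/=; exists i => /=; first by rewrite mem_index_enum.
by exists Y => //; rewrite setTI.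
Qed.

Lemma measurable_fun_rV d (T : measurableType d) (f : T -> 'rV[R]_n) :
  (forall i, measurable_fun [set: T] (fun t => f t ord0 i : measurableTypeR R)) ->
  measurable_fun [set: T] f.
Proof.
move=> mf _ A mA; rewrite setTI.
suff : preimage_set_system [set: T] f (g_sigma_preimage coord) `<=` measurable.
  by move=> /(_ (f @^-1` A)); apply; exists A => //; rewrite setTI.
rewrite -g_sigma_preimage_comp.
apply: smallest_sub; first exact: sigma_algebra_measurable.
move=> B; rewrite -bigcup_seq => -[i _ [C mC <-]].
exact: mf.
Qed.

End measurable_rV.

(* Lebesgue measure on R^n, by R^(n+1) = R^n x R with the new coordinate last. *)
Section lebesgue_rV.
Context {R : realType}.

Definition rV_snoc n (u : 'rV[R]_n * measurableTypeR R) : 'rV[R]_n.+1 :=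
  \row_i (if unlift ord_max i is Some j then u.1 ord0 j else u.2).

Definition rV_split n (x : 'rV[R]_n.+1) : 'rV[R]_n * measurableTypeR R :=
  (\row_j x ord0 (lift ord_max j), x ord0 ord_max).

Lemma rV_snocK n : cancel (@rV_snoc n) (@rV_split n).
Proof.
move=> [x t]; rewrite /rV_split /rV_snoc; congr (_, _) => /=.
  by apply/rowP => j; rewrite !mxE liftK.
by rewrite mxE unlift_none.
Qed.

Lemma measurable_rV_snoc n : measurable_fun [set: _] (@rV_snoc n).
Proof.
apply: measurable_fun_rV => i; rewrite /rV_snoc.
case: (unliftP ord_max i) => [j ->|->].
  under eq_fun do rewrite mxE liftK.
  by apply: (measurableT_comp (measurable_coord j)); exact: measurable_fst.
under eq_fun do rewrite mxE unlift_none.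
exact: measurable_snd.
Qed.

Lemma measurable_rV_split n : measurable_fun [set: _] (@rV_split n).
Proof.
apply: measurable_fun_pair; last exact: measurable_coord.
apply: measurable_fun_rV => i; under eq_fun do rewrite mxE.
exact: measurable_coord.
Qed.

Section snoc_measure.
Context {n : nat} (mu : {sigma_finite_measure set 'rV[R]_n -> \bar R}).

Definition snoc_measure : set 'rV[R]_n.+1 -> \bar R :=
  pushforward (mu \x @lebesgue_measure R)%E (@rV_snoc n).

HB.instance Definition _ := Measure.copy snoc_measure
  (measure_function_pushforward__canonical__measure_function_Measure
    (mu \x @lebesgue_measure R)%E (@measurable_rV_snoc n)).

Lemma snoc_measure_sigma_finite : sigma_finite setT snoc_measure.
Proof.
have /sigma_finiteP[F [FT ndF Foo]] := sigma_finiteT mu.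
have /sigma_finiteP[G [GT ndG Goo]] := sigma_finiteT (@lebesgue_measure R).
exists (fun k => @rV_split n @^-1` (F k `*` G k)).
  apply/esym; rewrite -subTset => x _.
  have [i _ Fi] : (\bigcup_k F k) (rV_split x).1 by rewrite -FT.
  have [j _ Gj] : (\bigcup_k G k) (rV_split x).2 by rewrite -GT.
  exists (maxn i j) => //; split.
    by move: Fi; apply: subsetPset; apply/ndF/leq_maxl.
  by move: Gj; apply: subsetPset; apply/ndG/leq_maxr.
move=> k; have [mFk Fkoo] := Foo k; have [mGk Gkoo] := Goo k; split.
  rewrite -[X in measurable X]setTI; apply: measurable_rV_split => //.
  exact: measurableX.
rewrite /snoc_measure /pushforward -comp_preimage.
rewrite (_ : _ \o _ = id); last by apply/funext => u /=; rewrite rV_snocK.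
by rewrite preimage_id product_measure1E// lte_mul_pinfty// ge0_fin_numE.
Qed.

HB.instance Definition _ := @Measure_isSigmaFinite.Build _ _ _
  snoc_measure snoc_measure_sigma_finite.

End snoc_measure.

Fixpoint lebesgue_rV n : {sigma_finite_measure set 'rV[R]_n -> \bar R} :=
  match n return {sigma_finite_measure set 'rV[R]_n -> \bar R} with
  | 0%N => \d_(0 : 'rV[R]_0)
  | k.+1 => snoc_measure (lebesgue_rV k)
  end.

End lebesgue_rV.

Section multipliers.
Context {R : realType} {n : nat}.
Implicit Types (f g m : 'rV[R]_n -> R[i]) (p : \bar R).

Definition cmeasurable f :=
  measurable_fun [set: 'rV[R]_n] (fun x => complex.Re (f x)) /\
  measurable_fun [set: 'rV[R]_n] (fun x => complex.Im (f x)).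

Definition cintegral f : R[i] :=
  Rintegral (lebesgue_rV n) setT (fun x => complex.Re (f x)) +i*
  Rintegral (lebesgue_rV n) setT (fun x => complex.Im (f x)).

Definition Lp_norm p f : \bar R :=
  Lnorm (lebesgue_rV n) p (fun x => (ComplexField.Normc.normc (f x))%:E).

Definition in_Lp p f := cmeasurable f /\ (Lp_norm p f < +oo)%E.

Definition ae_equal f g := {ae lebesgue_rV n, forall x, f x = g x}.

Fixpoint Ck (k : nat) (u : 'rV[R]_n -> R) : Prop :=
  match k with
  | 0%N => continuous u
  | k'.+1 => continuous u /\ forall i : 'I_n,
      (forall x, derivable u x (delta_mx ord0 i)) /\
      Ck k' (fun x => 'D_(delta_mx ord0 i) u x)
  end.

(* C_0^oo(R^n, C) *)
Definition test_function f :=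
  (forall k, Ck k (fun x => complex.Re (f x)) /\
             Ck k (fun x => complex.Im (f x))) /\
  compact (closure [set x | f x != 0]).

Definition dotprod (x y : 'rV[R]_n) : R := \sum_i x ord0 i * y ord0 i.

Definition expi (t : R) : R[i] := cos t +i* sin t.

Definition fourier f (y : 'rV[R]_n) : R[i] :=
  cintegral (fun x => expi (- (2 * pi * dotprod x y)) * f x).

Definition multiplier_op m f (x : 'rV[R]_n) : R[i] :=
  cintegral (fun y => expi (2 * pi * dotprod x y) * m y * fourier f y).

(* Operators on L^p act here on representatives: linearity holds almost
   everywhere and, together with a finite operator norm, it makes T compatible
   with almost everywhere equality. *)
Definition opnorm p (T : ('rV[R]_n -> R[i]) -> ('rV[R]_n -> R[i])) : \bar R :=
  ereal_sup [set Lp_norm p (T f) | f in [set f | in_Lp p f /\ (Lp_norm p f <= 1)%E]].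

Definition bounded_operator p (T : ('rV[R]_n -> R[i]) -> ('rV[R]_n -> R[i])) :=
  [/\ forall f, in_Lp p f -> in_Lp p (T f),
      forall (a : R[i]) f g, in_Lp p f -> in_Lp p g ->
        ae_equal (T (fun x => a * f x + g x)) (fun x => a * T f x + T g x) &
      (opnorm p T < +oo)%E].

Definition bounded_extension p m (T : ('rV[R]_n -> R[i]) -> ('rV[R]_n -> R[i])) :=
  bounded_operator p T /\
  forall f, test_function f -> ae_equal (T f) (multiplier_op m f).

Definition fourier_multiplier p m :=
  in_Lp +oo%E m /\ exists T, bounded_extension p m T.

(* For p < +oo test functions are dense in L^p, so all bounded extensions of T_m
   have the same operator norm, which is the value of the infimum.  It is +oo
   when there is no bounded extension. *)
Definition multiplier_norm p m : \bar R :=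
  ereal_inf [set opnorm p T | T in [set T | bounded_extension p m T]].

(* T_m is in \mathcal{R}, on the domain C_0^oo on which T_m is initially given;
   by density this amounts to the same condition on L^p. *)
Definition real_to_real m :=
  forall f, test_function f -> (forall x, complex.Im (f x) = 0) ->
    forall x, complex.Im (multiplier_op m f x) = 0.

End multipliers.

Section splitting.
Context {R : realType} {n : nat}.
Implicit Types (m : 'rV[R]_n.+1 -> R[i]) (x : 'rV[R]_n.+1).

(* x_n for x = (x', x_n) *)
Definition last_coord x : R := x ord0 ord_max.

Definition m_plus m x : R[i] := if 0 < last_coord x then m x else 0.

Definition m_minus m x : R[i] := if last_coord x < 0 then m x else 0.

Definition e_last : 'rV[R]_n.+1 := delta_mx ord0 ord_max.

(* S_t m *)
Definition shift_apart (t : R) m x : R[i] :=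
  m_plus m (x - t *: e_last) + m_minus m (x + t *: e_last).

End splitting.

(* Main.v *)
Require Import Defs.
From mathcomp Require Import all_boot all_order all_algebra.
From mathcomp Require Import all_classical all_reals all_analysis.
From mathcomp Require Import complex.
From mathcomp Require Import measurable_realfun.
From mathcomp Require Import ring lra.

Import Order.TTheory GRing.Theory Num.Theory.
Import numFieldNormedType.Exports.

Set Implicit Arguments.
Unset Strict Implicit.
Unset Printing Implicit Defensive.

Local Open Scope classical_set_scope.
Local Open Scope ring_scope.

(** Write [p = 2 q] and, for a test function [f], split [T_(S_t m) f] into
[g = upper t f] and [h = lower t f], the contributions of the two halves of the
separated multiplier. Two facts give the inequality.

First, the frequencies of [g] lie in the slab [t <= y_n <= t + A] and those of
[h] in the opposite slab. In the expansion of
[|g + h| ^ p = (g + h) ^ q (conj g + conj h) ^ q], the product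
[g ^ (q - i) h ^ i (conj g) ^ (q - j) (conj h) ^ j] with [i < j] has its
frequencies in [y_n >= 2 t (j - i) - A (q - (j - i))], a half-space contained
in [y_n >= 0] when [t >= (q - 1) A / 2 = (p - 2) A / 4]. An integrable function
with frequencies in [y_n >= 0] has integral zero (spec_ge0_cint0); for [i > j]
one conjugates. What remains is the diagonal
[sum_i C(q, i) ^ 2 |g| ^ (2 (q - i)) |h| ^ (2 i)], and pairing [i] with [q - i]
bounds it by [C(p, q) / 2 (|g| ^ p + |h| ^ p)], since the squares of the
binomial coefficients add up to [C(2 q, q)] (Rintegral_addX_le). As [g] and [h]
are modulations of the images of modulations of [f] under the operators of
[m_+] and [m_-], this bounds the norm of [T_(S_t m)] by [C(p, q) ^ (1 / p)]
times the larger of the two norms.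

Second, the two norms are equal. For real [f] the function
[w = g - conj h] is real, because [g + h] is, and its frequencies lie in
[y_n >= t > 0]. Then [w ^ 2 = |w| ^ 2] has frequencies in [y_n >= 2 t], so its
averages against suitable kernels vanish and [w = 0] (spec_gt0_real_eq0). Hence
the operator of [m_+] is the conjugate of that of [m_-] by complex conjugation
(plus_conj_minus), and the common norm is the geometric mean.

The functions [g] and [h] are bounded but not integrable, so their frequencies
have to be understood in a weak sense. Instead of distributions a dual
definition is used: [spec_ge d u] says that multiplication by [u] sends the
integrable functions whose inverse Fourier transform vanishes on [c <= y_n] to
those for which it vanishes on [c - d <= y_n]. Products are then immediate, and
Fubini's theorem shows that Fourier integrals have the expected spectrum. The
two vanishing results use kernels that tend to 1 and whose Fourier transform
is supported near [y_n = 0]; they are built from the Fejer kernel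
[(sin x / x) ^ 2], whose Fourier transform has compact support by an elementary
computation with second differences.

The rest is the classical background: the Fourier transform of a test function
is integrable (fourier_decay), so that the multiplier operators are given by
absolutely convergent integrals; and test functions are dense in [L^p]
(test_dense), so that a bound on test functions bounds the extension. *)

(** * Integration of complex-valued functions *)

Section complex_integral.
Context d (T : measurableType d) (R : realType).
Implicit Types (f g : T -> R[i]) (mu : {measure set T -> \bar R}).

Local Notation nc := ComplexField.Normc.normc.

(** Over [lebesgue_rV n] the predicate [cmeas] is convertible to [cmeasurable]
and [cint] to [cintegral]; a general measure is needed for product spaces and
for the line. *)
Definition cmeas f :=
  measurable_fun [set: T] (fun x => complex.Re (f x)) /\
  measurable_fun [set: T] (fun x => complex.Im (f x)).

Definition cintegrable mu f :=
  mu.-integrable [set: T] (fun x => (complex.Re (f x))%:E) /\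
  mu.-integrable [set: T] (fun x => (complex.Im (f x))%:E).

Definition cint mu f : R[i] :=
  Complex (Rintegral mu setT (fun x => complex.Re (f x)))
          (Rintegral mu setT (fun x => complex.Im (f x))).

Lemma Re_mulc (x y : R[i]) : complex.Re (x * y) =
  complex.Re x * complex.Re y - complex.Im x * complex.Im y.
Proof. by case: x y => [a b] [c e]. Qed.

Lemma Im_mulc (x y : R[i]) : complex.Im (x * y) =
  complex.Re x * complex.Im y + complex.Im x * complex.Re y.
Proof. by case: x y => [a b] [c e]. Qed.

Lemma Re_addc (x y : R[i]) : complex.Re (x + y) = complex.Re x + complex.Re y.
Proof. by case: x y => [a b] [c e]. Qed.

Lemma Im_addc (x y : R[i]) : complex.Im (x + y) = complex.Im x + complex.Im y.
Proof. by case: x y => [a b] [c e]. Qed.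

Lemma Re_oppc (x : R[i]) : complex.Re (- x) = - complex.Re x.
Proof. by case: x. Qed.

Lemma Im_oppc (x : R[i]) : complex.Im (- x) = - complex.Im x.
Proof. by case: x. Qed.

Lemma normcE2 (x : R[i]) :
  nc x = Num.sqrt (complex.Re x ^+ 2 + complex.Im x ^+ 2).
Proof. by case: x. Qed.

Lemma normc_sqr (x : R[i]) :
  nc x ^+ 2 = complex.Re x ^+ 2 + complex.Im x ^+ 2.
Proof. by rewrite normcE2 sqr_sqrtr// addr_ge0// sqr_ge0. Qed.

Lemma normc_ge0 (x : R[i]) : 0 <= nc x.
Proof. by rewrite normcE2 sqrtr_ge0. Qed.

Lemma normRe_le (x : R[i]) : `|complex.Re x| <= nc x.
Proof.
by rewrite -ler_sqr ?nnegrE ?normr_ge0 ?normc_ge0// normc_sqr real_normK ?num_real//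
  lerDl sqr_ge0.
Qed.

Lemma normIm_le (x : R[i]) : `|complex.Im x| <= nc x.
Proof.
by rewrite -ler_sqr ?nnegrE ?normr_ge0 ?normc_ge0// normc_sqr real_normK ?num_real//
  lerDr sqr_ge0.
Qed.

Lemma normc_leD (x : R[i]) : nc x <= `|complex.Re x| + `|complex.Im x|.
Proof.
rewrite -ler_sqr ?nnegrE ?normc_ge0 ?addr_ge0// normc_sqr sqrrD.
by rewrite !real_normK ?num_real// lerD2r lerDl mulrn_wge0// mulr_ge0.
Qed.

Lemma normc_conj (x : R[i]) : nc (conjc x) = nc x.
Proof. by rewrite !normcE2; case: x => a b /=; rewrite sqrrN. Qed.

Lemma normcX (x : R[i]) n : nc (x ^+ n) = nc x ^+ n.
Proof.
elim: n => [|n IH]; first by rewrite !expr0 ComplexField.Normc.normc1.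
by rewrite !exprS ComplexField.Normc.normcM IH.
Qed.

Lemma mul_conjc (x : R[i]) : x * conjc x = Complex (nc x ^+ 2) 0.
Proof.
by rewrite normc_sqr; case: x => a b; apply/eqP; rewrite eq_complex /=; apply/andP; split;
  apply/eqP; ring.
Qed.

Lemma cmeasM f g : cmeas f -> cmeas g -> cmeas (fun x => f x * g x).
Proof.
move=> [f1 f2] [g1 g2]; split.
  under eq_fun do rewrite Re_mulc.
  by apply: measurable_funB; apply: measurable_funM.
under eq_fun do rewrite Im_mulc.
by apply: measurable_funD; apply: measurable_funM.
Qed.

Lemma cmeasD f g : cmeas f -> cmeas g -> cmeas (fun x => f x + g x).
Proof.
move=> [f1 f2] [g1 g2]; split.
  by under eq_fun do rewrite Re_addc; apply: measurable_funD.
by under eq_fun do rewrite Im_addc; apply: measurable_funD.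
Qed.

Lemma cmeas_cst (c : R[i]) : cmeas (fun=> c).
Proof. by split; apply: measurable_cst. Qed.

Lemma cmeasX f n : cmeas f -> cmeas (fun x => f x ^+ n).
Proof.
move=> mf; elim: n => [|n IH].
  by under eq_fun do rewrite expr0; apply: cmeas_cst.
by under eq_fun do rewrite exprS; apply: cmeasM.
Qed.

Lemma cmeas_conj f : cmeas f -> cmeas (fun x => conjc (f x)).
Proof.
move=> [f1 f2]; split.
  by rewrite (_ : (fun _ => _) = (fun x => complex.Re (f x)))//; apply/funext => x; case: (f x).
rewrite (_ : (fun _ => _) = (fun x => - complex.Im (f x))).
  exact: measurable_funN.
by apply/funext => x; case: (f x).
Qed.

Lemma cmeas_normc f : cmeas f -> measurable_fun [set: T] (fun x => nc (f x)).
Proof.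
move=> [f1 f2]; under eq_fun do rewrite normcE2.
have ms : measurable_fun [set: R] (@Num.sqrt R).
  by apply: continuous_measurable_fun; apply: sqrt_continuous.
apply: (measurableT_comp ms).
by apply: measurable_funD; apply: measurable_funX.
Qed.

Lemma integrable_scale mu (r : R) (k : T -> R) :
  mu.-integrable [set: T] (fun x => (k x)%:E) ->
  mu.-integrable [set: T] (fun x => (r * k x)%:E).
Proof. by move=> ki; under eq_fun do rewrite EFinM; exact: integrableZl. Qed.

Lemma integrable_measR mu (k : T -> R) :
  mu.-integrable [set: T] (fun x => (k x)%:E) -> measurable_fun [set: T] k.
Proof. by case/integrableP => mk _; exact/measurable_EFinP. Qed.

Lemma cintegrable_cmeas mu f : cintegrable mu f -> cmeas f.
Proof. by move=> [f1 f2]; split; [exact: integrable_measR f1|exact: integrable_measR f2]. Qed.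

Lemma cintegrable_normc mu f : cintegrable mu f ->
  mu.-integrable [set: T] (fun x => (nc (f x))%:E).
Proof.
move=> fi; have mf := cintegrable_cmeas fi; case: fi => f1 f2.
apply: (@le_integrable _ _ _ _ _ _ _ (fun x => `|(complex.Re (f x))%:E| + `|(complex.Im (f x))%:E|)%E) => //.
- by apply/measurable_EFinP; apply: cmeas_normc.
- move=> x _; rewrite /= !lee_fin (ger0_norm (normc_ge0 _)) (le_trans (normc_leD _))//.
  by rewrite ler_norm.
- by apply: integrableD => //; apply: integrable_abse.
Qed.

Lemma integrable_ae_dom mu (k h : T -> R) : measurable_fun [set: T] k ->
  mu.-integrable [set: T] (fun x => (h x)%:E) ->
  {ae mu, forall x, `|k x| <= h x} -> mu.-integrable [set: T] (fun x => (k x)%:E).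
Proof.
move=> mk hi kh; apply/integrableP; split; first exact/measurable_EFinP.
case/integrableP: (hi) => mh hoo; apply: le_lt_trans hoo.
apply: ae_ge0_le_integral => //.
- by apply: measurableT_comp => //; exact/measurable_EFinP.
- exact: measurableT_comp.
- by apply: filterS kh => x kx _; rewrite lee_fin (le_trans kx)// ler_norm.
Qed.

Lemma cintegrable_dom mu f (h : T -> R) : cmeas f ->
  mu.-integrable [set: T] (fun x => (h x)%:E) ->
  {ae mu, forall x, nc (f x) <= h x} -> cintegrable mu f.
Proof.
move=> [f1 f2] hi fh; split; apply: (integrable_ae_dom _ hi) => //;
  apply: filterS fh => x; apply: le_trans; [exact: normRe_le|exact: normIm_le].
Qed.

Lemma cintegrableD mu f g : cintegrable mu f -> cintegrable mu g ->
  cintegrable mu (fun x => f x + g x).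
Proof.
move=> [f1 f2] [g1 g2]; split.
  by under eq_fun do rewrite Re_addc EFinD; apply: integrableD.
by under eq_fun do rewrite Im_addc EFinD; apply: integrableD.
Qed.

Lemma cintegrableMb mu f g (M : R) : cintegrable mu f -> cmeas g ->
  {ae mu, forall x, nc (g x) <= M} -> cintegrable mu (fun x => f x * g x).
Proof.
move=> fi mg gM; have mf := cintegrable_cmeas fi.
apply: (@cintegrable_dom _ _ (fun x => M * nc (f x))).
- exact: cmeasM.
- by apply: integrable_scale; apply: cintegrable_normc.
- apply: filterS gM => x gx; rewrite ComplexField.Normc.normcM mulrC.
  by rewrite ler_wpM2r// normc_ge0.
Qed.

Lemma cintegrableZ mu (c : R[i]) f : cintegrable mu f ->
  cintegrable mu (fun x => c * f x).
Proof.
move=> fi; under eq_fun do rewrite mulrC.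
by apply: (@cintegrableMb _ _ _ (nc c)) => //; apply/nearW.
Qed.

Lemma cintegrable_conj mu f : cintegrable mu f ->
  cintegrable mu (fun x => conjc (f x)).
Proof.
move=> fi; apply: (@cintegrable_dom _ _ (fun x => nc (f x))).
- by apply: cmeas_conj; apply: cintegrable_cmeas fi.
- exact: cintegrable_normc.
- by apply/nearW => x; rewrite normc_conj.
Qed.

Lemma cintD mu f g : cintegrable mu f -> cintegrable mu g ->
  cint mu (fun x => f x + g x) = cint mu f + cint mu g.
Proof.
move=> [f1 f2] [g1 g2]; rewrite /cint; apply/eqP; rewrite eq_complex/=; apply/andP; split; apply/eqP.
  by under eq_Rintegral do rewrite Re_addc; rewrite RintegralD.
by under eq_Rintegral do rewrite Im_addc; rewrite RintegralD.
Qed.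

Lemma cintZ mu (c : R[i]) f : cintegrable mu f ->
  cint mu (fun x => c * f x) = c * cint mu f.
Proof.
move=> [f1 f2]; rewrite /cint; apply/eqP; rewrite eq_complex/= Re_mulc Im_mulc/=; apply/andP; split; apply/eqP.
  under eq_Rintegral do rewrite Re_mulc.
  rewrite RintegralB ?RintegralZl//.
    exact: integrable_scale.
  exact: integrable_scale.
under eq_Rintegral do rewrite Im_mulc.
rewrite RintegralD ?RintegralZl//.
  exact: integrable_scale.
exact: integrable_scale.
Qed.

Lemma cint_conj mu f : cintegrable mu f ->
  cint mu (fun x => conjc (f x)) = conjc (cint mu f).
Proof.
move=> [f1 f2]; rewrite /cint/=; congr Complex.
  by congr Rintegral; apply/funext => x; case: (f x).
rewrite -mulN1r -RintegralZl//; congr Rintegral; apply/funext => x.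
by rewrite mulN1r; case: (f x).
Qed.

Lemma cint0 mu : cint mu (fun=> 0) = 0.
Proof. by rewrite /cint/= /Rintegral integral0. Qed.

Lemma cintegrable0 mu : cintegrable mu (fun=> 0).
Proof. by split; apply: integrable0. Qed.

Lemma eq_cint mu f g : f =1 g -> cint mu f = cint mu g.
Proof. by move=> /funext->. Qed.

Lemma ae_eq_cint mu f g : cmeas f -> cmeas g ->
  {ae mu, forall x, f x = g x} -> cint mu f = cint mu g.
Proof.
move=> [f1 f2] [g1 g2] fg; rewrite /cint /Rintegral; congr Complex; congr fine;
  apply: ae_eq_integral => //; try exact/measurable_EFinP;
  by apply: filterS fg => x /= -> _.
Qed.

(** The factor 2 comes from estimating the two components separately. *)
Lemma normc_cint_le mu f : cintegrable mu f ->
  nc (cint mu f) <= 2 * Rintegral mu setT (fun x => nc (f x)).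
Proof.
move=> fi; have ni := cintegrable_normc fi; case: fi => f1 f2.
have H (k : T -> R) : mu.-integrable [set: T] (fun x => (k x)%:E) ->
    (forall x, `|k x| <= nc (f x)) ->
    `|Rintegral mu setT k| <= Rintegral mu setT (fun x => nc (f x)).
  move=> ki kf; apply: (le_trans (le_normr_Rintegral _ _)) => //.
  by apply: le_Rintegral => //; exact: (integrable_abse ki).
apply: (le_trans (normc_leD _)); rewrite mulr_natl mulr2n.
by apply: lerD; apply: H => // x; [apply: normRe_le|apply: normIm_le].
Qed.

Lemma cint_real mu (f : T -> R) :
  cint mu (fun x => Complex (f x) 0) = Complex (Rintegral mu setT f) 0.
Proof. by rewrite /cint/= /Rintegral integral0. Qed.

Lemma cintegrable_real mu (f : T -> R) : mu.-integrable [set: T] (fun x => (f x)%:E) ->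
  cintegrable mu (fun x => Complex (f x) 0).
Proof. by split => //=; apply: integrable0. Qed.

(** Dominated convergence along a sequence of functions of integral zero. *)
Lemma Rintegral_lim0 mu (k_ : nat -> T -> R) (k h : T -> R) :
  (forall j, measurable_fun setT (k_ j)) -> measurable_fun setT k ->
  mu.-integrable [set: T] (fun x => (h x)%:E) ->
  (forall j x, `|k_ j x| <= h x) -> (forall x, (fun j => k_ j x) @ \oo --> k x) ->
  (forall j, Rintegral mu setT (k_ j) = 0) -> Rintegral mu setT k = 0.
Proof.
move=> mk_ mk hi kh cvk k0.
have [|||||ik _ C] := @dominated_convergence _ _ _ mu setT measurableT
  (fun j x => (k_ j x)%:E) (fun x => (k x)%:E) (fun x => (h x)%:E).
- by move=> j; exact/measurable_EFinP.
- exact/measurable_EFinP.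
- by apply/nearW => x _; apply: cvg_EFin; [exact: nearW|exact: cvk].
- by [].
- by apply/nearW => x j _; rewrite lee_fin.
have ik_ j : mu.-integrable setT (fun x => (k_ j x)%:E).
  apply: le_integrable hi => //; first exact/measurable_EFinP.
  by move=> x _; rewrite /= lee_fin (le_trans (kh j x))// ler_norm.
rewrite /Rintegral.
have E : (fun j => \int[mu]_x (k_ j x)%:E)%E = cst 0%E.
  apply/funext => j /=; rewrite -[LHS]fineK ?integrable_fin_num//.
  by congr EFin; exact: k0.
suff -> : (\int[mu]_x (k x)%:E = 0)%E by [].
by apply: (cvg_unique _ C) => //; rewrite E; apply: cvg_cst.
Qed.

Lemma cint_lim0 mu (f_ : nat -> T -> R[i]) f (h : T -> R) :
  (forall k, cmeas (f_ k)) -> cmeas f ->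
  mu.-integrable [set: T] (fun x => (h x)%:E) ->
  (forall k x, nc (f_ k x) <= h x) ->
  (forall x, (fun k => complex.Re (f_ k x)) @ \oo --> complex.Re (f x)) ->
  (forall x, (fun k => complex.Im (f_ k x)) @ \oo --> complex.Im (f x)) ->
  (forall k, cint mu (f_ k) = 0) -> cint mu f = 0.
Proof.
move=> mf_ [mf1 mf2] hi fh cvR cvI f0; rewrite /cint; congr Complex.
- apply: (Rintegral_lim0 (k_ := fun j x => complex.Re (f_ j x)) (h := h)) => //.
  + by move=> j; case: (mf_ j).
  + by move=> j x; apply: le_trans (normRe_le _) _.
  + by move=> j; have := f0 j; rewrite /cint => -[].
- apply: (Rintegral_lim0 (k_ := fun j x => complex.Im (f_ j x)) (h := h)) => //.
  + by move=> j; case: (mf_ j).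
  + by move=> j x; apply: le_trans (normIm_le _) _.
  + by move=> j; have := f0 j; rewrite /cint => -[].
Qed.

End complex_integral.

Section complex_fubini.
Context d1 d2 (T1 : measurableType d1) (T2 : measurableType d2) (R : realType).
Variables (m1 : {sigma_finite_measure set T1 -> \bar R})
          (m2 : {sigma_finite_measure set T2 -> \bar R}).
Local Notation nc := ComplexField.Normc.normc.

Lemma measurable_Rintegral_snd (f : T1 * T2 -> R) : measurable_fun setT f ->
  measurable_fun setT (fun x => Rintegral m2 setT (fun y => f (x, y))).
Proof.
move=> mf; have : measurable_fun setT (EFin \o f) by exact/measurable_EFinP.
rewrite (_ : (fun x => _) = fine \o fubini_F m2 (EFin \o f))//.
move: (EFin \o f) => g mg.
have mF : measurable_fun setT (fubini_F m2 g).
  rewrite (_ : fubini_F _ _ = fun x => (fubini_F m2 (g^\+)%E x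
      - fubini_F m2 (g^\-)%E x)%E); last first.
    apply/funext=> x; rewrite [LHS]integralE.
    under eq_integral do rewrite funepos_comp/=.
    by under [X in (_ - X)%E = _]eq_integral do rewrite funeneg_comp/=.
  by apply: emeasurable_funB; apply: measurable_fun_fubini_tonelli_F => //;
    [exact: measurable_funepos|exact: measurable_funeneg].
exact: (measurableT_comp (fine_measurable measurableT) mF).
Qed.

Lemma Rintegral_prod1 (f : T1 * T2 -> R) :
  (m1 \x m2)%E.-integrable setT (fun z => (f z)%:E) ->
  m1.-integrable setT (fun x => (Rintegral m2 setT (fun y => f (x, y)))%:E) /\
  Rintegral m1 setT (fun x => Rintegral m2 setT (fun y => f (x, y))) =
  Rintegral (m1 \x m2)%E setT f.
Proof.
move=> fi; have Fi := integrable_fubini_F fi.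
have E : ae_eq m1 setT (fun x => (Rintegral m2 setT (fun y => f (x, y)))%:E)
    (fubini_F m2 (fun z => (f z)%:E)).
  apply: filterS (integrable_ae measurableT Fi) => x Fx _.
  by rewrite /Rintegral fineK// Fx.
have mE : measurable_fun setT (fun x => (Rintegral m2 setT (fun y => f (x, y)))%:E).
  apply/measurable_EFinP; apply: measurable_Rintegral_snd.
  exact: integrable_measR fi.
have mF := measurable_int _ Fi.
split.
  apply/integrableP; split => //; case/integrableP: Fi => _; apply: le_lt_trans.
  rewrite le_eqVlt; apply/orP; left; apply/eqP; apply: ae_eq_integral => //.
  - exact: measurableT_comp.
  - exact: measurableT_comp.
  - by apply: filterS E => x + _ => ->.
by rewrite /Rintegral (ae_eq_integral _ _ _ mE mF E)// integral12_prod_meas1.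
Qed.

End complex_fubini.

Section complex_fubini.
Context d1 d2 (T1 : measurableType d1) (T2 : measurableType d2) (R : realType).
Variables (m1 : {sigma_finite_measure set T1 -> \bar R})
          (m2 : {sigma_finite_measure set T2 -> \bar R}).
Local Notation nc := ComplexField.Normc.normc.

Lemma Rintegral_fubini (f : T1 * T2 -> R) :
  (m1 \x m2)%E.-integrable setT (fun z => (f z)%:E) ->
  Rintegral m1 setT (fun x => Rintegral m2 setT (fun y => f (x, y))) =
  Rintegral m2 setT (fun y => Rintegral m1 setT (fun x => f (x, y))).
Proof.
move=> fi; have [_ ->] := Rintegral_prod1 fi.
have mf := measurable_int _ fi.
have mswap : measurable_fun setT (fun z : T2 * T1 => (z.2, z.1)).
  by apply: measurable_fun_pair; [exact: measurable_snd|exact: measurable_fst].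
have fi' : (m2 \x m1)%E.-integrable setT (fun z => (f (z.2, z.1))%:E).
  apply/integrable12ltyP; first exact: (measurableT_comp mf mswap).
  by move/integrable21ltyP : fi; apply.
have [_ /= ->] := Rintegral_prod1 fi'.
by rewrite /Rintegral -(integral12_prod_meas1 fi) -(integral12_prod_meas1 fi') Fubini.
Qed.

Lemma cmeas_cint_snd (f : T1 * T2 -> R[i]) : cmeas f ->
  cmeas (fun x => cint m2 (fun y => f (x, y))).
Proof.
by move=> [f1 f2]; split; [apply: (measurable_Rintegral_snd _ f1)|apply: (measurable_Rintegral_snd _ f2)].
Qed.

Lemma cint_prod1 (f : T1 * T2 -> R[i]) : cintegrable (m1 \x m2)%E f ->
  cint m1 (fun x => cint m2 (fun y => f (x, y))) = cint (m1 \x m2)%E f.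
Proof.
by move=> [f1 f2]; congr Complex; [case: (Rintegral_prod1 f1)|case: (Rintegral_prod1 f2)].
Qed.

Lemma cint_fubini (f : T1 * T2 -> R[i]) : cintegrable (m1 \x m2)%E f ->
  cint m1 (fun x => cint m2 (fun y => f (x, y))) =
  cint m2 (fun y => cint m1 (fun x => f (x, y))).
Proof.
by move=> [f1 f2]; congr Complex; [apply: (Rintegral_fubini f1)|apply: (Rintegral_fubini f2)].
Qed.

Lemma integrable_prodM (h : T1 -> R) (k : T2 -> R) :
  m1.-integrable setT (fun x => (h x)%:E) -> m2.-integrable setT (fun x => (k x)%:E) ->
  (m1 \x m2)%E.-integrable setT (fun z => (h z.1 * k z.2)%:E).
Proof.
move=> hi ki.
have mh : measurable_fun setT h by exact: integrable_measR hi.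
have mk : measurable_fun setT k by exact: integrable_measR ki.
apply/integrable12ltyP.
  apply/measurable_EFinP; apply: measurable_funM.
    exact: (measurableT_comp mh measurable_fst).
  exact: (measurableT_comp mk measurable_snd).
under eq_integral => x _.
  under eq_integral => y _ do rewrite /= normrM EFinM.
  rewrite ge0_integralZl//; last first.
    by apply/measurable_EFinP; exact: measurableT_comp.
  over.
rewrite ge0_integralZr//=; last 2 first.
- by apply/measurable_EFinP; exact: measurableT_comp.
- by apply: integral_ge0.
case/integrableP: hi => _ hi; case/integrableP: ki => _ ki.
by rewrite lte_mul_pinfty// ?integral_ge0// ge0_fin_numE// integral_ge0.
Qed.

Lemma cmeas_fst (f : T1 -> R[i]) : cmeas f -> cmeas (fun z : T1 * T2 => f z.1).
Proof.
by move=> [f1 f2]; split; [apply: (measurableT_comp f1)|apply: (measurableT_comp f2)]; exact: measurable_fst.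
Qed.

Lemma cmeas_snd (f : T2 -> R[i]) : cmeas f -> cmeas (fun z : T1 * T2 => f z.2).
Proof.
by move=> [f1 f2]; split; [apply: (measurableT_comp f1)|apply: (measurableT_comp f2)]; exact: measurable_snd.
Qed.

Lemma cmeas_pair1 (E : T1 * T2 -> R[i]) x : cmeas E -> cmeas (fun y => E (x, y)).
Proof.
by move=> [f1 f2]; split; [apply: (measurableT_comp f1)|apply: (measurableT_comp f2)];
  exact: measurable_pair1.
Qed.

Lemma cmeas_pair2 (E : T1 * T2 -> R[i]) y : cmeas E -> cmeas (fun x => E (x, y)).
Proof.
by move=> [f1 f2]; split; [apply: (measurableT_comp f1)|apply: (measurableT_comp f2)];
  exact: measurable_pair2.
Qed.

(** The Fubini exchange for two integrable functions coupled by a bounded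
kernel [E]; below, [E] is a character of the scalar product. *)
Lemma cint_kernel_swap (k : T1 -> R[i]) (phi : T2 -> R[i]) (E : T1 * T2 -> R[i]) :
  cintegrable m1 k -> cintegrable m2 phi -> cmeas E -> (forall z, nc (E z) <= 1) ->
  cint m1 (fun x => k x * cint m2 (fun s => phi s * E (x, s))) =
  cint m2 (fun s => phi s * cint m1 (fun x => k x * E (x, s))).
Proof.
move=> ki pi_ mE E1; pose f z := k z.1 * phi z.2 * E z.
have fi : cintegrable (m1 \x m2)%E f.
  apply: (cintegrable_dom _ (integrable_prodM (cintegrable_normc ki) (cintegrable_normc pi_))).
    apply: cmeasM => //; apply: cmeasM.
      exact/cmeas_fst/cintegrable_cmeas/ki.
    exact/cmeas_snd/cintegrable_cmeas/pi_.
  apply/nearW => z; rewrite /f !ComplexField.Normc.normcM -[leRHS]mulr1.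
  by rewrite ler_wpM2l// mulr_ge0// normc_ge0.
transitivity (cint m1 (fun x => cint m2 (fun y => f (x, y)))).
  apply: eq_cint => x; rewrite -cintZ.
    by apply: eq_cint => s; rewrite /f/= mulrA.
  by apply: (cintegrableMb (M := 1)) => //; [exact: cmeas_pair1|apply/nearW].
rewrite cint_fubini//; apply: eq_cint => s; rewrite -cintZ.
  by apply: eq_cint => x; rewrite /f/= mulrA [phi s * _]mulrC.
by apply: (cintegrableMb (M := 1)) => //; [exact: cmeas_pair2|apply/nearW].
Qed.

End complex_fubini.

(** * Measure-preserving maps and Lebesgue measure *)

Section measure_preserving.
Context d1 d2 (T1 : measurableType d1) (T2 : measurableType d2) (R : realType).
Variables (m1 : {measure set T1 -> \bar R}) (m2 : {measure set T2 -> \bar R}).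
Variable phi : T1 -> T2.
Hypothesis mphi : measurable_fun [set: T1] phi.
Hypothesis phiE : forall A, measurable A -> m2 A = m1 (phi @^-1` A).

Lemma mp_ge0_integral (f : T2 -> \bar R) : measurable_fun [set: T2] f ->
  (forall y, 0 <= f y)%E -> (\int[m2]_y f y = \int[m1]_x f (phi x))%E.
Proof.
move=> mf f0; rewrite -[RHS](ge0_integral_pushforward mphi m1 measurableT mf)//.
by apply: eq_measure_integral => A mA _; rewrite phiE.
Qed.

Lemma mp_integral (f : T2 -> \bar R) : measurable_fun [set: T2] f ->
  (\int[m2]_y f y = \int[m1]_x f (phi x))%E.
Proof.
move=> mf; rewrite integralE [in RHS]integralE.
under [X in _ = (X - _)%E]eq_integral do rewrite funepos_comp/=.
under [X in _ = (_ - X)%E]eq_integral do rewrite funeneg_comp/=.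
by congr (_ - _)%E; apply: mp_ge0_integral => //;
  [exact: measurable_funepos|exact: measurable_funeneg].
Qed.

Lemma mp_integrable (f : T2 -> R) : measurable_fun [set: T2] f ->
  m1.-integrable setT (fun x => (f (phi x))%:E) <-> m2.-integrable setT (fun y => (f y)%:E).
Proof.
move=> mf; have mfp := measurableT_comp mf mphi.
have E : (\int[m2]_y `|(f y)%:E| = \int[m1]_x `|(f (phi x))%:E|)%E.
  apply: (mp_ge0_integral (f := fun y => `|(f y)%:E|%E)) => //.
  by apply: measurableT_comp => //; exact/measurable_EFinP.
by split => /integrableP[_]; [rewrite -E|rewrite E] => fi; apply/integrableP; split => //;
  exact/measurable_EFinP.
Qed.

Lemma mp_Rintegral (f : T2 -> R) : measurable_fun [set: T2] f ->
  Rintegral m2 setT f = Rintegral m1 setT (fun x => f (phi x)).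
Proof.
move=> mf; rewrite /Rintegral (mp_integral (f := fun y => (f y)%:E))//.
exact/measurable_EFinP.
Qed.

Lemma mp_cint (f : T2 -> R[i]) : cmeas f -> cint m2 f = cint m1 (fun x => f (phi x)).
Proof. by move=> [f1 f2]; congr Complex; rewrite mp_Rintegral. Qed.

Lemma mp_cmeas (f : T2 -> R[i]) : cmeas f -> cmeas (fun x => f (phi x)).
Proof. by move=> [f1 f2]; split; [apply: (measurableT_comp f1)|apply: (measurableT_comp f2)]. Qed.

Lemma mp_cintegrable (f : T2 -> R[i]) : cmeas f ->
  cintegrable m1 (fun x => f (phi x)) <-> cintegrable m2 f.
Proof.
move=> [f1 f2]; split=> -[]; rewrite /cintegrable.
  by move=> /(mp_integrable f1) ? /(mp_integrable f2).
by move=> /(mp_integrable f1) ? /(mp_integrable f2).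
Qed.

Lemma mp_ae (P : T2 -> Prop) : {ae m2, forall y, P y} -> {ae m1, forall x, P (phi x)}.
Proof.
move=> [N [mN N0 subN]]; exists (phi @^-1` N); split.
- by rewrite -[X in measurable X]setTI; exact: mphi.
- by rewrite -phiE.
- by move=> x /= Px; apply: subN.
Qed.

End measure_preserving.

Section lebesgue_line.
Context (R : realType).
Local Notation leb := (@lebesgue_measure R).

(** It is enough to compare the two measures on half-open intervals. *)
Lemma lebesgue_translation (a : R) A : measurable A ->
  leb A = leb ((fun x => x + a) @^-1` A).
Proof.
have m : measurable_fun [set: measurableTypeR R] (fun x : measurableTypeR R => x + a : measurableTypeR R).
  by apply: measurable_funD.
pose nu := pushforward leb (fun x : measurableTypeR R => x + a : measurableTypeR R).
move=> mA; apply: (@lebesgue_measure_unique _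
  (measure_function_pushforward__canonical__measure_function_Measure leb m)) => //= _ [[u v]] _ <-.
rewrite /pushforward.
rewrite (_ : _ @^-1` _ = `]u - a, v - a]%classic).
  by rewrite !lebesgue_measure_itv/= !lte_fin ltrD2r -!EFinB opprB addrA subrK.
by apply/seteqP; split => x /=; rewrite !in_itv/= ltrBlDr lerBrDr.
Qed.

Lemma ge0_integral_dilation (a : R) (f : measurableTypeR R -> \bar R) : 0 < a ->
  measurable_fun [set: measurableTypeR R] f -> (forall x, 0 <= f x)%E ->
  (\int[leb]_x f x = a%:E * \int[leb]_x f (a * x)%R)%E.
Proof.
move=> a0 mf f0.
have m : measurable_fun [set: measurableTypeR R] (fun x : measurableTypeR R => a * x : measurableTypeR R).
  by apply: measurable_funM.
pose p := measure_function_pushforward__canonical__measure_function_Measure leb m.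
pose nu := mscale (NngNum (ltW a0)) p.
transitivity (\int[nu]_x f x)%E.
  apply: eq_measure_integral => A mA _; apply: lebesgue_measure_unique => //= _ [[u v]] _ <-.
  rewrite /nu /mscale/= /pushforward.
  rewrite (_ : _ @^-1` _ = `](u / a), (v / a)]%classic).
    rewrite !lebesgue_measure_itv/= !lte_fin ltr_pM2r ?invr_gt0//.
    case: ifP => _; last by rewrite mule0.
    by rewrite -!EFinB -EFinM; congr EFin; field; rewrite gt_eqF.
  by apply/seteqP; split => x /=; rewrite !in_itv/= ltr_pdivrMr// ler_pdivlMr// ![x * a]mulrC.
rewrite ge0_integral_mscale//=; congr (_ * _)%E.
exact: ge0_integral_pushforward.
Qed.

Lemma lebesgue_reflection A : measurable A -> leb A = leb ((fun x : measurableTypeR R => - x) @^-1` A).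
Proof. by move=> mA; rewrite -[LHS]lebesgue_measureN. Qed.

End lebesgue_line.

(** * The Fejer kernel *)

Section fejer.
Context (R : realType).
Local Notation leb := (@lebesgue_measure R).
Implicit Types x y a : R.

(** The mean value theorem; it gives both [|sin x| <= |x|] and, through
[cos c], the rate at which [sin x / x] tends to 1. *)
Lemma norm_sin_sub x : exists c, `|c| <= `|x| /\ sin x = cos c * x.
Proof.
have pos (z : R) : 0 < z -> exists c, `|c| <= `|z| /\ sin z = cos c * z.
  move=> z0; have [|c + E] := @MVT R sin cos 0 z z0 (fun c _ => is_derive_sin c).
    by apply: continuous_subspaceT => c; exact: continuous_sin.
  rewrite in_itv/= => /andP[c0 cz]; exists c; split.
    by rewrite !gtr0_norm// ltW.
  by move: E; rewrite sin0 !subr0.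
case: (ltgtP x 0) => [x0|/pos//|->]; last by exists 0; rewrite sin0 mulr0.
have [|c [cx E]] := pos (- x); first by rewrite oppr_gt0.
by exists c; rewrite normrN in cx; split => //; move: E; rewrite sinN mulrN => /oppr_inj.
Qed.

Lemma norm_sin_le x : `|sin x| <= `|x|.
Proof.
have [c [_ ->]] := norm_sin_sub x; rewrite normrM -[leRHS]mul1r.
by rewrite ler_wpM2r// cos_max.
Qed.

Definition fejer x : R := if x == 0 then 1 else (sin x / x) ^+ 2.

Lemma fejerE x : fejer x = \1_[set 0] x + sin x ^+ 2 * (x ^+ 2)^-1.
Proof.
rewrite /fejer indicE; case: eqVneq => [->|x0].
  by rewrite mem_set// expr0n invr0 mulr0 addr0.
rewrite memNset ?add0r ?exprMn ?exprVn//; exact/eqP.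
Qed.

Lemma measurable_inv_sqr : measurable_fun [set: measurableTypeR R] (fun x => (x ^+ 2)^-1).
Proof.
rewrite (_ : (fun _ => _) = (fun x => (x ^+ 2) `^ (-1))).
  apply: (measurableT_comp (measurable_powR _)); exact: measurable_funX.
by apply/funext => x; rewrite powR_inv1// sqr_ge0.
Qed.

Lemma measurable_sin_sqr a : measurable_fun [set: measurableTypeR R] (fun x => sin (a * x) ^+ 2 * (x ^+ 2)^-1).
Proof.
apply: measurable_funM; last exact: measurable_inv_sqr.
apply: measurable_funX; apply: measurableT_comp; last exact: measurable_funM.
by apply: continuous_measurable_fun => x; exact: continuous_sin.
Qed.

Lemma measurable_fejer : measurable_fun [set: measurableTypeR R] fejer.
Proof.
rewrite (_ : fejer = fun x => \1_[set 0] x + sin x ^+ 2 * (x ^+ 2)^-1); last first.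
  by apply/funext => x; exact: fejerE.
apply: measurable_funD; first exact: measurable_indic.
have := measurable_sin_sqr 1; by under eq_fun do rewrite mul1r.
Qed.

Lemma fejer_ge0 x : 0 <= fejer x.
Proof. by rewrite /fejer; case: ifP => // _; rewrite sqr_ge0. Qed.

Lemma fejer_le1 x : fejer x <= 1.
Proof.
rewrite /fejer; case: eqVneq => // x0.
rewrite -[_ ^+ 2]real_normK ?num_real// expr_le1// normrM normfV.
by rewrite ler_pdivrMr ?normr_gt0// mul1r norm_sin_le.
Qed.

Lemma fejer_le x : fejer x <= 2 * (oneDsqr x)^-1.
Proof.
rewrite ler_pdivlMr ?(lt_le_trans ltr01 (oneDsqr_ge1 _))// /oneDsqr.
case: (leP (x ^+ 2) 1) => x1.
  rewrite (le_trans (_ : _ <= 1 * (1 + x ^+ 2)))//; last by lra.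
  by rewrite ler_wpM2r// ?fejer_le1// addr_ge0// sqr_ge0.
rewrite /fejer; case: eqVneq => [x0|x0].
  by move: x1; rewrite x0 expr0n/= ltr10.
have s1 : sin x ^+ 2 <= 1.
  by rewrite -[_ ^+ 2]real_normK ?num_real// expr_le1// sin_max.
rewrite exprMn exprVn mulrAC ler_pdivrMr; last by lra.
have : sin x ^+ 2 * (1 + x ^+ 2) <= 1 * (1 + x ^+ 2) by rewrite ler_wpM2r//; lra.
lra.
Qed.

Lemma fejer_near1 x : `|1 - fejer x| <= x ^+ 2.
Proof.
rewrite /fejer; case: eqVneq => [->|x0]; first by rewrite subrr normr0 expr0n.
have [c [cx ->]] := norm_sin_sub x; rewrite mulfK// -sin2cos2.
rewrite ger0_norm ?sqr_ge0//.
have H (u v : R) : `|u| <= `|v| -> u ^+ 2 <= v ^+ 2.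
  by move=> uv; rewrite -[u ^+ 2]real_normK ?num_real// -[v ^+ 2]real_normK ?num_real// lerXn2r.
by apply: H; apply: le_trans (norm_sin_le _) _.
Qed.

Lemma integrable_oneDsqrV : leb.-integrable setT (fun x => ((oneDsqr x)^-1)%:E).
Proof.
have m : measurable_fun [set: measurableTypeR R] (fun x => ((oneDsqr x)^-1)%:E).
  apply/measurable_EFinP; apply: continuous_measurable_fun; exact: continuous_oneDsqrV.
apply/integrableP; split => //.
under eq_integral => x _.
  rewrite gee0_abs; last by rewrite lee_fin invr_ge0 (le_trans ler01)// oneDsqr_ge1.
  over.
have p0 x : (0 <= ((oneDsqr x)^-1)%:E)%E.
  by rewrite lee_fin invr_ge0 (le_trans ler01)// oneDsqr_ge1.
have -> : [set: R] = `]-oo, 0%R[%classic `|` `[0%R, +oo[%classic.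
  by apply/seteqP; split => // x _ /=; rewrite !in_itv/= andbT; case: ltP; [left|right].
rewrite ge0_integral_setU//; [|exact: measurable_funTS|]; last first.
  apply/disj_setPS => x /=; rewrite !in_itv/= andbT => -[x0].
  by rewrite leNgt x0.
rewrite integral0y_oneDsqr lte_add_pinfty ?ltry//.
apply: (@le_lt_trans _ _ (pi / 2)%:E); last exact: ltry.
rewrite -integral0y_oneDsqr ge0_integration_by_substitution0//.
under [leRHS]eq_integral => x _ do rewrite /oneDsqr sqrrN -/(oneDsqr x).
apply: ge0_subset_integral => //; first exact: measurable_funTS.
by move=> x /=; rewrite !in_itv/=; exact: ltW.
Qed.

Lemma integrable_fejer : leb.-integrable setT (fun x => (fejer x)%:E).
Proof.
apply: (integrable_ae_dom measurable_fejer (integrable_scale 2 integrable_oneDsqrV)).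
by apply/nearW => x; rewrite ger0_norm ?fejer_ge0// fejer_le.
Qed.

Lemma integrable_sin_sqr a : leb.-integrable setT (fun x => (sin (a * x) ^+ 2 * (x ^+ 2)^-1)%:E).
Proof.
apply: (integrable_ae_dom (measurable_sin_sqr a)
  (integrable_scale (2 * (a ^+ 2 + 1)) integrable_oneDsqrV)).
apply/nearW => x; rewrite ger0_norm; last by rewrite mulr_ge0// ?invr_ge0 sqr_ge0.
have sq (u v : R) : `|u| <= `|v| -> u ^+ 2 <= v ^+ 2.
  by move=> uv; rewrite -[u ^+ 2]real_normK ?num_real// -[v ^+ 2]real_normK ?num_real// lerXn2r.
have s1 : sin (a * x) ^+ 2 <= 1 by rewrite -[leRHS](expr1n _ 2); apply: sq; rewrite normr1 sin_max.
have s2 : sin (a * x) ^+ 2 <= a ^+ 2 * x ^+ 2 by rewrite -exprMn; apply: sq; exact: norm_sin_le.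
have [->|x0] := eqVneq x 0.
  by rewrite mulr0 sin0 expr0n mul0r /oneDsqr expr0n addr0 invr1 mulr1; nra.
have x20 : 0 < x ^+ 2 by rewrite exprn_even_gt0.
rewrite ler_pdivrMr// mulrAC ler_pdivlMr; last by rewrite /oneDsqr; lra.
rewrite /oneDsqr; nra.
Qed.

Local Notation S a := (Rintegral leb setT (fun x => sin (a * x) ^+ 2 * (x ^+ 2)^-1)).

(** The substitution [x := x / |a|]. *)
Lemma sin_sqr_dilation_integral a : S a = `|a| * S 1.
Proof.
wlog a0 : a / 0 < a => [H|].
  have [a0|a0|->] := ltgtP a 0; [|exact: H|]; last first.
    rewrite normr0 mul0r /Rintegral; under eq_integral do rewrite mul0r sin0 expr0n mul0r.
    by rewrite integral0.
  rewrite -normrN -H ?oppr_gt0//; congr Rintegral; apply/funext => x.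
  by rewrite mulNr sinN sqrrN.
rewrite gtr0_norm// /Rintegral -[X in X * _]/(fine a%:E) -fineM//; last first.
  apply: integrable_fin_num => //; exact: integrable_sin_sqr.
congr fine; rewrite [in RHS](ge0_integral_dilation a0); first last.
- by move=> x; rewrite lee_fin mulr_ge0// ?invr_ge0 sqr_ge0.
- by apply/measurable_EFinP; exact: measurable_sin_sqr.
rewrite muleA -EFinM -ge0_integralZl//.
- apply: eq_integral => x _; rewrite -EFinM; congr EFin; rewrite mul1r [(a * x) ^+ 2]exprMn.
  move: (sin (a * x) ^+ 2) => u; rewrite (invfM (a ^+ 2)) -expr2 mulrCA !mulrA.
  by congr (_ / _); rewrite -[u * a * a]mulrA -expr2 mulfK// sqrf_eq0 gt_eqF.
- apply/measurable_EFinP.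
  apply: (measurableT_comp (measurable_sin_sqr 1)); exact: measurable_funM.
- by move=> x _; rewrite lee_fin mulr_ge0// ?invr_ge0 sqr_ge0.
- by rewrite lee_fin -expr2 sqr_ge0.
Qed.

(** The Fourier transform of [sin^2 x / x^2] is a second difference of the
function [a |-> |a| S 1], which is affine away from the origin; hence it
vanishes outside [-2, 2]. *)
Lemma fejer_cos y : 2 <= `|y| -> Rintegral leb setT (fun x => fejer x * cos (y * x)) = 0.
Proof.
move=> y2.
have E : Rintegral leb setT (fun x => fejer x * cos (y * x)) =
  2^-1 * S ((y + 2) / 2) + (2^-1 * S ((y - 2) / 2) + (-1) * S (y / 2)).
  have i a c := integrable_scale c (integrable_sin_sqr a).
  rewrite -!RintegralZl//; [|exact: integrable_sin_sqr..].
  rewrite -[X in _ = _ + X]RintegralD//; [|exact: i..].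
  rewrite -RintegralD//; [|exact: i|]; last first.
    by apply: (integrableD measurableT (i _ _) (i _ _)).
  rewrite /Rintegral; congr fine; apply: ae_eq_integral => //.
  - apply/measurable_EFinP; apply: measurable_funM; first exact: measurable_fejer.
    apply: measurableT_comp; last exact: measurable_funM.
    by apply: continuous_measurable_fun => x; exact: continuous_cos.
  - have m c a := measurable_funM (@measurable_cst _ _ _ _ setT c) (measurable_sin_sqr a).
    apply/measurable_EFinP; apply: measurable_funD; first exact: m.
    by apply: measurable_funD; exact: m.
  exists [set 0]; split => //; first exact: lebesgue_measure_set1.
  move=> x /= H; apply: contrapT => x0; apply: H => _; congr EFin.
  have {}x0 : x != 0 by exact/eqP.
  rewrite /fejer (negbTE x0) expr_div_n.
  have -> : sin x ^+ 2 / x ^+ 2 * cos (y * x) = (sin x ^+ 2 * cos (y * x)) / x ^+ 2 by ring.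
  rewrite !mulrA -!mulrDl; congr (_ / _).
  have -> : (y + 2) / 2 * x = y / 2 * x + x by field.
  have -> : (y - 2) / 2 * x = y / 2 * x - x by field.
  have -> : y * x = y / 2 * x + y / 2 * x by field.
  rewrite sinD sinB cosD -!expr2; have := sin2cos2 x; have := sin2cos2 (y / 2 * x).
  by move: (sin (y / 2 * x)) (cos (y / 2 * x)) (sin x) (cos x) => u v s c Hu Hs; nra.
rewrite E !(sin_sqr_dilation_integral (_ / 2)) !normrM normfV (ger0_norm (ler0n _ _)).
case: (leP 0 y) => y0.
  move: y2; rewrite (ger0_norm y0) => y2.
  rewrite (ger0_norm (_ : 0 <= y + 2)); last by lra.
  by rewrite (ger0_norm (_ : 0 <= y - 2)); [field|lra].
move: y2; rewrite (ltr0_norm y0) => y2.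
rewrite (ler0_norm (_ : y + 2 <= 0)); last by lra.
by rewrite (ler0_norm (_ : y - 2 <= 0)); [field|lra].
Qed.

(** The integrand is odd. *)
Lemma fejer_sin y : Rintegral leb setT (fun x => fejer x * sin (y * x)) = 0.
Proof.
have m : measurable_fun [set: measurableTypeR R] (fun x => fejer x * sin (y * x)).
  apply: measurable_funM; first exact: measurable_fejer.
  apply: measurableT_comp; last exact: measurable_funM.
  by apply: continuous_measurable_fun => x; exact: continuous_sin.
have i : leb.-integrable setT (fun x => (fejer x * sin (y * x))%:E).
  apply: (integrable_ae_dom m integrable_fejer); apply/nearW => x.
  by rewrite normrM (ger0_norm (fejer_ge0 _)) -[leRHS]mulr1 ler_wpM2l ?fejer_ge0// sin_max.
have mN : measurable_fun [set: measurableTypeR R] (fun x : measurableTypeR R => - x : measurableTypeR R).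
  exact: measurable_funN.
have := mp_Rintegral mN (@lebesgue_reflection R) m.
under [in X in _ = X -> _]eq_Rintegral => x _.
  rewrite (_ : _ * _ = -1 * (fejer x * sin (y * x))).
    over.
  by rewrite mulrN sinN mulrN mulN1r; congr (- (_ * _)); rewrite /fejer oppr_eq0 sinN invrN mulrNN.
rewrite RintegralZl//; lra.
Qed.

End fejer.

Section fejer_dilation.
Context (R : realType).
Local Notation leb := (@lebesgue_measure R).

Lemma Rintegral_dilation0 (a : R) (f : measurableTypeR R -> R) : 0 < a ->
  leb.-integrable setT (fun x => (f x)%:E) ->
  Rintegral leb setT f = 0 -> Rintegral leb setT (fun x => f (a * x)) = 0.
Proof.
move=> a0 fi f0.
have mf := integrable_measR fi.
have E : (\int[leb]_x (f x)%:E = 0)%E.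
  rewrite -[LHS]fineK ?integrable_fin_num//; congr EFin; exact: f0.
have ma : measurable_fun [set: measurableTypeR R] (fun x : measurableTypeR R => a * x : measurableTypeR R).
  by apply: measurable_funM.
have mfE : measurable_fun [set: measurableTypeR R] (EFin \o f) by exact/measurable_EFinP.
have mfa : measurable_fun [set: measurableTypeR R] (fun x : measurableTypeR R => f (a * x)).
  exact: (measurableT_comp mf ma).
have fia : leb.-integrable setT (fun x => (f (a * x))%:E).
  apply/integrableP; split; first exact/measurable_EFinP.
  case/integrableP: fi => _; rewrite (ge0_integral_dilation a0)//; last first.
    exact: measurableT_comp.
  have : (0 <= \int[leb]_x `|(f (a * x))%:E|)%E by apply: integral_ge0.
  case: (\int[leb]_x `|(f (a * x))%:E|)%E => [r _ _|_|//]; first exact: ltry.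
  by rewrite gt0_muley// lte_fin.
have H : (\int[leb]_x (f x)%:E = a%:E * \int[leb]_x (f (a * x))%:E)%E.
  rewrite integralE [in RHS]integralE muleBr//; last first.
    apply: fin_num_adde_defl; rewrite fin_numN; apply: integrable_fin_num => //.
    exact: integrable_funeneg.
  have ep x : (((fun x => (f (a * x))%:E)^\+) x = ((EFin \o f)^\+) (a * x)%R)%E.
    by rewrite -[LHS]/(funepos ((EFin \o f) \o (fun x => a * x)) x) funepos_comp.
  have en x : (((fun x => (f (a * x))%:E)^\-) x = ((EFin \o f)^\-) (a * x)%R)%E.
    by rewrite -[LHS]/(funeneg ((EFin \o f) \o (fun x => a * x)) x) funeneg_comp.
  under [X in (_ = _ * X - _)%E]eq_integral do rewrite ep.
  under [X in (_ = _ - _ * X)%E]eq_integral do rewrite en.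
  congr (_ - _)%E; apply: ge0_integral_dilation => //.
    exact: measurable_funepos.
  exact: measurable_funeneg.
rewrite /Rintegral; move: H; rewrite E => /esym/eqP.
by rewrite mule_eq0 eqe gt_eqF//= => /eqP ->.
Qed.

End fejer_dilation.

(** * Lebesgue measure on [R^n] *)

Section lebesgue_space.
Context (R : realType).
Local Notation leb := (@lebesgue_measure R).
Local Notation nc := ComplexField.Normc.normc.

Lemma lebesgue_rVS n A : measurable A ->
  lebesgue_rV n.+1 A = ((lebesgue_rV n \x leb)%E (@rV_snoc R n @^-1` A)).
Proof. by []. Qed.

(** By induction on the dimension: the translation of a product is the product
of translations, and a product measure is determined by its values on
rectangles. *)
Lemma lebesgue_rV_translation n (v : 'rV[R]_n) A : measurable A ->
  lebesgue_rV n A = lebesgue_rV n ((fun x => x + v) @^-1` A).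
Proof.
elim: n v A => [|n IH] v A mA.
  by congr (lebesgue_rV 0 _); apply/seteqP; split => x /=; rewrite [v]thinmx0 addr0.
have mt m (w : 'rV[R]_m) : measurable_fun [set: 'rV[R]_m] (fun x => x + w).
  apply: measurable_fun_rV => i; under eq_fun do rewrite mxE.
  by apply: measurable_funD => //; exact: measurable_coord.
have mAv : measurable ((fun x => x + v) @^-1` A) by rewrite -[X in measurable X]setTI; exact: mt.
pose tau (z : 'rV[R]_n * measurableTypeR R) : 'rV[R]_n * measurableTypeR R :=
  (z.1 + (rV_split v).1, z.2 + (rV_split v).2).
have mtau : measurable_fun setT tau.
  apply: measurable_fun_pair; first exact: (measurableT_comp (mt _ _) measurable_fst).
  by apply: measurable_funD => //; exact: measurable_snd.
pose p := measure_function_pushforward__canonical__measure_function_Measure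
   (lebesgue_rV n \x leb)%E mtau.
have mX : measurable (@rV_snoc R n @^-1` A).
  by rewrite -[X in measurable X]setTI; exact: measurable_rV_snoc.
have U : (lebesgue_rV n \x leb)%E (@rV_snoc R n @^-1` A) = p (@rV_snoc R n @^-1` A).
  apply: product_measure_unique mX.
  move=> B C mB mC; rewrite /p/= /pushforward.
  rewrite (_ : _ @^-1` _ = ((fun x => x + (rV_split v).1) @^-1` B) `*`
     ((fun x : measurableTypeR R => x + (rV_split v).2 : measurableTypeR R) @^-1` C)); last by [].
  rewrite product_measure1E.
  - by rewrite [in RHS](IH (rV_split v).1 B mB) (lebesgue_translation (rV_split v).2 mC).
  - by rewrite -[X in measurable X]setTI; exact: mt.
  - rewrite -[X in measurable X]setTI.
    have mc : measurable_fun [set: measurableTypeR R]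
      (fun x : measurableTypeR R => x + (rV_split v).2 : measurableTypeR R).
      by apply: measurable_funD.
    exact: mc.
rewrite (lebesgue_rVS mA) (lebesgue_rVS mAv) U.
rewrite -[LHS]/((lebesgue_rV n \x leb)%E (tau @^-1` (@rV_snoc R n @^-1` A))).
congr ((_ \x _)%E _); apply/seteqP.
have E z : rV_snoc (tau z) = rV_snoc z + v.
  by apply/rowP => i; rewrite !mxE /=; case: (unliftP ord_max i) => [j ->|->]; rewrite ?mxE.
by split => z /=; rewrite E.
Qed.

Lemma measurable_shift n (w : 'rV[R]_n) : measurable_fun [set: 'rV[R]_n] (fun x => x + w).
Proof.
apply: measurable_fun_rV => i; under eq_fun do rewrite mxE.
by apply: measurable_funD => //; exact: measurable_coord.
Qed.

(** An integrable function of product form. It dominates the functions of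
bounded support, and it measures the decay of Fourier transforms. *)
Definition weight n (x : 'rV[R]_n) : R := \prod_i (oneDsqr (x ord0 i))^-1.

Lemma oneDsqrV_gt0 (x : R) : 0 < (oneDsqr x)^-1.
Proof. by rewrite invr_gt0 (lt_le_trans ltr01)// oneDsqr_ge1. Qed.

Lemma weight_gt0 n (x : 'rV[R]_n) : 0 < weight x.
Proof. by apply: prodr_gt0 => i _; exact: oneDsqrV_gt0. Qed.

Lemma measurable_weight n : measurable_fun [set: 'rV[R]_n] (@weight n).
Proof.
rewrite /weight; apply: measurable_prod => i _.
have m : measurable_fun [set: measurableTypeR R] (fun x : measurableTypeR R => (oneDsqr x)^-1).
  by apply: continuous_measurable_fun; exact: continuous_oneDsqrV.
exact: (measurableT_comp m (measurable_coord i)).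
Qed.

Lemma snoc_unlift n (z : 'rV[R]_n * measurableTypeR R) (i : 'I_n) :
  rV_snoc z ord0 (lift ord_max i) = z.1 ord0 i.
Proof. by rewrite mxE liftK. Qed.

Lemma snoc_last n (z : 'rV[R]_n * measurableTypeR R) : rV_snoc z ord0 ord_max = z.2.
Proof. by rewrite mxE unlift_none. Qed.

Lemma sum_lift_max (V : nmodType) n (F : 'I_n.+1 -> V) :
  \sum_i F i = \sum_i F (lift ord_max i) + F ord_max.
Proof.
rewrite big_ord_recr/=; congr (_ + _); apply: eq_bigr => i _; congr F.
by apply/val_inj => /=; rewrite /bump leqNgt ltn_ord.
Qed.

Lemma prod_lift_max n (F : 'I_n.+1 -> R) :
  \prod_i F i = \prod_i F (lift ord_max i) * F ord_max.
Proof.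
rewrite big_ord_recr/=; congr (_ * _); apply: eq_bigr => i _; congr F.
by apply/val_inj => /=; rewrite /bump leqNgt ltn_ord.
Qed.

(** Fubini, one coordinate at a time. *)
Lemma integrable_weight n : (lebesgue_rV n).-integrable setT (fun x => (@weight n x)%:E).
Proof.
elim: n => [|n IH].
  apply/integrableP; split; first by apply/measurable_EFinP; exact: measurable_weight.
  rewrite integral_dirac//; last first.
    by do 2 apply: measurableT_comp => //; exact: measurable_weight.
  by rewrite diracT mul1e ltry.
apply/(mp_integrable (@measurable_rV_snoc R n) (@lebesgue_rVS n) (@measurable_weight _)).
apply: eq_integrable (integrable_prodM IH (integrable_oneDsqrV R)) => // z _.
rewrite /weight prod_lift_max snoc_last; congr (_ * _)%:E.
by apply: eq_bigr => i _; rewrite snoc_unlift.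
Qed.

End lebesgue_space.

(** * Functions whose spectrum lies in a half-space *)

Section spectrum.
Context (R : realType) (n : nat).
Local Notation nc := ComplexField.Normc.normc.
Local Notation leb := (@lebesgue_measure R).
Local Notation mu := (@lebesgue_rV R n.+1).
Local Notation vec := 'rV[R]_n.+1.

Lemma expiD (a b : R) : expi (a + b) = expi a * expi b.
Proof.
apply/eqP; rewrite eq_complex /= ?cosD ?sinD; apply/andP; split => //.
by apply/eqP; ring.
Qed.

Lemma normc_expi (a : R) : nc (expi a) = 1.
Proof. by rewrite normcE2 /= cos2Dsin2 sqrtr1. Qed.

Lemma conj_expi (a : R) : conjc (expi a) = expi (- a).
Proof. by rewrite /expi /= cosN sinN. Qed.

Lemma expi0 : expi 0 = 1 :> R[i].
Proof. by rewrite /expi cos0 sin0. Qed.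

Lemma cmeas_expi d (T : measurableType d) (f : T -> R) :
  measurable_fun setT f -> cmeas (fun z => expi (f z)).
Proof.
move=> mf; split => /=.
  have mc : measurable_fun [set: R] (@cos R).
    by apply: continuous_measurable_fun => x; exact: continuous_cos.
  exact: (measurableT_comp mc mf).
have mc : measurable_fun [set: R] (@sin R).
  by apply: continuous_measurable_fun => x; exact: continuous_sin.
exact: (measurableT_comp mc mf).
Qed.

Lemma dotprodDr m (x y z : 'rV[R]_m) : dotprod x (y + z) = dotprod x y + dotprod x z.
Proof. by rewrite /dotprod -big_split/=; apply: eq_bigr => i _; rewrite mxE mulrDr. Qed.

Lemma dotprodZr m (a : R) (x y : 'rV[R]_m) : dotprod x (a *: y) = a * dotprod x y.
Proof. by rewrite /dotprod mulr_sumr; apply: eq_bigr => i _; rewrite mxE mulrCA. Qed.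

Lemma dotprod0r m (x : 'rV[R]_m) : dotprod x 0 = 0.
Proof. by rewrite /dotprod big1// => i _; rewrite mxE mulr0. Qed.

Lemma measurable_dotprod2 m : measurable_fun [set: 'rV[R]_m * 'rV[R]_m]
  (fun z => dotprod z.1 z.2).
Proof.
rewrite /dotprod; apply: measurable_sum => i; apply: measurable_funM.
  exact: (measurableT_comp (measurable_coord i) measurable_fst).
exact: (measurableT_comp (measurable_coord i) measurable_snd).
Qed.

Lemma measurable_dotprod m (y : 'rV[R]_m) : measurable_fun [set: 'rV[R]_m]
  (fun x => dotprod x y).
Proof.
rewrite /dotprod; apply: measurable_sum => i; apply: measurable_funM => //.
exact: measurable_coord.
Qed.

Local Notation chi y x := (expi (2 * pi * dotprod x y)).

Lemma cmeas_chi (y : vec) : cmeas (fun x : vec => chi y x).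
Proof. by apply: cmeas_expi; apply: measurable_funM => //; exact: measurable_dotprod. Qed.

Lemma chiD (x y z : vec) : chi (y + z) x = chi y x * chi z x.
Proof. by rewrite dotprodDr mulrDr expiD. Qed.

(** [annih c k]: the inverse Fourier transform of the integrable function [k]
vanishes on the half-space [c <= y_n]. *)
Definition annih (c : R) (k : vec -> R[i]) := cintegrable mu k /\
  forall y, c <= last_coord y -> cint mu (fun x => k x * chi y x) = 0.

(** The spectrum of the bounded function [u] lies in the half-space [d <= y_n].
The definition is dual, by the shift that multiplication by [u] induces on the
classes [annih c], so that spectra of products are immediately controlled. *)
Definition spec_ge (d : R) (u : vec -> R[i]) := [/\ cmeas u, exists M, forall x, nc (u x) <= M &
  forall c k, annih c k -> annih (c - d) (fun x => k x * u x)].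

Lemma spec_ge1 : spec_ge 0 (fun=> 1).
Proof.
split; first exact: cmeas_cst.
  by exists (nc 1).
by move=> c k; rewrite subr0; under [fun x => k x * 1]eq_fun do rewrite mulr1.
Qed.

Lemma spec_geM a b u v : spec_ge a u -> spec_ge b v -> spec_ge (a + b) (fun x => u x * v x).
Proof.
move=> [mu1 [M1 uM] su] [mv [M2 vM] sv]; split; first exact: cmeasM.
  exists (M1 * M2) => x; rewrite ComplexField.Normc.normcM.
  by apply: ler_pM => //; exact: normc_ge0.
move=> c k /su/sv; rewrite opprD addrA.
by under [fun x => k x * u x * v x]eq_fun do rewrite -mulrA.
Qed.

Lemma spec_geX a u j : spec_ge a u -> spec_ge (j%:R * a) (fun x => u x ^+ j).
Proof.
move=> su; elim: j => [|j IH].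
  by rewrite mul0r; under eq_fun do rewrite expr0; exact: spec_ge1.
rewrite -[j.+1]add1n natrD mulrDl mul1r; under eq_fun do rewrite exprS.
exact: spec_geM.
Qed.

Lemma spec_ge_le a b u : a <= b -> spec_ge b u -> spec_ge a u.
Proof.
move=> ab [mu1 Mu su]; split => // c k /su[ki k0]; split => // y cy.
by apply: k0; apply: le_trans cy; rewrite lerB.
Qed.

Lemma spec_geD a u v : spec_ge a u -> spec_ge a v -> spec_ge a (fun x => u x + v x).
Proof.
move=> [mu1 [M1 uM] su] [mv [M2 vM] sv]; split; first exact: cmeasD.
  by exists (M1 + M2) => x; apply: le_trans (le_normcD _ _) _; exact: lerD.
move=> c k ck; have [ui u0] := su _ _ ck; have [vi v0] := sv _ _ ck.
rewrite (_ : (fun x => _) = (fun x => k x * u x + k x * v x)); last first.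
  by apply/funext => x; rewrite mulrDr.
split; first exact: cintegrableD.
move=> y cy; rewrite (_ : (fun x => _) = (fun x => k x * u x * chi y x + k x * v x * chi y x)).
  have H w : cintegrable mu w -> cintegrable mu (fun x => w x * chi y x).
    move=> wi; apply: (cintegrableMb (M := 1)) => //; first exact: cmeas_chi.
    by apply/nearW => x; rewrite normc_expi.
  by rewrite cintD ?u0 ?v0 ?addr0//; exact: H.
by apply/funext => x; rewrite mulrDl.
Qed.

Lemma spec_geZ a (c : R[i]) u : spec_ge a u -> spec_ge a (fun x => c * u x).
Proof.
move=> su; rewrite -[a]add0r; apply: spec_geM su.
split; [exact: cmeas_cst|by exists (nc c)|].
move=> b k [ki k0]; rewrite subr0; split.
  by under eq_fun do rewrite mulrC; exact: cintegrableZ.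
move=> y /k0 k0y; under eq_cint do rewrite mulrAC mulrC.
rewrite cintZ ?k0y ?mulr0//; apply: (cintegrableMb (M := 1)) => //; first exact: cmeas_chi.
by apply/nearW => x; rewrite normc_expi.
Qed.

Section fourier_integrals.
Variables (eps d : R) (phi : vec -> R[i]).
Hypothesis phii : cintegrable mu phi.
Hypothesis phi_supp : {ae mu, forall s, phi s != 0 -> d <= eps * last_coord s}.

Let E (z : vec * vec) : R[i] := chi (eps *: z.2) z.1.

Let mE : cmeas E.
Proof.
apply: cmeas_expi; apply: measurable_funM => //; under eq_fun do rewrite dotprodZr.
by apply: measurable_funM => //; exact: measurable_dotprod2.
Qed.

(** By Fubini, the class [annih c] is tested on the products of [k] with the
characters of [eps *: s]; such a product translates the inverse Fourier
transform of [k] by a vector whose last coordinate is at least [d]. The sign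
[eps = 1] serves for Fourier integrals, [eps = -1] for their conjugates. *)
Lemma spec_ge_fourier : spec_ge d (fun x => cint mu (fun s => chi (eps *: s) x * phi s)).
Proof.
have mEphi : cmeas (fun z : vec * vec => E z * phi z.2).
  by apply: cmeasM => //; apply: cmeas_snd; exact: cintegrable_cmeas phii.
have iE x : cintegrable mu (fun s => chi (eps *: s) x * phi s).
  under eq_fun do rewrite mulrC; apply: (cintegrableMb (M := 1)) => //.
    exact: (cmeas_pair1 x mE).
  by apply/nearW => s; rewrite normc_expi.
have mc : cmeas (fun x => cint mu (fun s => chi (eps *: s) x * phi s)).
  exact: (cmeas_cint_snd _ mEphi).
have bM x : nc (cint mu (fun s => chi (eps *: s) x * phi s)) <=
    2 * Rintegral mu setT (fun s => nc (phi s)).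
  apply: le_trans (normc_cint_le (iE x)) _.
  by under eq_Rintegral do rewrite ComplexField.Normc.normcM normc_expi mul1r.
split => //; first by eexists; exact: bM.
move=> c k [ki k0]; split.
  by apply: (cintegrableMb _ mc) => //; apply/nearW; exact: bM.
move=> y cy.
have kyi : cintegrable mu (fun x => k x * chi y x).
  apply: (cintegrableMb (M := 1)) => //; first exact: cmeas_chi.
  by apply/nearW => x; rewrite normc_expi.
transitivity (cint mu (fun x => k x * chi y x * cint mu (fun s => phi s * E (x, s)))).
  apply: eq_cint => x; rewrite mulrAC; congr (_ * _); apply: eq_cint => s.
  by rewrite mulrC.
rewrite cint_kernel_swap//; last by move=> z; rewrite normc_expi.
rewrite -[RHS](cint0 mu); apply: ae_eq_cint.
- apply: cmeasM; first exact: cintegrable_cmeas phii.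
  pose ky (x : vec) := k x * chi y x.
  have mky : cmeas ky := cintegrable_cmeas kyi.
  pose E' (z : vec * vec) := E (z.2, z.1).
  have mE' : cmeas E'.
    have msw : measurable_fun setT (fun z : vec * vec => (z.2, z.1)).
      by apply: measurable_fun_pair; [exact: measurable_snd|exact: measurable_fst].
    by case: mE => E1 E2; split; [apply: (measurableT_comp E1 msw)|apply: (measurableT_comp E2 msw)].
  have mky2 : cmeas (fun z : vec * vec => ky z.2) by exact: cmeas_snd.
  exact: (cmeas_cint_snd _ (cmeasM mky2 mE')).
- exact: cmeas_cst.
- apply: filterS phi_supp => s sP; have [->|/sP ds] := eqVneq (phi s) 0; first by rewrite mul0r.
  rewrite (_ : cint mu _ = cint mu (fun x => k x * chi (y + eps *: s) x)); last first.
    by apply: eq_cint => x; rewrite /E/= chiD mulrA.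
  rewrite k0 ?mulr0//.
  have -> : last_coord (y + eps *: s) = last_coord y + eps * last_coord s.
    by rewrite /last_coord !mxE.
  by rewrite -(subrK d c) lerD.
Qed.

End fourier_integrals.

End spectrum.

(** * Integrals of functions with spectrum in a half-space *)

Section vanishing.
Context (R : realType) (n : nat).
Local Notation nc := ComplexField.Normc.normc.
Local Notation leb := (@lebesgue_measure R).
Local Notation mu := (@lebesgue_rV R n.+1).
Local Notation vec := 'rV[R]_n.+1.
Local Notation chi y x := (expi (2 * pi * dotprod x y)).

Lemma fejer_ft (dl b : R) : 0 < dl -> 2 * dl <= `|b| ->
  cint leb (fun t => Complex (fejer (dl * t)) 0 * expi (b * t)) = 0.
Proof.
move=> dl0 b2.
have b2' : 2 <= `|b / dl| by rewrite normrM normfV (gtr0_norm dl0) ler_pdivlMr.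
have bE t : b * t = b / dl * (dl * t) by rewrite mulrA divfK// gt_eqF.
have mf (g : R -> R) : continuous g -> measurable_fun [set: measurableTypeR R] (fun x => fejer x * g (b / dl * x)).
  move=> cg; apply: measurable_funM; first exact: measurable_fejer.
  apply: measurableT_comp; last exact: measurable_funM.
  exact: continuous_measurable_fun.
have fi (g : R -> R) : continuous g -> (forall x, `|g x| <= 1) ->
    leb.-integrable setT (fun x => (fejer x * g (b / dl * x))%:E).
  move=> cg g1; apply: (integrable_ae_dom (mf _ cg) (integrable_fejer R)); apply/nearW => x.
  by rewrite normrM (ger0_norm (fejer_ge0 _)) -[leRHS]mulr1 ler_wpM2l ?fejer_ge0.
rewrite /cint; congr Complex.
  transitivity (Rintegral leb setT (fun t => (fun x => fejer x * cos (b / dl * x)) (dl * t))).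
    by congr Rintegral; apply/funext => t; rewrite Re_mulc/= mul0r subr0 bE.
  apply: (Rintegral_dilation0 dl0 (fi _ (@continuous_cos _) (@cos_max _))).
  exact: fejer_cos.
transitivity (Rintegral leb setT (fun t => (fun x => fejer x * sin (b / dl * x)) (dl * t))).
  by congr Rintegral; apply/funext => t; rewrite Im_mulc/= mul0r addr0 bE.
apply: (Rintegral_dilation0 dl0 (fi _ (@continuous_sin _) (@sin_max _))).
exact: fejer_sin.
Qed.

(** Integrable kernels, bounded by 1 and tending to 1, whose Fourier transform
vanishes where [|y_n| >= 1 / (k + 1)]: the first [n] coordinates are truncated
integrably, the last one carries a dilated Fejer kernel. *)
Definition kern_fst (k : nat) (x : 'rV[R]_n) : R := Order.min 1 (k.+1%:R * weight x).

Definition kern (k : nat) (x : vec) : R :=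
  kern_fst k (rV_split x).1 * fejer (k.+1%:R^-1 * (rV_split x).2).

Lemma kern_fst_ge0 k x : 0 <= kern_fst k x.
Proof. by rewrite /kern_fst le_min ler01 mulr_ge0// ltW// weight_gt0. Qed.

Lemma kern_fst_integrable k : (lebesgue_rV n).-integrable setT (fun x => (kern_fst k x)%:E).
Proof.
have m : measurable_fun [set: 'rV[R]_n] (kern_fst k).
  apply: measurable_minr => //; apply: measurable_funM => //; exact: measurable_weight.
apply: (integrable_ae_dom m (integrable_scale k.+1%:R (integrable_weight R n))).
by apply/nearW => x; rewrite ger0_norm ?kern_fst_ge0// /kern_fst ge_min lexx orbT.
Qed.

Lemma integrable_fejer_dil (dl : R) : 0 < dl ->
  leb.-integrable setT (fun t => (fejer (dl * t))%:E).
Proof.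
move=> dl0.
have m : measurable_fun [set: measurableTypeR R] (fun t => fejer (dl * t)).
  have mM : measurable_fun [set: measurableTypeR R] (fun x : measurableTypeR R => dl * x : measurableTypeR R).
    by apply: measurable_funM.
  exact: (measurableT_comp (@measurable_fejer R) mM).
apply/integrableP; split; first exact/measurable_EFinP.
have /integrableP[mf] := integrable_fejer R.
rewrite (ge0_integral_dilation dl0)//; last exact: measurableT_comp.
have : (0 <= \int[leb]_x `|(fejer (dl * x))%:E|)%E by apply: integral_ge0.
case: (\int[leb]_x `|(fejer (dl * x))%:E|)%E => [r _ _|_|//]; first exact: ltry.
by rewrite gt0_muley// lte_fin.
Qed.

Lemma measurable_kern k : measurable_fun [set: vec] (kern k).
Proof.
apply: measurable_funM.
  apply: (measurableT_comp (integrable_measR (kern_fst_integrable k))).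
  exact: (measurableT_comp measurable_fst (@measurable_rV_split R n)).
have i : 0 < k.+1%:R^-1 :> R by rewrite invr_gt0.
apply: (measurableT_comp (integrable_measR (integrable_fejer_dil i))).
exact: (measurableT_comp measurable_snd (@measurable_rV_split R n)).
Qed.

Lemma kern_snoc k z : kern k (rV_snoc z) = kern_fst k z.1 * fejer (k.+1%:R^-1 * z.2).
Proof. by rewrite /kern rV_snocK. Qed.

Lemma integrable_kern k : mu.-integrable setT (fun x => (kern k x)%:E).
Proof.
have i : 0 < k.+1%:R^-1 :> R by rewrite invr_gt0.
apply/(mp_integrable (@measurable_rV_snoc R n) (@lebesgue_rVS R n) (measurable_kern k)).
apply: eq_integrable (integrable_prodM (kern_fst_integrable k) (integrable_fejer_dil i)) => // z _.
by rewrite kern_snoc.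
Qed.

Lemma kern_ge0 k x : 0 <= kern k x.
Proof. by rewrite mulr_ge0 ?kern_fst_ge0 ?fejer_ge0. Qed.

Lemma kern_le1 k x : kern k x <= 1.
Proof.
rewrite -[leRHS]mulr1; apply: ler_pM; rewrite ?kern_fst_ge0 ?fejer_ge0 ?fejer_le1//.
by rewrite /kern_fst ge_min lexx.
Qed.

Lemma kern_cvg x : (fun k => kern k x) @ \oo --> (1 : R).
Proof.
rewrite -[X in _ --> X]mulr1; apply: cvgM.
  apply: cvg_near_cst.
  have w0 := weight_gt0 (rV_split x).1.
  exists (Num.truncn (weight (rV_split x).1)^-1) => // k /= hk.
  apply/min_idPl; rewrite -ler_pdivrMr// mul1r.
  apply/ltW; apply: lt_le_trans (truncnS_gt _) _.
  by rewrite ler_nat.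
apply/cvgrPdist_le => e e0.
have : (fun k => k.+1%:R^-1 * (rV_split x).2) @ \oo --> (0 * (rV_split x).2 : R).
  by apply: cvgMr_tmp; exact: cvg_harmonic.
rewrite mul0r => /cvgrPdist_le/(_ (Num.min 1 e)); rewrite lt_min ltr01 e0 => /(_ isT).
apply: filterS => k; rewrite sub0r normrN le_min => /andP[h1 h2].
apply: le_trans (fejer_near1 _) _; rewrite -real_normK ?num_real//.
by apply: le_trans h2; rewrite expr2 ler_piMl.
Qed.

Lemma kern_ft k (y : vec) : k.+1%:R^-1 <= last_coord y ->
  cint mu (fun x => Complex (kern k x) 0 * chi y x) = 0.
Proof.
move=> yk; have k0 : 0 < k.+1%:R^-1 :> R by rewrite invr_gt0.
have ik : cintegrable mu (fun x => Complex (kern k x) 0 * chi y x).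
  apply: (cintegrableMb (M := 1) (cintegrable_real (integrable_kern k))); first exact: cmeas_chi.
  by apply/nearW => x; rewrite normc_expi.
have mk := cintegrable_cmeas ik.
rewrite (mp_cint (@measurable_rV_snoc R n) (@lebesgue_rVS R n) mk).
rewrite -cint_prod1; last first.
  by apply/(mp_cintegrable (@measurable_rV_snoc R n) (@lebesgue_rVS R n) mk).
rewrite -[RHS](cint0 (lebesgue_rV n)); apply: eq_cint => u.
set b := 2 * pi * last_coord y.
have fi : cintegrable leb (fun t => Complex (fejer (k.+1%:R^-1 * t)) 0 * expi (b * t)).
  apply: (cintegrableMb (M := 1) (cintegrable_real (integrable_fejer_dil k0))).
    by apply: cmeas_expi; exact: measurable_funM.
  by apply/nearW => x; rewrite normc_expi.
transitivity (cint leb (fun t : measurableTypeR R => Complex (kern_fst k u) 0 * chi (rV_split y).1 u *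
   (Complex (fejer (k.+1%:R^-1 * t)) 0 * expi (b * t)))).
  apply: eq_cint => t; rewrite kern_snoc /dotprod sum_lift_max snoc_last /=.
  rewrite (_ : 2 * pi * _ = 2 * pi * dotprod u (rV_split y).1 + b * t); last first.
    rewrite mulrDr; congr (_ + _); last by rewrite /b /last_coord; ring.
    by congr (_ * _); apply: eq_bigr => i _; rewrite snoc_unlift mxE.
  rewrite expiD; set a := kern_fst k u; set c := fejer _.
  have -> : Complex (a * c) 0 = Complex a 0 * Complex c 0.
    by apply/eqP; rewrite eq_complex /= !mulr0 !mul0r subr0 addr0 !eqxx.
  exact: mulrACA.
rewrite cintZ// fejer_ft ?mulr0//.
rewrite /b !normrM ger0_norm// ger0_norm ?pi_ge0// -!mulrA ler_pM2l//.
have y0 : 0 <= last_coord y by apply: le_trans yk; exact: ltW.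
rewrite (ger0_norm y0) (le_trans yk)// ler_peMl//.
by apply: le_trans (pi_ge2 R); rewrite ler1n.
Qed.

(** The integral of [P] is the value at 0 of its Fourier transform, a
continuous function vanishing on the open half-space below the spectrum. *)
Lemma spec_ge0_cint0 (P : vec -> R[i]) : cintegrable mu P -> spec_ge 0 P -> cint mu P = 0.
Proof.
move=> iP sP; have mP := cintegrable_cmeas iP.
pose kk k (x : vec) := Complex (kern k x) 0 * chi (k.+1%:R^-1 *: @e_last R n) x.
have kkN k x : nc (kk k x) <= 1.
  rewrite /kk ComplexField.Normc.normcM normc_expi mulr1 normcE2/= expr0n/= addr0 sqrtr_sqr.
  by rewrite ger0_norm ?kern_ge0// kern_le1.
have mkk k : cmeas (kk k).
  apply: cmeasM; last exact: cmeas_chi.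
  by split => //=; exact: measurable_kern.
(* The modulation by [1 / (k + 1)] in the last coordinate moves the spectrum of
the kernel to one side of 0. *)
have akk k : annih 0 (kk k).
  split.
    apply: (cintegrableMb (M := 1) (cintegrable_real (integrable_kern k))); first exact: cmeas_chi.
    by apply/nearW => x; rewrite normc_expi.
  move=> y y0; rewrite (_ : (fun x => _) = (fun x => Complex (kern k x) 0 *
      chi (k.+1%:R^-1 *: @e_last R n + y) x)).
    rewrite kern_ft// /last_coord !mxE !eqxx mulr1 lerDl//.
  by apply/funext => x; rewrite chiD mulrA.
have th0 x : (fun k : nat => 2 * pi * dotprod x (k.+1%:R^-1 *: @e_last R n)) @ \oo --> (0 : R).
  have -> : (fun k : nat => 2 * pi * dotprod x (k.+1%:R^-1 *: @e_last R n)) =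
      (fun k : nat => k.+1%:R^-1 * (2 * pi * dotprod x (@e_last R n))).
    by apply/funext => k; rewrite dotprodZr; ring.
  rewrite -[X in _ --> X](mul0r (2 * pi * dotprod x (@e_last R n))).
  by apply: cvgMr_tmp; exact: cvg_harmonic.
have kR x : (fun k => complex.Re (kk k x)) @ \oo --> (1 : R).
  have -> : (fun k => complex.Re (kk k x)) =
      (fun k => kern k x * cos (2 * pi * dotprod x (k.+1%:R^-1 *: @e_last R n))).
    by apply/funext => k; rewrite Re_mulc/= mul0r subr0.
  rewrite -[X in _ --> X]mulr1; apply: cvgM; first exact: kern_cvg.
  rewrite -[X in _ --> X](@cos0 R).
  by apply: (continuous_cvg _ (@continuous_cos R 0)); exact: th0.
have kI x : (fun k => complex.Im (kk k x)) @ \oo --> (0 : R).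
  have -> : (fun k => complex.Im (kk k x)) =
      (fun k => kern k x * sin (2 * pi * dotprod x (k.+1%:R^-1 *: @e_last R n))).
    by apply/funext => k; rewrite Im_mulc/= mul0r addr0.
  rewrite -[X in _ --> X](mulr0 1); apply: cvgM; first exact: kern_cvg.
  rewrite -[X in _ --> X](@sin0 R).
  by apply: (continuous_cvg _ (@continuous_sin R 0)); exact: th0.
apply: (cint_lim0 (f_ := fun k x => kk k x * P x) (h := fun x => nc (P x))) => //.
- by move=> k; exact: cmeasM.
- exact: cintegrable_normc.
- by move=> k x; rewrite ComplexField.Normc.normcM ler_piMl// normc_ge0.
- move=> x.
  have -> : (fun k => complex.Re (kk k x * P x)) = (fun k => complex.Re (kk k x) * complex.Re (P x)
      - complex.Im (kk k x) * complex.Im (P x)) by apply/funext => k; rewrite Re_mulc.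
  rewrite -[X in _ --> X]subr0 -[X in _ --> X - _]mul1r -[X in _ --> _ - X](mul0r (complex.Im (P x))).
  by apply: cvgB; apply: cvgMr_tmp.
- move=> x.
  have -> : (fun k => complex.Im (kk k x * P x)) = (fun k => complex.Re (kk k x) * complex.Im (P x)
      + complex.Im (kk k x) * complex.Re (P x)) by apply/funext => k; rewrite Im_mulc.
  rewrite -[X in _ --> X]addr0 -[X in _ --> X + _]mul1r -[X in _ --> _ + X](mul0r (complex.Re (P x))).
  by apply: cvgD; apply: cvgMr_tmp.
- move=> k; case: sP => _ _ /(_ _ _ (akk k))[_ /(_ 0)].
  rewrite subr0 /last_coord mxE lexx => /(_ isT) <-.
  by apply: eq_cint => x; rewrite dotprod0r mulr0 expi0 mulr1.
Qed.

End vanishing.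

Section real_uniqueness.
Context (R : realType) (n : nat).
Local Notation nc := ComplexField.Normc.normc.
Local Notation mu := (@lebesgue_rV R n.+1).
Local Notation vec := 'rV[R]_n.+1.

Lemma realcM (a b : R) : Complex a 0 * Complex b 0 = Complex (a * b) 0 :> R[i].
Proof. by apply/eqP; rewrite eq_complex/= !mulr0 !mul0r subr0 addr0 !eqxx. Qed.

(** For real [u] the square [u ^+ 2 = |u| ^ 2] has its spectrum in
[2 d <= y_n], away from 0, so its averages vanish. *)
Lemma spec_gt0_real_eq0 (d : R) (u : vec -> R[i]) : 0 < d -> spec_ge d u ->
  (forall x, complex.Im (u x) = 0) -> {ae mu, forall x, u x = 0}.
Proof.
move=> d0 su u_re; have [mu_ [M uM] _] := su.
pose r x := complex.Re (u x).
have mr : measurable_fun [set: vec] r by case: mu_.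
have uE x : u x = Complex (r x) 0 by rewrite /r -[0](u_re x); case: (u x).
have [K Kd] : exists K : nat, forall k, (K <= k)%N -> k.+1%:R^-1 <= 2 * d.
  exists (Num.truncn (2 * d)^-1) => k Kk; rewrite invf_ple ?posrE ?mulr_gt0//.
  by apply/ltW; apply: lt_le_trans (truncnS_gt _) _; rewrite ler_nat.
have H k : (K <= k)%N -> {ae mu, forall x, kern k x * r x ^+ 2 = 0}.
  move=> Kk.
  have ak : annih k.+1%:R^-1 (fun x : vec => Complex (kern k x) 0).
    split; first exact/cintegrable_real/integrable_kern.
    exact: kern_ft.
  have := spec_geM su su; rewrite -mulr2n -[d *+ 2]mulr_natl => -[_ _ /(_ _ _ ak)[i2 /(_ 0)]].
  rewrite /last_coord mxE subr_le0 Kd// => /(_ isT).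
  have -> : (fun x => Complex (kern k x) 0 * (u x * u x) * expi (2 * pi * dotprod x 0)) =
     (fun x => Complex (kern k x * r x ^+ 2) 0).
    apply/funext => x; rewrite dotprod0r mulr0 expi0 mulr1 !uE.
    by rewrite !realcM -expr2.
  rewrite cint_real => -[I0].
  have iK : mu.-integrable setT (fun x => (kern k x * r x ^+ 2)%:E).
    case: i2 => i2 _; apply: eq_integrable i2 => // x _; congr EFin.
    by rewrite !uE !realcM -expr2.
  have : (\int[mu]_x `|(kern k x * r x ^+ 2)%:E| = 0)%E.
    have -> : (fun x => `|(kern k x * r x ^+ 2)%:E|%E) = (fun x => (kern k x * r x ^+ 2)%:E).
      by apply/funext => x; rewrite gee0_abs// lee_fin mulr_ge0 ?kern_ge0// sqr_ge0.
    by rewrite -[LHS]fineK ?integrable_fin_num//; congr EFin.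
  move/(ae_eq_integral_abs mu measurableT (measurable_int _ iK)).
  by apply: filterS => x /= /(_ I)[].
have : {ae mu, forall x, forall k, (K <= k)%N -> kern k x * r x ^+ 2 = 0}.
  apply/ae_foralln => k; have [/H|] := boolP (K <= k)%N; first by apply: filterS => x ->.
  by move=> _; apply/nearW.
apply: filterS => x xk; rewrite uE.
suff -> : r x = 0 by [].
apply/eqP; rewrite -sqrf_eq0; apply/eqP.
have C : (fun k => kern k x * r x ^+ 2) @ \oo --> (1 * r x ^+ 2 : R).
  by apply: cvgMr_tmp; exact: kern_cvg.
rewrite mul1r in C; apply: (cvg_unique _ C) => //.
by apply: cvg_near_cst; exists K => // k /= Kk; exact: xk.
Qed.

End real_uniqueness.

(** * Smooth functions *)

Section smooth_functions.
Context (R : realType) (m : nat).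
Local Notation vec := 'rV[R]_m.
Implicit Types (u v : vec -> R) (k : nat).

Lemma eq_Ck k u v : u =1 v -> Ck k v -> Ck k u.
Proof. by move=> /funext ->. Qed.

Lemma Ck_pred k u : Ck k.+1 u -> Ck k u.
Proof.
elim: k u => [|k IH] u [cu du]; first by [].
by split => // i; have [d1 d2] := du i; split => //; exact: IH.
Qed.

Lemma CkD k u v : Ck k u -> Ck k v -> Ck k (fun x => u x + v x).
Proof.
elim: k u v => [|k IH] u v /=; first by move=> cu cv x; apply: continuousD; [exact: cu|exact: cv].
move=> [cu du] [cv dv]; split; first by move=> x; apply: continuousD; [exact: cu|exact: cv].
move=> i; have [du1 du2] := du i; have [dv1 dv2] := dv i; split.
  by move=> x; exact: derivableD.
by apply: eq_Ck (IH _ _ du2 dv2) => x; rewrite -deriveD.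
Qed.

Lemma CkM k u v : Ck k u -> Ck k v -> Ck k (fun x => u x * v x).
Proof.
elim: k u v => [|k IH] u v; first by move=> cu cv x; apply: continuousM; [exact: cu|exact: cv].
move=> /[dup] Hu [cu du] /[dup] Hv [cv dv].
split; first by move=> x; apply: continuousM; [exact: cu|exact: cv].
move=> i; have [du1 du2] := du i; have [dv1 dv2] := dv i; split.
  by move=> x; exact: derivableM.
apply: (@eq_Ck _ _ (fun x => u x * 'D_(delta_mx ord0 i) v x + v x * 'D_(delta_mx ord0 i) u x)).
  by move=> x; rewrite -[LHS]/('D_(delta_mx ord0 i) (u * v) x) deriveM.
by apply: CkD; apply: IH => //; exact: Ck_pred.
Qed.

Lemma Ck_cst k (c : R) : Ck k (fun _ : vec => c).
Proof.
elim: k c => [|k IH] c; first by move=> x; exact: cst_continuous.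
split; first by move=> x; exact: cst_continuous.
move=> i; split; first by move=> x; exact: derivable_cst.
by apply: (@eq_Ck _ _ (fun=> 0)) (IH 0) => x; rewrite derive_cst.
Qed.

Lemma Ck_prod k (I : Type) (r : seq I) (F : I -> vec -> R) :
  (forall i, Ck k (F i)) -> Ck k (fun x => \prod_(i <- r) F i x).
Proof.
move=> CF; elim: r => [|i r IH].
  by apply: (@eq_Ck _ _ (fun=> 1)); [move=> x; rewrite big_nil|exact: Ck_cst].
by apply: eq_Ck (CkM (CF i) IH) => x; rewrite big_cons.
Qed.

Lemma is_derive_comp_linear (G : R -> R) (l : vec -> R) (x v : vec) (g : R) :
  (forall h y z, l (h *: z + y) = h * l z + l y) ->
  is_derive (l x) 1 G g -> is_derive x v (fun z => G (l z)) (l v * g).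
Proof.
move=> ll [dG eG].
have dF : differentiable G (l x) by exact/derivable1_diffP.
have E : (fun h : R => h^-1 *: (((fun z => G (l z)) \o shift x) (h *: v : vec) - G (l x)))
    = (fun h => h^-1 *: ((G \o shift (l x)) (h *: l v) - G (l x))).
  by apply/funext => h /=; rewrite /shift/= ll.
split.
  by rewrite /derivable E; exact: diff_derivable.
rewrite /derive E -/(derive G (l x) (l v)).
by rewrite deriveE// diff1E//= derive1E eG.
Qed.

(** A family [G] of functions of one variable, each the derivative of the
previous one, composed with a linear form. *)
Lemma Ck_comp_linear (G : nat -> R -> R) (l : vec -> R) :
  (forall j x, is_derive (x : R) 1 (G j) (G j.+1 x)) ->
  continuous l -> (forall h x y, l (h *: y + x) = h * l y + l x) ->
  forall k j, Ck k (fun x => G j (l x)).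
Proof.
move=> dG cl ll.
have cGl j : continuous (fun x => G j (l x)).
  move=> x; apply: continuous_comp; first exact: cl.
  by apply: differentiable_continuous; apply/derivable1_diffP; case: (dG j (l x)).
elim=> [|k IH] j; first exact: cGl.
split; first exact: cGl.
move=> i; have D x := @is_derive_comp_linear (G j) l x (delta_mx ord0 i) _ ll (dG j (l x)).
split; first by move=> x; case: (D x).
apply: (@eq_Ck _ _ (fun x => l (delta_mx ord0 i) * G j.+1 (l x))).
  by move=> x; case: (D x).
by apply: CkM; [exact: Ck_cst|exact: IH].
Qed.

Lemma continuous_coord (i : 'I_m) : continuous (fun x : vec => x ord0 i).
Proof. exact: coord_continuous. Qed.

Lemma dotprod_linearl (h : R) (z x y : vec) :
  dotprod (h *: z + x) y = h * dotprod z y + dotprod x y.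
Proof.
rewrite /dotprod mulr_sumr -big_split/=.
by apply: eq_bigr => i _; rewrite !mxE mulrDl mulrA.
Qed.

Lemma continuous_dotprod (y : vec) : continuous (fun x => dotprod x y).
Proof.
apply: continuous_big => [|i _]; first exact: add_continuous.
by move=> x; apply: continuousM; [exact: continuous_coord|exact: cst_continuous].
Qed.

(** The derivatives of [cos] and [sin] are their translates by multiples of
[pi / 2]. *)
Let Ck_trig (G : R -> R) (dG : forall j x, is_derive (x : R) 1
  (fun x => G (x + j%:R * (pi / 2))) (G (x + j.+1%:R * (pi / 2)))) k (y : vec) (a : R) :
  Ck k (fun x => G (a * dotprod x y)).
Proof.
have cl : continuous (fun x : vec => a * dotprod x y).
  by move=> x; apply: (@continuousM _ _ (fun=> a) (fun z : vec => dotprod z y));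
    [exact: cst_continuous|exact: continuous_dotprod].
have ll h (x z : vec) : a * dotprod (h *: z + x) y = h * (a * dotprod z y) + a * dotprod x y.
  by rewrite dotprod_linearl; ring.
have := Ck_comp_linear dG cl ll k 0.
by apply: eq_Ck => x; rewrite mul0r addr0.
Qed.

Lemma is_derive_shift (G : R -> R) (x c d : R) : is_derive (x + c) 1 G d ->
  is_derive x 1 (fun z => G (z + c)) d.
Proof.
move=> dG; have d1 : is_derive x 1 (fun z : R => z + c) 1.
  by apply: (is_derive_eq (is_deriveD (is_derive_id x 1) (is_derive_cst c x 1))); rewrite addr0.
by have := @is_derive1_comp _ G (fun z => z + c) x _ _ dG d1; rewrite mulr1.
Qed.

Lemma Ck_cos k (y : vec) (a : R) : Ck k (fun x => cos (a * dotprod x y)).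
Proof.
apply: (@Ck_trig (@cos R)) => j x; apply: is_derive_shift.
have -> : x + j.+1%:R * (pi / 2) = x + j%:R * (pi / 2) + pi / 2.
  by rewrite -[j.+1]addn1 natrD mulrDl mul1r addrA.
by rewrite cosDpihalf; exact: is_derive_cos.
Qed.

Lemma Ck_sin k (y : vec) (a : R) : Ck k (fun x => sin (a * dotprod x y)).
Proof.
apply: (@Ck_trig (@sin R)) => j x; apply: is_derive_shift.
have -> : x + j.+1%:R * (pi / 2) = x + j%:R * (pi / 2) + pi / 2.
  by rewrite -[j.+1]addn1 natrD mulrDl mul1r addrA.
by rewrite sinDpihalf; exact: is_derive_sin.
Qed.

End smooth_functions.

(** * A smooth function vanishing on a half-line *)

Section bump.
Context (R : realType).
Variable c : R.
Hypothesis c0 : 0 < c.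

Lemma pow_expR_bound (i : nat) (s : R) : 0 <= s -> s ^+ i * expR (- (c * s)) <= i`!%:R / c ^+ i.
Proof.
move=> s0; rewrite expRN ler_pdivrMr ?expR_gt0// mulrAC ler_pdivlMr ?exprn_gt0//.
rewrite -exprMn [c * s]mulrC -ler_pdivrMl ?ltr0n ?fact_gt0// [leLHS]mulrC.
have sc : 0 <= s * c by rewrite mulr_ge0// ltW.
case: i => [|i].
  by rewrite expr0 fact0 invr1 mulr1 -[leLHS]expR0 ler_expR.
by apply: le_trans (expR_ge1Dxn i sc); rewrite lerDr ler01.
Qed.

Lemma horner_expR_bound (P : {poly R}) : exists C, forall s, 0 <= s ->
  `|P.[s] * expR (- (c * s))| <= C.
Proof.
exists (\sum_(i < size P) `|P`_i| * (i`!%:R / c ^+ i)) => s s0.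
rewrite horner_coef mulr_suml; apply: le_trans (ler_norm_sum _ _ _) _.
apply: ler_sum => i _; rewrite -mulrA normrM ler_wpM2l//.
by rewrite ger0_norm ?pow_expR_bound// mulr_ge0 ?exprn_ge0 ?expR_ge0.
Qed.

(** The derivatives of [exp (- c / x)], continued by 0, have the form
[P (1 / x) exp (- c / x)] with [P] a polynomial. *)
Definition flat (P : {poly R}) (x : R) : R :=
  if 0 < x then P.[x^-1] * expR (- c * x^-1) else 0.

Definition flat_step (P : {poly R}) : {poly R} := 'X^2 * (c *: P - P^`()).

(** At 0 the difference quotient is [O(h)], since the exponential dominates the
powers of [1 / h]. *)
Lemma is_derive_flat (P : {poly R}) (x : R) : is_derive x 1 (flat P) (flat (flat_step P) x).
Proof.
have [x0|x0|->] := ltgtP x 0.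
- rewrite /flat (ltNge 0 x) (ltW x0)/=.
  have d0 : is_derive x 1 (cst 0 : R -> R) 0 by exact: is_derive_cst.
  apply: near_eq_is_derive d0.
  near=> y; have y0 : y < 0 by near: y; exact: lt_nbhsl.
  by rewrite (ltNge 0 y) (ltW y0).
- have x1 : x != 0 by rewrite gt_eqF.
  have dV : is_derive x 1 (fun y : R => y^-1) (- x ^- 2).
    by have := is_deriveV x1 (is_derive_id x 1); rewrite scaler1.
  have dP : is_derive x^-1 1 (horner P) P^`().[x^-1].
    split; first exact: derivable_horner.
    by rewrite -derive1E derivE.
  have d1 := @is_derive1_comp _ (horner P) (fun y => y^-1) x _ _ dP dV.
  have dc : is_derive x 1 ((- c) \*: (fun y : R => y^-1)) ((- c) *: (- x ^- 2)).
    exact: is_deriveZ.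
  have d2 := @is_derive1_comp _ expR _ x _ _ (is_derive_expR _) dc.
  have := is_deriveM d1 d2; rewrite /flat x0 => d3.
  apply: near_eq_is_derive (is_derive_eq d3 _).
    near=> y; have y0 : 0 < y by near: y; exact: lt_nbhsr.
    by rewrite y0.
  by rewrite /flat_step !hornerE /= /GRing.scale/= exprVn; ring.
- have [C HC] := horner_expR_bound ('X^2 * P).
  have C0 : 0 <= C by apply: le_trans (HC 0 (lexx _)).
  have E0 : flat (flat_step P) 0 = 0 by rewrite /flat ltxx.
  have F0 : flat P 0 = 0 by rewrite /flat ltxx.
  have K h : `|h^-1 * flat P h| <= C * `|h|.
    rewrite /flat; case: ifPn => [h0|_]; last by rewrite mulr0 normr0 mulr_ge0.
    rewrite mulNr.
    have := HC h^-1; rewrite invr_ge0 (ltW h0) => /(_ isT).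
    rewrite !hornerE -ler_pdivrMr ?normr_gt0 ?gt_eqF//; apply: le_trans.
    rewrite ler_pdivrMr ?normr_gt0 ?gt_eqF// -normrM le_eqVlt; apply/orP; left; apply/eqP.
    have h1 : h != 0 by rewrite gt_eqF.
    move: (expR _) (P.[_]) => E Q; congr (`| _ |); rewrite expr2.
    by rewrite -[h^-1 * h^-1 * Q]mulrA [RHS]mulrC !mulrA mulfV// mul1r.
  have L : (fun h => h^-1 *: ((flat P \o shift 0) (h *: (1 : R)) - flat P 0)) @ 0^' --> (0 : R).
    apply/cvgrPdist_le => e e0; near=> h.
    rewrite sub0r normrN /= /shift/= addr0 F0 subr0 /GRing.scale/= mulr1.
    apply: le_trans (K h) _.
    have : `|h| <= e / (C + 1).
      near: h; apply: dnbhs0_le; rewrite divr_gt0//; lra.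
    rewrite ler_pdivlMr; last by lra.
    move=> he; apply: le_trans he; rewrite mulrC ler_wpM2l//; lra.
  split; first by apply/cvg_ex; exists 0.
  by rewrite E0; apply/cvg_lim.
Unshelve. all: by end_near. Qed.

End bump.

(** * Test functions *)

Section test_functions.
Context (R : realType) (n : nat).
Local Notation nc := ComplexField.Normc.normc.
Local Notation mu := (@lebesgue_rV R n.+1).
Local Notation vec := 'rV[R]_n.+1.

Lemma coord_le_norm (x : vec) i : `|x ord0 i| <= `|x|.
Proof.
rewrite -[`|x|]/(mx_norm x) mx_normrE.
exact: (@le_bigmax _ _ _ 0 (fun ij : 'I_1 * 'I_n.+1 => `|x ij.1 ij.2|) (ord0, i)).
Qed.

Lemma nbhs_boxP (x : vec) (A : set vec) : nbhs x A ->
  exists2 e : R, 0 < e & forall y : vec, (forall i, `|x ord0 i - y ord0 i| < e) -> A y.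
Proof.
move=> /nbhs_ballP[e /= e0 eA]; exists e => // y xy; apply: eA.
by split => // i j; rewrite (ord1 i); exact: xy.
Qed.

Lemma measurable_box (a b : 'I_n.+1 -> R) :
  measurable [set x : vec | forall i, a i < x ord0 i < b i].
Proof.
have -> : [set x : vec | forall i, a i < x ord0 i < b i] =
    \bigcap_(i in [set: 'I_n.+1]) ((fun x : vec => x ord0 i : measurableTypeR R) @^-1` `]a i, b i[%classic).
  by apply/seteqP; split => x /= H i; have := H i; rewrite ?in_itv//=; apply.
apply: fin_bigcap_measurable => // i _.
by rewrite -[X in measurable X]setTI; exact: measurable_coord.
Qed.

(** An open set is the union of the countably many rational boxes that it
contains. *)
Lemma open_measurable_rV (U : set vec) : open U -> measurable U.
Proof.
move=> oU.
pose r k : R := k.+1%:R^-1.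
pose Q (z : 'rV[rat]_n.+1 * nat) := [set x : vec | forall i, ratr (z.1 ord0 i) - r z.2 < x ord0 i < ratr (z.1 ord0 i) + r z.2].
pose Q' z := if `[< Q z `<=` U >] then Q z else set0.
have -> : U = \bigcup_z Q' z.
  apply/seteqP; split => x; last first.
    by move=> [z _]; rewrite /Q'; case: asboolP => // zU /zU.
  move=> Ux; have [e e0 eU] := nbhs_boxP (oU _ Ux).
  have [k ke] : exists k : nat, 2 * r k < e.
    exists (Num.truncn (2 / e)); rewrite /r.
    rewrite ltr_pdivrMr// mulrC -ltr_pdivrMr//; exact: truncnS_gt.
  have r0 : 0 < r k by rewrite invr_gt0.
  have H i : {q : rat | ratr q \in `]x ord0 i - r k, x ord0 i + r k[%R}.
    by apply: cid; apply: rat_in_itvoo; lra.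
  pose q : 'rV[rat]_n.+1 := \row_i sval (H i).
  have xQ : Q (q, k) x.
    move=> i /=; rewrite mxE; case: (H i) => /= y; rewrite in_itv/=; lra.
  exists (q, k) => //; rewrite /Q'; case: asboolP => // -[] y yQ; apply: eU => i.
  have := xQ i; have := yQ i; rewrite /= ltr_norml; lra.
apply: countable_bigcupT_measurable; first exact: countableP.
by move=> z; rewrite /Q'; case: asboolP => // _; exact: measurable_box.
Qed.

Lemma continuous_measurable_rV (u : vec -> R) : continuous u -> measurable_fun [set: vec] u.
Proof.
move=> cu; apply: (measurability _ (RGenOInfty.measurableE R)).
move=> /= _ [_ [a ->]] <-; rewrite setTI; apply: open_measurable_rV.
by apply: open_comp => // x _; exact: cu.
Qed.

(** Real test functions, with the compactness of the support spelled out in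
coordinates. *)
Definition rtest (u : vec -> R) := (forall k, Ck k u) /\
  exists M : R, forall x, u x != 0 -> forall i, `|x ord0 i| <= M.

Lemma compact_cube (M : R) : compact [set x : vec | forall i, `|x ord0 i| <= M].
Proof.
have := @rV_compact R n.+1 (fun=> `[- M, M]%classic) (fun=> @segment_compact R (- M) M).
congr compact; apply/seteqP; split => x /= H i; have := H i; by rewrite in_itv/= ler_norml.
Qed.

Lemma closed_cube (M : R) : closed [set x : vec | forall i, `|x ord0 i| <= M].
Proof. by apply: compact_closed; [exact: norm_hausdorff|exact: compact_cube]. Qed.

Lemma test_functionP (f : vec -> R[i]) : test_function f <->
  rtest (fun x => complex.Re (f x)) /\ rtest (fun x => complex.Im (f x)).
Proof.
split=> [[Cf cf]|[[C1 [M1 H1]] [C2 [M2 H2]]]].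
  have [M [_ HM]] := compact_bounded cf.
  have B x : f x != 0 -> forall i, `|x ord0 i| <= M + 1.
    move=> fx i; apply: le_trans (coord_le_norm x i) _; apply: HM; first by rewrite ltrDl.
    by apply: subset_closure.
  split; (split; first by move=> k; have [] := Cf k); exists (M + 1) => x fx; apply: B;
    by apply: contra_neq fx => ->.
split=> [k|]; first by split.
apply: (subclosed_compact _ (@compact_cube (Num.max M1 M2))); first exact: closed_closure.
move=> x; rewrite closureEbigcap; apply; split; first exact: closed_cube.
move=> y /= fy i; rewrite le_max.
have [Ry|/H1 -> //] := eqVneq (complex.Re (f y)) 0.
have [Iy|/H2 ->] := eqVneq (complex.Im (f y)) 0; last by rewrite orbT.
by move: fy Ry Iy; case: (f y) => a b /= + a0 b0; rewrite a0 b0 eqxx.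
Qed.

Lemma rtestD u v : rtest u -> rtest v -> rtest (fun x => u x + v x).
Proof.
move=> [Cu [M1 H1]] [Cv [M2 H2]]; split; first by move=> k; exact: CkD.
exists (Num.max M1 M2) => x uv i; rewrite le_max.
have [u0|/H1 -> //] := eqVneq (u x) 0.
have [v0|/H2 ->] := eqVneq (v x) 0; last by rewrite orbT.
by move: uv; rewrite u0 v0 addr0 eqxx.
Qed.

Lemma rtestM u v : (forall k, Ck k v) -> rtest u -> rtest (fun x => u x * v x).
Proof.
move=> Cv [Cu [M H]]; split; first by move=> k; exact: CkM.
by exists M => x uv; apply: H; apply: contraNneq uv => ->; rewrite mul0r.
Qed.

Lemma rtest_continuous u : rtest u -> continuous u.
Proof. by move=> [/(_ 0)]. Qed.

Lemma rtest_measurable u : rtest u -> measurable_fun [set: vec] u.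
Proof. by move=> /rtest_continuous /continuous_measurable_rV. Qed.

Lemma rtest_bounded u : rtest u -> exists2 B : R, 0 <= B & forall x, `|u x| <= B.
Proof.
move=> [Cu [M H]].
have cu : {within [set x : vec | forall i, `|x ord0 i| <= M], continuous u}.
  by apply: continuous_subspaceT; exact: (Cu 0%N).
have [B [_ HB]] := compact_bounded (continuous_compact cu (@compact_cube M)).
exists (`|B| + 1) => [|x]; first by rewrite addr_ge0.
have [->|ux] := eqVneq (u x) 0; first by rewrite normr0 addr_ge0.
apply: HB; first by rewrite ltr_pwDr// ler_norm.
by exists x => //; exact: H.
Qed.

Lemma rtest_derive u i : rtest u -> rtest (fun x => 'D_(delta_mx ord0 i) u x).
Proof.
move=> [Cu [M H]]; split; first by move=> k; have [_ /(_ i)[]] := Cu k.+1.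
exists M => x Dx j; rewrite leNgt; apply: contraNN Dx => xj; apply/eqP.
have e0 : 0 < `|x ord0 j| - M by rewrite subr_gt0.
apply: (@cvg_lim _ _ _ (0^')) => //; apply: cvg_near_cst; near=> h.
have he : `|h| < `|x ord0 j| - M by near: h; exact: dnbhs0_lt.
have z (y : vec) : M < `|y ord0 j| -> u y = 0.
  by move=> My; apply/eqP; apply: contraTT My => /H/(_ j); rewrite leNgt.
rewrite /= (z x)// subr0 z ?scaler0// /shift/= !mxE eqxx/=.
have : `|h * (j == i)%:R| <= `|h|.
  by rewrite normrM ler_piMr//; case: (j == i); rewrite ?normr0 ?normr1.
have := lerB_normD (x ord0 j) (h * (j == i)%:R); rewrite addrC; lra.
Unshelve. all: by end_near. Qed.

(** A bounded measurable function supported in a cube is dominated by a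
multiple of the integrable [weight]. *)
Lemma cube_le_weight (M : R) (x : vec) : (forall i, `|x ord0 i| <= M) ->
  1 <= (1 + M ^+ 2) ^+ n.+1 * weight x.
Proof.
move=> xM; rewrite /weight prodfV ler_pdivlMr ?mul1r; last first.
  by apply: prodr_gt0 => i _; rewrite (lt_le_trans ltr01)// oneDsqr_ge1.
rewrite -[X in _ ^+ X]card_ord -prodr_const; apply: ler_prod => i _.
rewrite (le_trans ler01 (oneDsqr_ge1 _))//= /oneDsqr lerD2l.
by rewrite -[leLHS]real_normK ?num_real// lerXn2r ?nnegrE// (le_trans _ (xM i)).
Qed.

Lemma rtest_le_weight u : rtest u -> exists2 C : R, 0 <= C & forall x, `|u x| <= C * weight x.
Proof.
move=> /[dup] /rtest_bounded[B B0 uB] [_ [M H]].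
exists (B * (1 + M ^+ 2) ^+ n.+1).
  by rewrite mulr_ge0// exprn_ge0// addr_ge0// sqr_ge0.
move=> x; have [->|ux] := eqVneq (u x) 0.
  by rewrite normr0 mulr_ge0 ?(ltW (weight_gt0 _))// mulr_ge0// exprn_ge0// addr_ge0// sqr_ge0.
by rewrite -mulrA (le_trans (uB x))// ler_peMr// cube_le_weight//; exact: H.
Qed.

Lemma rtest_integrable u : rtest u -> mu.-integrable setT (fun x => (u x)%:E).
Proof.
move=> ru; have [C C0 uC] := rtest_le_weight ru.
apply: (integrable_ae_dom (rtest_measurable ru) (integrable_scale C (integrable_weight R n.+1))).
exact/nearW.
Qed.

End test_functions.

(** * Decay of the Fourier transform of a test function *)

Section fourier_decay.
Context (R : realType) (n : nat).
Local Notation nc := ComplexField.Normc.normc.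
Local Notation mu := (@lebesgue_rV R n.+1).
Local Notation vec := 'rV[R]_n.+1.
Implicit Type u : vec -> R.

Lemma Rintegral_translation (v : vec) (f : vec -> R) : measurable_fun setT f ->
  Rintegral mu setT (fun x => f (x + v)) = Rintegral mu setT f.
Proof.
move=> mf; apply/esym.
exact: (mp_Rintegral (measurable_shift v) (@lebesgue_rV_translation R n.+1 v)).
Qed.

Lemma rtest_diff_le u i (B : R) : rtest u -> (forall x, `|'D_(delta_mx ord0 i) u x| <= B) ->
  forall (x : vec) (h : R), 0 < h -> `|u (x + h *: delta_mx ord0 i) - u x| <= B * h.
Proof.
move=> [Cu _] DB x h h0.
pose phi (s : R) := u (x + s *: delta_mx ord0 i).
have d (s : R) : is_derive s 1 phi ('D_(delta_mx ord0 i) u (x + s *: delta_mx ord0 i)).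
  have E : (fun e : R => e^-1 *: ((phi \o shift s) (e *: (1 : R)) - phi s)) =
     (fun e : R => e^-1 *: ((u \o shift (x + s *: delta_mx ord0 i)) (e *: delta_mx ord0 i) -
       u (x + s *: delta_mx ord0 i))).
    apply/funext => e; rewrite /phi /shift/=; congr (_ *: (u _ - _)).
    by rewrite scaler1 scalerDl addrCA.
  have [_ /(_ i)[du _]] := Cu 1%N.
  by split; [rewrite /derivable E; exact: du|rewrite /derive E].
have [|c _] := MVT h0 (fun s _ => d s).
  apply: continuous_subspaceT => s; apply: differentiable_continuous.
  by apply/derivable1_diffP; case: (d s).
rewrite /phi scale0r addr0 subr0 => ->.
by rewrite normrM (gtr0_norm h0) ler_wpM2r// ltW.
Qed.

(** The difference quotients have integral zero by translation invariance, and
they converge boundedly, with supports in a fixed cube. *)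
Lemma Rintegral_derive u i : rtest u ->
  Rintegral mu setT (fun x => 'D_(delta_mx ord0 i) u x) = 0.
Proof.
move=> ru; have rd := rtest_derive i ru.
have [B B0 DB] := rtest_bounded rd.
have [Cu [M HM]] := ru; have mu_ := rtest_measurable ru.
pose M1 := Num.max 0 M + 1.
pose C := B * (1 + M1 ^+ 2) ^+ n.+1.
pose q (j : nat) (x : vec) := j.+1%:R * (u (x + j.+1%:R^-1 *: delta_mx ord0 i) - u x).
have j0 (j : nat) : 0 < j.+1%:R^-1 :> R by rewrite invr_gt0.
have msh j : measurable_fun [set: vec] (fun x => u (x + j.+1%:R^-1 *: delta_mx ord0 i)).
  exact: (measurableT_comp mu_ (measurable_shift _)).
have iu := rtest_integrable ru.
have ish j : mu.-integrable setT (fun x => (u (x + j.+1%:R^-1 *: delta_mx ord0 i))%:E).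
  exact: (proj2 (mp_integrable (measurable_shift _) (@lebesgue_rV_translation R n.+1 _) mu_)).
apply: (@Rintegral_lim0 _ vec R mu q (fun x => 'D_(delta_mx ord0 i) u x) (fun x => C * weight x)).
- by move=> j; apply: measurable_funM => //; exact: measurable_funB.
- exact: rtest_measurable.
- by apply: integrable_scale; exact: integrable_weight.
- move=> j x.
  have qB : `|q j x| <= B.
    rewrite /q normrM ger0_norm// -ler_pdivlMl// mulrC.
    exact: rtest_diff_le.
  have [q0|q0] := eqVneq (q j x) 0.
    by rewrite q0 normr0 mulr_ge0 ?(ltW (weight_gt0 _))// mulr_ge0// exprn_ge0// addr_ge0// sqr_ge0.
  rewrite (le_trans qB)// -mulrA ler_peMr// cube_le_weight// => i'.
  rewrite leNgt; apply: contraNN q0 => xi; rewrite /q.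
  have z (y : vec) : M < `|y ord0 i'| -> u y = 0.
    by move=> My; apply/eqP; apply: contraTT My => /HM/(_ i'); rewrite leNgt.
  have MM : M <= Num.max 0 M by rewrite le_max lexx orbT.
  have xi' : Num.max 0 M + 1 < `|x ord0 i'| by [].
  rewrite !z ?subrr ?mulr0//; first lra.
  rewrite !mxE eqxx/=.
  have : `|j.+1%:R^-1 * (i' == i)%:R| <= 1 :> R.
    rewrite normrM (gtr0_norm (j0 j)) mulr_ile1 ?invf_le1 ?ler1n//.
    by case: (_ == _); rewrite ?normr0 ?normr1.
  have := lerB_normD (x ord0 i') (j.+1%:R^-1 * (i' == i)%:R); lra.
- move=> x; have [_ /(_ i)[/(_ x) du _]] := Cu 1%N.
  have H : (fun j : nat => j.+1%:R^-1 : R) @ \oo --> (0 : R)^'.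
    move=> A /= A0.
    have H1 : \forall j \near \oo, (j.+1%:R^-1 : R) != 0 -> A j.+1%:R^-1.
      exact: (@cvg_harmonic R _ A0).
    by apply: filterS H1 => j; apply; rewrite gt_eqF.
  pose g (h : R) := h^-1 *: ((u \o shift x) (h *: delta_mx ord0 i) - u x).
  have dg : g h @[h --> 0^'] --> 'D_(delta_mx ord0 i) u x by exact: du.
  have -> : (fun j => q j x) = g \o (fun j : nat => j.+1%:R^-1).
    by apply/funext => j; rewrite /q /g /= invrK /GRing.scale/= /shift/= [x + _]addrC.
  exact: (@cvg_comp _ _ _ (fun j : nat => j.+1%:R^-1 : R) g _ _ _ H dg).
- move=> j; rewrite /q RintegralZl//.
    have T := @Rintegral_translation (j.+1%:R^-1 *: delta_mx ord0 i) u mu_.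
    rewrite (_ : Rintegral mu setT _ = 0) ?mulr0//.
    have := RintegralB measurableT (ish j) iu.
    by rewrite T subrr.
  rewrite (_ : _ \o _ = (fun x => (u (x + j.+1%:R^-1 *: delta_mx ord0 i))%:E - (u x)%:E)%E)//.
  exact: integrableB.
Qed.

Local Notation Icos u y := (Rintegral mu setT (fun x => u x * cos (2 * pi * dotprod x y))).
Local Notation Isin u y := (Rintegral mu setT (fun x => u x * sin (2 * pi * dotprod x y))).

Let dirE i (y : vec) : dotprod (delta_mx ord0 i) y = y ord0 i.
Proof.
rewrite /dotprod (bigD1 i)//= mxE !eqxx mul1r big1 ?addr0// => j ji.
by rewrite mxE (negbTE ji) andbF mul0r.
Qed.

Let is_derive_trig (G G' : R -> R) (dG : forall x : R, is_derive x 1 G (G' x)) (x y : vec) i :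
  is_derive x (delta_mx ord0 i) (fun x => G (2 * pi * dotprod x y))
    (2 * pi * y ord0 i * G' (2 * pi * dotprod x y)).
Proof.
have ll h (a b : vec) : 2 * pi * dotprod (h *: b + a) y = h * (2 * pi * dotprod b y) + 2 * pi * dotprod a y.
  by rewrite dotprod_linearl; ring.
have := @is_derive_comp_linear R n.+1 G (fun x => 2 * pi * dotprod x y) x (delta_mx ord0 i)
  _ ll (dG _).
by rewrite dirE.
Qed.

(** Integration by parts against a character. *)
Let by_parts (G G' : R -> R) (CG : forall k y, Ck k (fun x : vec => G (2 * pi * dotprod x y)))
  (CG' : forall k y, Ck k (fun x : vec => G' (2 * pi * dotprod x y)))
  (dG : forall x : R, is_derive x 1 G (G' x)) u i (y : vec) : rtest u ->
  Rintegral mu setT (fun x => 'D_(delta_mx ord0 i) u x * G (2 * pi * dotprod x y)) =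
  - (2 * pi * y ord0 i) * Rintegral mu setT (fun x => u x * G' (2 * pi * dotprod x y)).
Proof.
move=> ru; have rd := rtest_derive i ru.
have ruG : rtest (fun x => u x * G (2 * pi * dotprod x y)) by exact: rtestM.
have ruG' : rtest (fun x => u x * G' (2 * pi * dotprod x y)) by exact: rtestM.
have rdG : rtest (fun x => 'D_(delta_mx ord0 i) u x * G (2 * pi * dotprod x y)) by exact: rtestM.
have := Rintegral_derive i ruG.
have -> : (fun x => 'D_(delta_mx ord0 i) (fun x => u x * G (2 * pi * dotprod x y)) x) =
   (fun x => 2 * pi * y ord0 i * (u x * G' (2 * pi * dotprod x y)) +
      'D_(delta_mx ord0 i) u x * G (2 * pi * dotprod x y)).
  apply/funext => x.
  have [dg eg] := is_derive_trig dG x y i.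
  have [/(_ 1%N)[_ /(_ i)[/(_ x) du _]] _] := ru.
  transitivity (u x *: 'D_(delta_mx ord0 i) (fun x => G (2 * pi * dotprod x y)) x +
    G (2 * pi * dotprod x y) *: 'D_(delta_mx ord0 i) u x); first exact: (deriveM du dg).
  by rewrite eg /GRing.scale/=; ring.
rewrite RintegralD ?RintegralZl//; [lra|exact: rtest_integrable| |exact: rtest_integrable].
by apply: integrable_scale; exact: rtest_integrable.
Qed.

Let derive_cos u i y : rtest u -> Icos ('D_(delta_mx ord0 i) u) y = 2 * pi * y ord0 i * Isin u y.
Proof.
move=> ru; rewrite (by_parts (G' := fun x => - sin x) _ _ _ i y ru).
- rewrite mulNr -mulrN; congr (_ * _).
  have -> : (fun x => u x * - sin (2 * pi * dotprod x y)) =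
      (fun x => -1 * (u x * sin (2 * pi * dotprod x y))) by apply/funext => x; ring.
  rewrite RintegralZl ?mulN1r ?opprK//; apply: rtest_integrable; apply: rtestM ru => k.
  exact: Ck_sin.
- by move=> k z; exact: Ck_cos.
- move=> k z; apply: (@eq_Ck _ _ _ _ (fun x => (-1) * sin (2 * pi * dotprod x z))).
    by move=> x; rewrite mulN1r.
  by apply: CkM; [exact: Ck_cst|exact: Ck_sin].
Qed.

Let derive_sin u i y : rtest u -> Isin ('D_(delta_mx ord0 i) u) y = - (2 * pi * y ord0 i) * Icos u y.
Proof.
move=> ru; apply: (by_parts _ _ _ i y ru).
- by move=> k z; exact: Ck_sin.
- by move=> k z; exact: Ck_cos.
Qed.

Lemma Itrig_bound u : rtest u -> exists C : R, forall y, `|Icos u y| <= C /\ `|Isin u y| <= C.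
Proof.
move=> ru; exists (Rintegral mu setT (fun x => `|u x|)) => y.
have iu := rtest_integrable ru.
have H (v : vec -> R) : (forall k, Ck k v) -> (forall x, `|v x| <= 1) ->
    `|Rintegral mu setT (fun x => u x * v x)| <= Rintegral mu setT (fun x => `|u x|).
  move=> Cv v1; have iuv := rtest_integrable (rtestM Cv ru).
  apply: (le_trans (le_normr_Rintegral _ _)) => //.
  apply: le_Rintegral => //; [exact: (integrable_abse iuv)|exact: (integrable_abse iu)|].
  by move=> x _; rewrite normrM ler_piMr.
split; apply: H => [k|x]; [exact: Ck_cos|exact: cos_max|exact: Ck_sin|exact: sin_max].
Qed.

(** Replacing [u] by [u - D_i D_i u] multiplies both integrals by
[1 + (2 pi y_i) ^ 2]; this is done once for each coordinate in [r]. *)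
Lemma Itrig_decay u (r : seq 'I_n.+1) : rtest u -> exists C : R, forall y,
  `|Icos u y| * \prod_(i <- r) oneDsqr (y ord0 i) <= C /\
  `|Isin u y| * \prod_(i <- r) oneDsqr (y ord0 i) <= C.
Proof.
elim: r u => [|i r IH] u ru.
  by have [C HC] := Itrig_bound ru; exists C => y; rewrite big_nil !mulr1.
have rd := rtest_derive i ru; have rdd := rtest_derive i rd.
pose v x := u x + -1 * 'D_(delta_mx ord0 i) (fun z => 'D_(delta_mx ord0 i) u z) x.
have rdd1 : rtest (fun x => -1 * 'D_(delta_mx ord0 i) (fun z => 'D_(delta_mx ord0 i) u z) x).
  rewrite (_ : (fun x => _) = (fun x => 'D_(delta_mx ord0 i) (fun z => 'D_(delta_mx ord0 i) u z) x * -1)).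
    by apply: rtestM rdd => k; exact: Ck_cst.
  by apply/funext => x; rewrite mulrC.
have rv : rtest v by exact: rtestD.
have [C HC] := IH v rv; exists C => y.
have E (w : vec -> R) : (forall k, Ck k w) -> Rintegral mu setT (fun x => v x * w x) =
   Rintegral mu setT (fun x => u x * w x) - Rintegral mu setT (fun x => 'D_(delta_mx ord0 i) (fun z => 'D_(delta_mx ord0 i) u z) x * w x).
  move=> Cw; rewrite -RintegralB//; [|exact/rtest_integrable/rtestM..].
  by congr Rintegral; apply/funext => x; rewrite /v; ring.
have Ec : Icos v y = (1 + (2 * pi * y ord0 i) ^+ 2) * Icos u y.
  rewrite E; last by move=> k; exact: Ck_cos.
  by rewrite derive_cos// derive_sin//; ring.
have Es : Isin v y = (1 + (2 * pi * y ord0 i) ^+ 2) * Isin u y.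
  rewrite E; last by move=> k; exact: Ck_sin.
  by rewrite derive_sin// derive_cos//; ring.
have D : oneDsqr (y ord0 i) <= 1 + (2 * pi * y ord0 i) ^+ 2.
  rewrite /oneDsqr lerD2l exprMn ler_peMl ?sqr_ge0//.
  have := pi_ge2 R; move: (@pi R) => p p2; nra.
have P0 : 0 <= \prod_(j <- r) oneDsqr (y ord0 j).
  by apply: prodr_ge0 => j _; apply: le_trans (oneDsqr_ge1 _).
have N : `|1 + (2 * pi * y ord0 i) ^+ 2| = 1 + (2 * pi * y ord0 i) ^+ 2.
  by rewrite ger0_norm// addr_ge0// sqr_ge0.
rewrite !big_cons; have [h1 h2] := HC y.
split; [apply: le_trans h1; rewrite Ec|apply: le_trans h2; rewrite Es];
  by rewrite normrM N mulrCA -[leRHS]mulrA ler_wpM2r// mulr_ge0.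
Qed.

Lemma rtest_fourier_decay u : rtest u -> exists2 C : R, 0 <= C & forall y,
  `|Icos u y| <= C * weight y /\ `|Isin u y| <= C * weight y.
Proof.
move=> ru; have [C HC] := Itrig_decay (index_enum 'I_n.+1) ru.
have C0 : 0 <= C.
  by apply: le_trans (HC 0).1; rewrite mulr_ge0//; apply: prodr_ge0 => j _; apply: le_trans (oneDsqr_ge1 _).
exists C => // y; have [h1 h2] := HC y.
have P0 : 0 < \prod_i oneDsqr (y ord0 i).
  by apply: prodr_gt0 => j _; apply: lt_le_trans (oneDsqr_ge1 _).
by rewrite /weight prodfV !ler_pdivlMr.
Qed.

End fourier_decay.

(** * Complex test functions and multiplier operators *)

Section fourier_test.
Context (R : realType) (n : nat).
Local Notation nc := ComplexField.Normc.normc.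
Local Notation mu := (@lebesgue_rV R n.+1).
Local Notation vec := 'rV[R]_n.+1.
Local Notation chi y x := (expi (2 * pi * dotprod x y)).
Implicit Types f g : vec -> R[i].

Lemma test_cmeas f : test_function f -> cmeas f.
Proof. by move=> /test_functionP[f1 f2]; split; exact: rtest_measurable. Qed.

Lemma test_cintegrable f : test_function f -> cintegrable mu f.
Proof. by move=> /test_functionP[f1 f2]; split; exact: rtest_integrable. Qed.

Lemma testM (w : vec -> R[i]) f : (forall k, Ck k (fun x => complex.Re (w x))) ->
  (forall k, Ck k (fun x => complex.Im (w x))) -> test_function f ->
  test_function (fun x => w x * f x).
Proof.
move=> w1 w2 /test_functionP[f1 f2].
have neg (u : vec -> R) : rtest u -> rtest (fun x => - u x).
  move=> ru; rewrite (_ : (fun x => _) = (fun x => u x * -1)).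
    by apply: rtestM ru => k; exact: Ck_cst.
  by apply/funext => x; rewrite mulrN1.
apply/test_functionP; split.
  rewrite (_ : (fun x => _) = (fun x => complex.Re (f x) * complex.Re (w x) +
     - (complex.Im (f x) * complex.Im (w x)))).
    by apply: rtestD; [|apply: neg]; exact: rtestM.
  by apply/funext => x; rewrite Re_mulc; ring.
rewrite (_ : (fun x => _) = (fun x => complex.Im (f x) * complex.Re (w x) +
     (complex.Re (f x) * complex.Im (w x)))).
  by apply: rtestD; exact: rtestM.
by apply/funext => x; rewrite Im_mulc; ring.
Qed.

Lemma testZ (c : R[i]) f : test_function f -> test_function (fun x => c * f x).
Proof. by apply: testM => k; exact: Ck_cst. Qed.

Lemma test_chi (y : vec) f : test_function f -> test_function (fun x => chi y x * f x).
Proof. by apply: testM => k; [exact: Ck_cos|exact: Ck_sin]. Qed.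

Lemma test_conj f : test_function f -> test_function (fun x => conjc (f x)).
Proof.
move=> /test_functionP[f1 f2]; apply/test_functionP; split.
  by rewrite (_ : (fun x => _) = (fun x => complex.Re (f x)))//; apply/funext => x; case: (f x).
rewrite (_ : (fun x => _) = (fun x => complex.Im (f x) * -1)).
  by apply: rtestM f2 => k; exact: Ck_cst.
by apply/funext => x; rewrite mulrN1; case: (f x).
Qed.

Lemma test_Re f : test_function f -> test_function (fun x => Complex (complex.Re (f x)) 0).
Proof.
move=> /test_functionP[f1 f2]; apply/test_functionP; split => //=.
by split; [move=> k; exact: Ck_cst|exists 0 => x; rewrite eqxx].
Qed.

Lemma test_Im f : test_function f -> test_function (fun x => Complex (complex.Im (f x)) 0).
Proof.
move=> /test_functionP[f1 f2]; apply/test_functionP; split => //=.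
by split; [move=> k; exact: Ck_cst|exists 0 => x; rewrite eqxx].
Qed.

Lemma dotprodNr (x y : vec) : dotprod x (- y) = - dotprod x y.
Proof. by rewrite -scaleN1r dotprodZr mulN1r. Qed.

Lemma chiN (y x : vec) : chi (- y) x = expi (- (2 * pi * dotprod x y)).
Proof. by rewrite dotprodNr mulrN. Qed.

Lemma fourierE f (y : vec) : fourier f y = cint mu (fun x => chi (- y) x * f x).
Proof. by apply: eq_cint => x; rewrite chiN. Qed.

Lemma cmeas_chi2 (eps : R) : cmeas (fun z : vec * vec => chi (eps *: z.2) z.1).
Proof.
apply: cmeas_expi; apply: measurable_funM => //; under eq_fun do rewrite dotprodZr.
by apply: measurable_funM => //; exact: measurable_dotprod2.
Qed.

Lemma cintegrable_chi f (y : vec) : cintegrable mu f -> cintegrable mu (fun x => chi y x * f x).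
Proof.
move=> fi; rewrite (_ : (fun x => _) = (fun x => f x * chi y x)); last first.
  by apply/funext => x; rewrite mulrC.
apply: (cintegrableMb (M := 1)) => //; first exact: cmeas_chi.
by apply/nearW => x; rewrite normc_expi.
Qed.

Lemma cmeas_fourier f : cmeas f -> cmeas (fourier f).
Proof.
move=> mf.
have m1 := cmeas_chi2 (-1).
have msw : measurable_fun setT (fun z : vec * vec => (z.2, z.1)).
  by apply: measurable_fun_pair; [exact: measurable_snd|exact: measurable_fst].
have m2 : cmeas (fun z : vec * vec => chi (-1 *: z.1) z.2).
  by case: m1 => E1 E2; split; [exact: (measurableT_comp E1 msw)|exact: (measurableT_comp E2 msw)].
have m3 : cmeas (fun z : vec * vec => f z.2) by exact: cmeas_snd.
have := cmeas_cint_snd mu (cmeasM m2 m3).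
rewrite (_ : (fun x => cint _ _) = fourier f)//.
by apply/funext => y; rewrite fourierE; apply: eq_cint => x; rewrite /= scaleN1r.
Qed.

Lemma fourier_decay f : test_function f -> exists2 C : R, 0 <= C &
  forall y, nc (fourier f y) <= C * weight y.
Proof.
move=> tf; have /test_functionP[f1 f2] := tf.
have [C1 C10 H1] := rtest_fourier_decay f1; have [C2 C20 H2] := rtest_fourier_decay f2.
exists (C1 + C2 + (C1 + C2)) => [|y]; first by rewrite !addr_ge0.
have ic (u : vec -> R) : rtest u -> mu.-integrable setT (fun x => (u x * cos (2 * pi * dotprod x y))%:E).
  by move=> ru; apply: rtest_integrable; apply: rtestM ru => k; exact: Ck_cos.
have is_ (u : vec -> R) : rtest u -> mu.-integrable setT (fun x => (u x * sin (2 * pi * dotprod x y))%:E).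
  by move=> ru; apply: rtest_integrable; apply: rtestM ru => k; exact: Ck_sin.
have [h1 h2] := H1 y; have [h3 h4] := H2 y.
rewrite mulrDl; apply: le_trans (normc_leD _) _; apply: lerD.
  rewrite (_ : complex.Re _ = Rintegral mu setT (fun x => complex.Re (f x) * cos (2 * pi * dotprod x y)) +
     Rintegral mu setT (fun x => complex.Im (f x) * sin (2 * pi * dotprod x y))).
    by rewrite [leRHS]mulrDl; apply: le_trans (ler_normD _ _) _; exact: lerD.
  rewrite -RintegralD//; [|exact: ic|exact: is_].
  rewrite /fourier /cintegral/=; congr Rintegral; apply/funext => x.
  by rewrite Re_mulc/= cosN sinN; ring.
rewrite (_ : complex.Im _ = Rintegral mu setT (fun x => complex.Im (f x) * cos (2 * pi * dotprod x y)) -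
     Rintegral mu setT (fun x => complex.Re (f x) * sin (2 * pi * dotprod x y))).
  by rewrite [leRHS]mulrDl [leRHS]addrC; apply: le_trans (ler_normB _ _) _; exact: lerD.
rewrite -RintegralB//; [|exact: ic|exact: is_].
rewrite /fourier /cintegral/=; congr Rintegral; apply/funext => x.
by rewrite Im_mulc/= cosN sinN; ring.
Qed.

Lemma fourier_cintegrable f : test_function f -> cintegrable mu (fourier f).
Proof.
move=> tf; have [C C0 HC] := fourier_decay tf.
apply: (cintegrable_dom (cmeas_fourier (test_cmeas tf)) (integrable_scale C (integrable_weight R n.+1))).
exact/nearW.
Qed.

Lemma fourierD f g (y : vec) : test_function f -> test_function g ->
  fourier (fun x => f x + g x) y = fourier f y + fourier g y.
Proof.
move=> tf tg; rewrite !fourierE -cintD; [|exact/cintegrable_chi/test_cintegrable..].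
by apply: eq_cint => x; rewrite mulrDr.
Qed.

Lemma fourierZ (c : R[i]) f (y : vec) : test_function f ->
  fourier (fun x => c * f x) y = c * fourier f y.
Proof.
move=> tf; rewrite !fourierE -cintZ; last exact/cintegrable_chi/test_cintegrable.
by apply: eq_cint => x; rewrite mulrCA.
Qed.

Lemma fourier_chi f (v y : vec) :
  fourier (fun x => chi (- v) x * f x) y = fourier f (y + v).
Proof.
rewrite !fourierE; apply: eq_cint => x.
by rewrite mulrA -chiD opprD.
Qed.

Lemma cint_translation (v : vec) (f : vec -> R[i]) : cmeas f ->
  cint mu (fun x => f (x + v)) = cint mu f.
Proof.
move=> mf; apply/esym.
exact: (mp_cint (measurable_shift v) (@lebesgue_rV_translation R n.+1 v)).
Qed.

Lemma cmeas_chi_swap (x : vec) : cmeas (fun y : vec => chi y x).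
Proof.
have := cmeas_pair1 x (cmeas_chi2 1).
by rewrite (_ : (fun y => _) = (fun y => chi y x))//; apply/funext => y; rewrite /= scale1r.
Qed.

Lemma cmeas_shift (v : vec) (w : vec -> R[i]) : cmeas w -> cmeas (fun y : vec => w (y + v)).
Proof. exact: (mp_cmeas (measurable_shift v)). Qed.

Lemma ae_shift (v : vec) (P : vec -> Prop) : {ae mu, forall y, P y} -> {ae mu, forall y, P (y + v)}.
Proof. exact: (mp_ae (measurable_shift v) (@lebesgue_rV_translation R n.+1 v)). Qed.

Definition symbol (m : vec -> R[i]) :=
  cmeas m /\ exists M : R, {ae mu, forall y, nc (m y) <= M}.

Lemma symbol_shift (v : vec) m : symbol m -> symbol (fun y => m (y + v)).
Proof.
by move=> [mm [M mM]]; split; [exact: cmeas_shift|exists M; exact: (ae_shift v mM)].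
Qed.

Lemma symbol_cintegrable m f : symbol m -> test_function f ->
  cintegrable mu (fun y => m y * fourier f y).
Proof.
move=> [mm [M mM]] tf; rewrite (_ : (fun y => _) = (fun y => fourier f y * m y)).
  exact: (cintegrableMb (fourier_cintegrable tf) mm mM).
by apply/funext => y; rewrite mulrC.
Qed.

Lemma multiplier_opE m f x :
  multiplier_op m f x = cint mu (fun y => chi y x * (m y * fourier f y)).
Proof. by apply: eq_cint => y; rewrite mulrA. Qed.

Lemma symbol_cintegrable_chi m f x : symbol m -> test_function f ->
  cintegrable mu (fun y => chi y x * (m y * fourier f y)).
Proof.
move=> sm tf; rewrite (_ : (fun y => _) = (fun y => m y * fourier f y * chi y x)).
  apply: (cintegrableMb (M := 1)) (symbol_cintegrable sm tf) (cmeas_chi_swap x) _.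
  by apply/nearW => y; rewrite normc_expi.
by apply/funext => y; rewrite mulrC.
Qed.

Lemma multiplier_opD m1 m2 f x : symbol m1 -> symbol m2 -> test_function f ->
  multiplier_op (fun y => m1 y + m2 y) f x = multiplier_op m1 f x + multiplier_op m2 f x.
Proof.
move=> s1 s2 tf; rewrite !multiplier_opE -cintD; [|exact: symbol_cintegrable_chi..].
by apply: eq_cint => y; ring.
Qed.

Lemma multiplier_op_addr m f g x : symbol m -> test_function f -> test_function g ->
  multiplier_op m (fun x => f x + g x) x = multiplier_op m f x + multiplier_op m g x.
Proof.
move=> sm tf tg; rewrite !multiplier_opE -cintD; [|exact: symbol_cintegrable_chi..].
by apply: eq_cint => y; rewrite fourierD//; ring.
Qed.

Lemma multiplier_op_scale m (c : R[i]) f x : symbol m -> test_function f ->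
  multiplier_op m (fun x => c * f x) x = c * multiplier_op m f x.
Proof.
move=> sm tf; rewrite !multiplier_opE -cintZ; last exact: symbol_cintegrable_chi.
by apply: eq_cint => y; rewrite fourierZ//; ring.
Qed.

(** Translating a symbol conjugates its operator by a character. *)
Lemma multiplier_op_shift m (v : vec) f x : symbol m -> test_function f ->
  multiplier_op (fun y => m (y - v)) f x =
  chi v x * multiplier_op m (fun x => chi (- v) x * f x) x.
Proof.
move=> sm tf; have tcf := test_chi (- v) tf.
rewrite !multiplier_opE.
rewrite -[LHS](cint_translation v); last first.
  exact: cintegrable_cmeas (symbol_cintegrable_chi x (symbol_shift _ sm) tf).
rewrite -cintZ; last exact: symbol_cintegrable_chi.
by apply: eq_cint => y; rewrite chiD addrK fourier_chi; ring.
Qed.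

Lemma conjcM (a b : R[i]) : conjc (a * b) = conjc a * conjc b.
Proof. exact: rmorphM. Qed.

Lemma conjcD (a b : R[i]) : conjc (a + b) = conjc a + conjc b.
Proof. exact: rmorphD. Qed.

Lemma conjcX (a : R[i]) k : conjc (a ^+ k) = conjc a ^+ k.
Proof. exact: rmorphXn. Qed.

Section spectra.
Variables (m : vec -> R[i]) (d : R).
Hypothesis sm : symbol m.

Lemma spec_multiplier_op f : test_function f ->
  {ae mu, forall y, m y != 0 -> d <= last_coord y} -> spec_ge d (multiplier_op m f).
Proof.
move=> tf md.
have := @spec_ge_fourier R n 1 d _ (symbol_cintegrable sm tf).
rewrite (_ : (fun x => _) = multiplier_op m f); last first.
  by apply/funext => x; rewrite multiplier_opE; apply: eq_cint => y; rewrite scale1r.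
apply; apply: filterS md => y md mf; rewrite mul1r; apply: md.
by apply: contraNneq mf => ->; rewrite mul0r.
Qed.

(** Conjugation reflects the frequencies, so an upper bound on the support of
the symbol becomes a lower bound for the conjugate. *)
Lemma spec_multiplier_op_conj f : test_function f ->
  {ae mu, forall y, m y != 0 -> last_coord y <= - d} ->
  spec_ge d (fun x => conjc (multiplier_op m f x)).
Proof.
move=> tf md.
have := @spec_ge_fourier R n (-1) d _ (cintegrable_conj (symbol_cintegrable sm tf)).
rewrite (_ : (fun x => cint _ _) = (fun x => conjc (multiplier_op m f x))); last first.
  apply/funext => x; rewrite multiplier_opE -cint_conj; last exact: symbol_cintegrable_chi.
  apply: eq_cint => y; by rewrite [in RHS]conjcM conj_expi scaleN1r dotprodNr mulrN.
apply; apply: filterS md => y md mf; rewrite mulN1r lerNr; apply: md.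
by apply: contraNneq mf => ->; rewrite mul0r conjc0.
Qed.

End spectra.

End fourier_test.

(** * The two halves of a separated multiplier *)

Section halves.
Context (R : realType) (n : nat).
Local Notation nc := ComplexField.Normc.normc.
Local Notation mu := (@lebesgue_rV R n.+1).
Local Notation vec := 'rV[R]_n.+1.
Local Notation chi y x := (expi (2 * pi * dotprod x y)).
Variables (A : R) (m : vec -> R[i]).
Hypothesis sm : symbol m.
Hypothesis m_supp : {ae mu, forall y, A < `|last_coord y| -> m y = 0}.
Implicit Types (f : vec -> R[i]) (t : R).

Lemma symbol_plus : symbol (m_plus m).
Proof.
case: sm => mm [M mM]; split.
  have mc : measurable_fun [set: vec] (fun x : vec => 0 < last_coord x).
    by apply: measurable_fun_ltr => //; exact: measurable_coord.
  case: mm => m1 m2; split.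
    rewrite (_ : (fun x => _) = (fun x => if 0 < last_coord x then complex.Re (m x) else 0)).
      exact: measurable_fun_ifT.
    by apply/funext => x; rewrite /m_plus; case: ifP.
  rewrite (_ : (fun x => _) = (fun x => if 0 < last_coord x then complex.Im (m x) else 0)).
    exact: measurable_fun_ifT.
  by apply/funext => x; rewrite /m_plus; case: ifP.
exists M; apply: filterS mM => y my; rewrite /m_plus; case: ifP => // _.
by rewrite ComplexField.Normc.normc0 (le_trans (normc_ge0 (m y))).
Qed.

Lemma symbol_minus : symbol (m_minus m).
Proof.
case: sm => mm [M mM]; split.
  have mc : measurable_fun [set: vec] (fun x : vec => last_coord x < 0).
    by apply: measurable_fun_ltr => //; exact: measurable_coord.
  case: mm => m1 m2; split.
    rewrite (_ : (fun x => _) = (fun x => if last_coord x < 0 then complex.Re (m x) else 0)).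
      exact: measurable_fun_ifT.
    by apply/funext => x; rewrite /m_minus; case: ifP.
  rewrite (_ : (fun x => _) = (fun x => if last_coord x < 0 then complex.Im (m x) else 0)).
    exact: measurable_fun_ifT.
  by apply/funext => x; rewrite /m_minus; case: ifP.
exists M; apply: filterS mM => y my; rewrite /m_minus; case: ifP => // _.
by rewrite ComplexField.Normc.normc0 (le_trans (normc_ge0 (m y))).
Qed.

Definition upper t f := multiplier_op (fun y => m_plus m (y - t *: @e_last R n)) f.
Definition lower t f := multiplier_op (fun y => m_minus m (y + t *: @e_last R n)) f.

Lemma upper_lower t f x : test_function f ->
  multiplier_op (shift_apart t m) f x = upper t f x + lower t f x.
Proof.
move=> tf; apply: multiplier_opD => //; apply: symbol_shift.
  exact: symbol_plus.
exact: symbol_minus.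
Qed.

Let last_shift (y : vec) t : last_coord (y + t *: @e_last R n) = last_coord y + t.
Proof. by rewrite /last_coord !mxE !eqxx mulr1. Qed.

Let last_shiftN (y : vec) t : last_coord (y - t *: @e_last R n) = last_coord y - t.
Proof. by rewrite -scaleNr last_shift. Qed.

(** The support of the shifted upper half lies in the slab
[t <= y_n <= t + A], that of the lower half in the opposite slab. *)
Let plus_ae t : {ae mu, forall y, m_plus m (y - t *: @e_last R n) != 0 ->
  t <= last_coord y /\ last_coord y <= t + A}.
Proof.
apply: filterS (ae_shift (- (t *: @e_last R n)) m_supp) => y my.
rewrite /m_plus last_shiftN; case: ifP => [yt m0|]; last by rewrite eqxx.
split; first by lra.
rewrite leNgt; apply: contraNN m0 => yA; rewrite my// last_shiftN gtr0_norm//; lra.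
Qed.

Let minus_ae t : {ae mu, forall y, m_minus m (y + t *: @e_last R n) != 0 ->
  - (t + A) <= last_coord y /\ last_coord y <= - t}.
Proof.
apply: filterS (ae_shift (t *: @e_last R n) m_supp) => y my.
rewrite /m_minus last_shift; case: ifP => [yt m0|]; last by rewrite eqxx.
split; last by lra.
rewrite leNgt; apply: contraNN m0 => yA; rewrite my// last_shift ltr0_norm//; lra.
Qed.

Let sp t : symbol (fun y => m_plus m (y - t *: @e_last R n)).
Proof. by apply: symbol_shift; exact: symbol_plus. Qed.

Let sn t : symbol (fun y => m_minus m (y + t *: @e_last R n)).
Proof. by apply: symbol_shift; exact: symbol_minus. Qed.

Lemma spec_upper t f : test_function f -> spec_ge t (upper t f).
Proof.
move=> tf; apply: (spec_multiplier_op (sp t) tf).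
by apply: filterS (plus_ae t) => y /[apply] -[].
Qed.

Lemma spec_upper_conj t f : test_function f ->
  spec_ge (- (t + A)) (fun x => conjc (upper t f x)).
Proof.
move=> tf; apply: (spec_multiplier_op_conj (sp t) tf).
by apply: filterS (plus_ae t) => y /[apply] -[_]; rewrite opprK.
Qed.

Lemma spec_lower t f : test_function f -> spec_ge (- (t + A)) (lower t f).
Proof.
move=> tf; apply: (spec_multiplier_op (sn t) tf).
by apply: filterS (minus_ae t) => y /[apply] -[].
Qed.

Lemma spec_lower_conj t f : test_function f -> spec_ge t (fun x => conjc (lower t f x)).
Proof.
move=> tf; apply: (spec_multiplier_op_conj (sn t) tf).
by apply: filterS (minus_ae t) => y /[apply] -[].
Qed.

Lemma upperE t f x : test_function f ->
  upper t f x = chi (t *: @e_last R n) x *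
    multiplier_op (m_plus m) (fun x => chi (- (t *: @e_last R n)) x * f x) x.
Proof. by move=> tf; apply: multiplier_op_shift => //; exact: symbol_plus. Qed.

Lemma lowerE t f x : test_function f ->
  lower t f x = chi (- (t *: @e_last R n)) x *
    multiplier_op (m_minus m) (fun x => chi (t *: @e_last R n) x * f x) x.
Proof.
move=> tf; rewrite /lower.
have := @multiplier_op_shift R n (m_minus m) (- (t *: @e_last R n)) f x symbol_minus tf.
by rewrite opprK.
Qed.

Hypothesis m_real : forall t, 0 < t -> real_to_real (shift_apart t m).

(** For real [f] the function [upper - conj lower] is real, because
[upper + lower] is, and its spectrum lies in [y_n >= t > 0]: it vanishes. *)
Lemma upper_conj_lower_real t f : 0 < t -> test_function f ->
  (forall x, complex.Im (f x) = 0) ->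
  {ae mu, forall x, upper t f x = conjc (lower t f x)}.
Proof.
move=> t0 tf f_re.
pose w x := upper t f x + -1 * conjc (lower t f x).
have sw : spec_ge t w by apply: spec_geD; [exact: spec_upper|apply: spec_geZ; exact: spec_lower_conj].
have w_re x : complex.Im (w x) = 0.
  have := m_real t0 tf f_re x; rewrite upper_lower// /w.
  by move: (upper t f x) (lower t f x) => z [c d]; rewrite mulN1r !Im_addc Im_oppc/= opprK.
apply: filterS (spec_gt0_real_eq0 t0 sw w_re) => x.
by rewrite /w mulN1r => /eqP; rewrite subr_eq0 => /eqP.
Qed.

(** By linearity, from the real and imaginary parts of [f]. *)
Lemma upper_conj_lower t f : 0 < t -> test_function f ->
  {ae mu, forall x, upper t f x = conjc (lower t (fun x => conjc (f x)) x)}.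
Proof.
move=> t0 tf.
pose u x := Complex (complex.Re (f x)) 0; pose v x := Complex (complex.Im (f x)) 0.
have tu : test_function u by exact: test_Re.
have tv : test_function v by exact: test_Im.
have Hu := upper_conj_lower_real t0 tu (fun=> erefl).
have Hv := upper_conj_lower_real t0 tv (fun=> erefl).
have iv : test_function (fun x => 'i%C * v x) by exact: testZ.
have niv : test_function (fun x => - 'i%C * v x) by exact: testZ.
apply: filterS2 Hu Hv => x hu hv.
have -> : f = (fun x => u x + 'i%C * v x).
  by apply/funext => z; rewrite /u /v; case: (f z) => a b; apply/eqP; rewrite eq_complex/=;
    apply/andP; split; apply/eqP; ring.
have -> : (fun x => conjc (u x + 'i%C * v x)) = (fun x => u x + - 'i%C * v x).
  by apply/funext => z; rewrite /u /v; apply/eqP; rewrite eq_complex/=; apply/andP; split; apply/eqP; ring.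
rewrite /upper /lower !multiplier_op_addr ?multiplier_op_scale//.
rewrite -/(upper t u x) -/(upper t v x) -/(lower t u x) -/(lower t v x) hu hv.
rewrite conjcD conjcM; congr (_ + _ * _).
by apply/eqP; rewrite eq_complex/= opprK oppr0 !eqxx.
Qed.

(** The symmetry [m_- (- y) = conj (m_+ y)], at the level of operators. *)
Lemma plus_conj_minus f : test_function f ->
  {ae mu, forall x, multiplier_op (m_plus m) f x =
    conjc (multiplier_op (m_minus m) (fun x => conjc (f x)) x)}.
Proof.
move=> tf; pose v : vec := 1 *: @e_last R n.
have tg : test_function (fun x => chi v x * f x) by exact: test_chi.
have E1 : (fun x => chi (- v) x * (chi v x * f x)) = f.
  by apply/funext => z; rewrite mulrA -chiD addNr dotprod0r mulr0 expi0 mul1r.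
have E2 : (fun x => chi v x * conjc (chi v x * f x)) = (fun x => conjc (f x)).
  apply/funext => z; rewrite conjcM conj_expi -chiN mulrA -chiD addrN.
  by rewrite dotprod0r mulr0 expi0 mul1r.
have nz x : chi v x != 0.
  apply/eqP => E; have := normc_expi (2 * pi * dotprod x v).
  by rewrite E ComplexField.Normc.normc0 => /esym/eqP; rewrite oner_eq0.
apply: filterS (upper_conj_lower ltr01 tg) => x.
rewrite (upperE 1 x tg) (lowerE 1 x (test_conj tg)) -/v E1 E2.
rewrite conjcM conj_expi -chiN opprK.
exact: (mulfI (nz x)).
Qed.

End halves.

(** * The main inequality on even powers *)

Section even_power.
Context (R : realType).
Implicit Types x y : R.

Lemma exprM_le_exprD x y (a b : nat) : 0 <= x -> 0 <= y ->
  x ^+ a * y ^+ b <= x ^+ (a + b) + y ^+ (a + b).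
Proof.
move=> x0 y0; rewrite !exprD; have [xy|yx] := leP x y.
  apply: ler_wpDl; first by rewrite mulr_ge0// exprn_ge0.
  by rewrite ler_wpM2r ?exprn_ge0// lerXn2r.
apply: ler_wpDr; first by rewrite mulr_ge0// exprn_ge0.
by rewrite ler_wpM2l ?exprn_ge0// lerXn2r// ?nnegrE// ltW.
Qed.

Lemma exprM_symm_le x y (a b : nat) : 0 <= x -> 0 <= y ->
  x ^+ a * y ^+ b + x ^+ b * y ^+ a <= x ^+ (a + b) + y ^+ (a + b).
Proof.
move=> x0 y0; rewrite !exprD -subr_ge0.
rewrite (_ : _ - _ = (x ^+ a - y ^+ a) * (x ^+ b - y ^+ b)); last by ring.
have [xy|yx] := leP x y.
  by rewrite mulr_le0// subr_le0 lerXn2r.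
by rewrite mulr_ge0// subr_ge0 lerXn2r// ?nnegrE// ltW.
Qed.

(** The terms [i] and [q - i] are paired, and the sum of the squares of the
binomial coefficients is a central binomial coefficient (Vandermonde). *)
Lemma sum_sqr_bin_le x y (q : nat) : 0 <= x -> 0 <= y ->
  \sum_(i < q.+1) 'C(q, i)%:R ^+ 2 * (x ^+ (q - i) * y ^+ i) <=
  'C(q.*2, q)%:R / 2 * (x ^+ q + y ^+ q).
Proof.
move=> x0 y0; set S := \sum_(i < _) _.
have SE : S = \sum_(i < q.+1) 'C(q, i)%:R ^+ 2 * (x ^+ i * y ^+ (q - i)).
  rewrite /S (reindex_inj rev_ord_inj)/=; apply: eq_bigr => i _.
  have iq : (i <= q)%N by rewrite -ltnS.
  by rewrite subSS bin_sub// subKn.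
have CE : 'C(q.*2, q)%:R = \sum_(i < q.+1) 'C(q, i)%:R ^+ 2 :> R.
  rewrite -addnn -binomial.Vandermonde natr_sum; apply: eq_bigr => i _.
  by rewrite natrM bin_sub ?expr2// -ltnS.
suff : S + S <= 'C(q.*2, q)%:R * (x ^+ q + y ^+ q) by lra.
rewrite {2}SE /S CE -big_split mulr_suml; apply: ler_sum => i _ /=.
rewrite -mulrDr ler_wpM2l ?sqr_ge0//.
have iq : (i <= q)%N by rewrite -ltnS.
by have := exprM_symm_le (q - i) i x0 y0; rewrite subnK.
Qed.

End even_power.

Section real_in_complex.
Context (R : realType).

Lemma realcX (r : R) k : Complex r 0 ^+ k = Complex (r ^+ k) 0.
Proof. by elim: k => // k IH; rewrite !exprS IH realcM. Qed.

Lemma realcZ (z : R[i]) k : z *+ k = Complex k%:R 0 * z.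
Proof.
elim: k => [|k IH]; first by rewrite mulr0n (_ : Complex _ _ = 0)// mul0r.
rewrite mulrS IH (_ : Complex k.+1%:R 0 = 1 + Complex k%:R 0) ?mulrDl ?mul1r//.
by rewrite -natr1 addrC; apply/eqP; rewrite eq_complex/= addr0 !eqxx.
Qed.

End real_in_complex.

Section complex_sums.
Context d (T : measurableType d) (R : realType) (mu : {measure set T -> \bar R}).
Local Notation nc := ComplexField.Normc.normc.

Lemma cintegrable_sum (I : Type) (s : seq I) (F : I -> T -> R[i]) :
  (forall i, cintegrable mu (F i)) -> cintegrable mu (fun x => \sum_(i <- s) F i x).
Proof.
move=> Fi; elim: s => [|i s IH].
  by under eq_fun do rewrite big_nil; exact: cintegrable0.
by under eq_fun do rewrite big_cons; exact: cintegrableD.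
Qed.

Lemma cint_sum (I : Type) (s : seq I) (F : I -> T -> R[i]) :
  (forall i, cintegrable mu (F i)) ->
  cint mu (fun x => \sum_(i <- s) F i x) = \sum_(i <- s) cint mu (F i).
Proof.
move=> Fi; elim: s => [|i s IH].
  by rewrite big_nil -[RHS](cint0 mu); apply: eq_cint => x; rewrite big_nil.
rewrite big_cons -IH -cintD//; last exact: cintegrable_sum.
by apply: eq_cint => x; rewrite big_cons.
Qed.

End complex_sums.

Section main_inequality.
Context (R : realType) (n : nat).
Local Notation nc := ComplexField.Normc.normc.
Local Notation mu := (@lebesgue_rV R n.+1).
Local Notation vec := 'rV[R]_n.+1.
Variables (g h : vec -> R[i]) (q : nat) (t A : R).
Hypothesis A0 : 0 <= A.
Hypothesis tA : (q%:R - 1) * A <= 2 * t.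
Hypothesis sg : spec_ge t g.
Hypothesis sgc : spec_ge (- (t + A)) (fun x => conjc (g x)).
Hypothesis sh : spec_ge (- (t + A)) h.
Hypothesis shc : spec_ge t (fun x => conjc (h x)).
Hypothesis gq : mu.-integrable setT (fun x => (nc (g x) ^+ q.*2)%:E).
Hypothesis hq : mu.-integrable setT (fun x => (nc (h x) ^+ q.*2)%:E).

(** The term of indices [i], [j] in the expansion of
[|g + h| ^ 2q = (g + h) ^ q (conj g + conj h) ^ q], without its coefficient. *)
Let P (i j : nat) (x : vec) : R[i] :=
  g x ^+ (q - i) * h x ^+ i * (conjc (g x) ^+ (q - j) * conjc (h x) ^+ j).

Let mP i j : cmeas (P i j).
Proof.
have mg : cmeas g by case: sg.
have mh : cmeas h by case: sh.
apply: cmeasM; apply: cmeasM; apply: cmeasX => //; exact: cmeas_conj.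
Qed.

Let nP i j x : nc (P i j x) =
  nc (g x) ^+ (q - i + (q - j)) * nc (h x) ^+ (i + j).
Proof.
rewrite /P !ComplexField.Normc.normcM !normcX !normc_conj !exprD.
by rewrite mulrACA.
Qed.

Let iP i j : (i <= q)%N -> (j <= q)%N -> cintegrable mu (P i j).
Proof.
move=> iq jq; apply: (cintegrable_dom (mP i j) (integrableD measurableT gq hq)).
apply/nearW => x; rewrite nP.
have := @exprM_le_exprD R _ _ (q - i + (q - j)) (i + j) (normc_ge0 (g x)) (normc_ge0 (h x)).
by rewrite addnACA !subnK// addnn.
Qed.

(** For [i < j] the spectrum of [P i j] lies in [0 <= y_n]: the exponent of
each of the four factors contributes [t] or [- (t + A)], and the assumption on
[t] is what makes the balance nonnegative in the worst case [j = i + 1]. *)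
Let P_lt0 i j : (i < j)%N -> (j <= q)%N -> cint mu (P i j) = 0.
Proof.
move=> ij jq; have iq : (i <= q)%N by apply: leq_trans jq; exact: ltnW.
apply: spec_ge0_cint0; first exact: iP.
have := spec_geM (spec_geM (spec_geX (q - i) sg) (spec_geX i sh))
                 (spec_geM (spec_geX (q - j) sgc) (spec_geX j shc)).
apply: spec_ge_le; rewrite !natrB//.
have k1 : 1 <= j%:R - i%:R :> R.
  by rewrite -natrB ?(ltnW ij)// (_ : 1 = 1%:R)// ler_nat subn_gt0.
set k : R := j%:R - i%:R in k1.
have -> : (q%:R - i%:R) * t + i%:R * - (t + A) +
   ((q%:R - j%:R) * - (t + A) + j%:R * t) = 2 * t * k - A * (q%:R - k).
  by rewrite /k; ring.
have kt := ler_wpM2r (le_trans ler01 k1) tA.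
have q1 : 0 <= (k - 1) * (q%:R * A) by rewrite mulr_ge0 ?mulr_ge0// subr_ge0.
by nra.
Qed.

Let P_conj i j x : conjc (P i j x) = P j i x.
Proof.
rewrite /P !conjcM !conjcX !conjcK; ring.
Qed.

Let P_neq0 i j : i != j -> (i <= q)%N -> (j <= q)%N -> cint mu (P i j) = 0.
Proof.
rewrite neq_ltn => /orP[] ij iq jq; first exact: P_lt0.
have <- : (fun x => conjc (P j i x)) = P i j by apply/funext => x; rewrite P_conj.
by rewrite cint_conj ?P_lt0 ?conjc0//; exact: iP.
Qed.

Let P_diag i x : P i i x = Complex ((nc (g x) ^+ 2) ^+ (q - i) * (nc (h x) ^+ 2) ^+ i) 0.
Proof.
rewrite /P mulrACA -!exprMn !mul_conjc.
by rewrite !realcX realcM.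
Qed.

Let iD i : (i <= q)%N -> mu.-integrable setT
  (fun x => ((nc (g x) ^+ 2) ^+ (q - i) * (nc (h x) ^+ 2) ^+ i)%:E).
Proof.
move=> iq; have [+ _] := iP iq iq.
by rewrite (_ : (fun x => _) = (fun x => ((nc (g x) ^+ 2) ^+ (q - i) * (nc (h x) ^+ 2) ^+ i)%:E))//;
  apply/funext => x; rewrite P_diag.
Qed.

Let expand x : Complex (nc (g x + h x) ^+ q.*2) 0 =
  \sum_(i < q.+1) \sum_(j < q.+1) Complex ('C(q, i)%:R * 'C(q, j)%:R) 0 * P i j x.
Proof.
rewrite -mul2n exprM -realcX -mul_conjc exprMn conjcD !exprDn mulr_suml.
apply: eq_bigr => i _; rewrite mulr_sumr; apply: eq_bigr => j _.
rewrite !realcZ -realcM /P; ring.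
Qed.

Lemma integrable_addX : mu.-integrable setT (fun x => (nc (g x + h x) ^+ q.*2)%:E).
Proof.
have : cintegrable mu (fun x => Complex (nc (g x + h x) ^+ q.*2) 0).
  rewrite (funext expand).
  apply: cintegrable_sum => i; apply: cintegrable_sum => j.
  by apply: cintegrableZ; apply: iP; rewrite -ltnS.
by case.
Qed.

(** Only the diagonal terms of the expansion survive integration. *)
Lemma Rintegral_addX_le : Rintegral mu setT (fun x => nc (g x + h x) ^+ q.*2) <=
  'C(q.*2, q)%:R / 2 * (Rintegral mu setT (fun x => nc (g x) ^+ q.*2) +
                        Rintegral mu setT (fun x => nc (h x) ^+ q.*2)).
Proof.
pose D x := \sum_(i < q.+1) 'C(q, i)%:R ^+ 2 *
  ((nc (g x) ^+ 2) ^+ (q - i) * (nc (h x) ^+ 2) ^+ i).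
have -> : Rintegral mu setT (fun x => nc (g x + h x) ^+ q.*2) = Rintegral mu setT D.
  have iPZ (i j : 'I_q.+1) : cintegrable mu
      (fun x => Complex ('C(q, i)%:R * 'C(q, j)%:R) 0 * P i j x).
    by apply: cintegrableZ; apply: iP; rewrite -ltnS.
  suff : cint mu (fun x => Complex (nc (g x + h x) ^+ q.*2) 0) =
      cint mu (fun x => Complex (D x) 0) by rewrite !cint_real => -[].
  rewrite (funext expand).
  rewrite cint_sum; last by move=> i; apply: cintegrable_sum.
  have -> : (fun x => Complex (D x) 0) = (fun x => \sum_(i < q.+1)
      Complex ('C(q, i)%:R * 'C(q, i)%:R) 0 * P i i x).
    apply/funext => x; rewrite /D.
    have -> : forall s : seq 'I_q.+1, Complex (\sum_(i <- s) 'C(q, i)%:R ^+ 2 *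
       ((nc (g x) ^+ 2) ^+ (q - i) * (nc (h x) ^+ 2) ^+ i)) 0 =
       \sum_(i <- s) Complex ('C(q, i)%:R * 'C(q, i)%:R) 0 * P i i x => //.
    elim=> [|i s IH]; first by rewrite !big_nil.
    rewrite !big_cons -IH P_diag realcM expr2.
    by apply/eqP; rewrite eq_complex/= addr0 !eqxx.
  rewrite cint_sum//; apply: eq_bigr => i _.
  rewrite cint_sum// (bigD1 i)//= big1 ?addr0// => j ji.
  have iq : (i <= q)%N by rewrite -ltnS.
  have jq : (j <= q)%N by rewrite -ltnS.
  have ij : (i : nat) != j by rewrite eq_sym.
  by rewrite (cintZ _ (iP iq jq)) (P_neq0 ij iq jq) mulr0.
have iD' : mu.-integrable setT (fun x => (D x)%:E).
  have : cintegrable mu (fun x => \sum_(i < q.+1) Complex ('C(q, i)%:R ^+ 2 *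
     ((nc (g x) ^+ 2) ^+ (q - i) * (nc (h x) ^+ 2) ^+ i)) 0).
    apply: cintegrable_sum => i; apply: cintegrable_real; apply: integrable_scale.
    by apply: iD; rewrite -ltnS.
  case=> + _; rewrite (_ : (fun x => _) = (fun x => (D x)%:E))//.
  apply/funext => x; congr EFin; rewrite /D.
  have -> // : forall s : seq 'I_q.+1, complex.Re (\sum_(i <- s) Complex ('C(q, i)%:R ^+ 2 *
     ((nc (g x) ^+ 2) ^+ (q - i) * (nc (h x) ^+ 2) ^+ i)) 0) =
     \sum_(i <- s) 'C(q, i)%:R ^+ 2 * ((nc (g x) ^+ 2) ^+ (q - i) * (nc (h x) ^+ 2) ^+ i).
  by elim=> [|i s IH]; rewrite ?big_nil// !big_cons -IH Re_addc.
rewrite -RintegralD// -RintegralZl//; last exact: (integrableD measurableT gq hq).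
apply: le_Rintegral => //; first by apply: integrable_scale; exact: (integrableD measurableT gq hq).
move=> x _; rewrite -mul2n !exprM mul2n.
by apply: sum_sqr_bin_le; exact: sqr_ge0.
Qed.

End main_inequality.

(** * Density of the test functions *)

Section power_bounds.
Context (R : realType) d (T : measurableType d) (mu : {measure set T -> \bar R}).

Lemma exprD_le (x y : R) (p : nat) : 0 <= x -> 0 <= y ->
  (x + y) ^+ p <= 2 ^+ p * (x ^+ p + y ^+ p).
Proof.
move=> x0 y0; rewrite mulrDr -!exprMn; have [xy|yx] := leP x y.
  by apply: ler_wpDl; rewrite ?exprn_ge0 ?mulr_ge0// lerXn2r// ?nnegrE ?addr_ge0 ?mulr_ge0//; lra.
by apply: ler_wpDr; rewrite ?exprn_ge0 ?mulr_ge0// lerXn2r// ?nnegrE ?addr_ge0 ?mulr_ge0//; lra.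
Qed.

Lemma integral_exprD_le (a b c : T -> R) (p : nat) :
  measurable_fun setT a -> measurable_fun setT b -> measurable_fun setT c ->
  (forall x, 0 <= a x) -> (forall x, 0 <= b x) -> (forall x, 0 <= c x) ->
  (forall x, c x <= a x + b x) ->
  (\int[mu]_x (c x ^+ p)%:E <=
   (2 ^+ p)%:E * (\int[mu]_x (a x ^+ p)%:E + \int[mu]_x (b x ^+ p)%:E))%E.
Proof.
move=> ma mb mc a0 b0 c0 cab.
have mX (f : T -> R) : measurable_fun setT f -> measurable_fun setT (fun x => (f x ^+ p)%:E).
  by move=> mf; apply/measurable_EFinP; exact: measurable_funX.
have X0 (f : T -> R) : (forall x, 0 <= f x) -> forall x, setT x -> (0 <= (f x ^+ p)%:E)%E.
  by move=> f0 x _; rewrite lee_fin exprn_ge0.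
rewrite -(@ge0_integralD _ _ _ _ _ measurableT _ _ (X0 _ a0) (mX _ ma) (X0 _ b0) (mX _ mb)).
rewrite -ge0_integralZl//; last 2 first.
- by apply: emeasurable_funD; exact: mX.
- by move=> x _; rewrite adde_ge0// X0.
apply: ge0_le_integral => //.
- by move=> x _; exact: X0.
- exact: mX.
- apply: emeasurable_funM => //; apply: emeasurable_funD; exact: mX.
move=> x _; rewrite -EFinD -EFinM lee_fin; apply: le_trans (exprD_le p (a0 x) (b0 x)).
by rewrite lerXn2r// nnegrE ?addr_ge0.
Qed.

End power_bounds.

Section approximable.
Context (R : realType) (n p : nat).
Hypothesis p_gt0 : (0 < p)%N.
Local Notation nc := ComplexField.Normc.normc.
Local Notation mu := (@lebesgue_rV R n.+1).
Local Notation vec := 'rV[R]_n.+1.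
Implicit Types (r s u : vec -> R).

(** [r] is a limit of test functions in the norm of [L^p]. *)
Definition approximable r := forall e : R, 0 < e -> exists2 u, rtest u &
  (\int[mu]_x (`|r x - u x| ^+ p)%:E <= e%:E)%E.

Let mB r u : measurable_fun setT r -> measurable_fun setT u ->
  measurable_fun setT (fun x => `|r x - u x|).
Proof. by move=> mr mu_; apply: measurableT_comp => //; exact: measurable_funB. Qed.

Let halve (e : R) : 0 < e -> 0 < e / (2 ^+ p * 2).
Proof. by move=> e0; rewrite divr_gt0// mulr_gt0// exprn_gt0. Qed.

Let halvesE (e : R) (a b : \bar R) : (a <= (e / (2 ^+ p * 2))%:E)%E ->
  (b <= (e / (2 ^+ p * 2))%:E)%E -> ((2 ^+ p)%:E * (a + b) <= e%:E)%E.
Proof.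
move=> ae be; apply: (@le_trans _ _ ((2 ^+ p)%:E * ((e / (2 ^+ p * 2)) + (e / (2 ^+ p * 2)))%:E)%E).
  by rewrite EFinD lee_wpmul2l ?lee_fin ?exprn_ge0// leeD.
rewrite -EFinM lee_fin le_eqVlt; apply/orP; left; apply/eqP.
have : (2 : R) ^+ p != 0 by rewrite expf_neq0.
by move=> ?; field.
Qed.

Lemma approximableD r s : measurable_fun setT r -> measurable_fun setT s ->
  approximable r -> approximable s -> approximable (fun x => r x + s x).
Proof.
move=> mr ms ar as_ e e0.
have [u tu ru] := ar _ (halve e0); have [v tv sv] := as_ _ (halve e0).
exists (fun x => u x + v x); first exact: rtestD.
have mu_ := rtest_measurable tu; have mv := rtest_measurable tv.
apply: le_trans (halvesE ru sv).
apply: (integral_exprD_le _ _ (mB mr mu_) (mB ms mv)) => //.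
  by apply: mB; exact: measurable_funD.
by move=> x; rewrite opprD addrACA; exact: ler_normD.
Qed.

Lemma approximableZ (c : R) r : measurable_fun setT r ->
  approximable r -> approximable (fun x => c * r x).
Proof.
move=> mr ar e e0.
have c0 : 0 < `|c| ^+ p + 1 by rewrite ltr_wpDl// exprn_ge0.
have [u tu ru] := ar _ (divr_gt0 e0 c0).
exists (fun x => u x * c); first by apply: rtestM tu => k; exact: Ck_cst.
under eq_integral => x _ do rewrite (mulrC (u x)) -mulrBr normrM exprMn EFinM.
rewrite ge0_integralZl//; last first.
  by apply/measurable_EFinP/measurable_funX; apply: mB => //; exact: rtest_measurable.
apply: (@le_trans _ _ ((`|c| ^+ p)%:E * (e / (`|c| ^+ p + 1))%:E)%E).
  by rewrite lee_wpmul2l// lee_fin exprn_ge0.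
rewrite -EFinM lee_fin mulrA ler_pdivrMr// mulrC ler_wpM2l ?(ltW e0)//.
by rewrite lerDl.
Qed.

(** Dominated convergence, with the bound [(2 h) ^ p]. *)
Lemma approximable_lim (r_ : nat -> vec -> R) r (h : vec -> R) :
  (forall k, measurable_fun setT (r_ k)) -> measurable_fun setT r ->
  measurable_fun setT h ->
  mu.-integrable setT (fun x => (h x ^+ p)%:E) ->
  (forall k x, `|r_ k x| <= h x) -> (forall x, (fun k => r_ k x) @ \oo --> r x) ->
  (forall k, approximable (r_ k)) -> approximable r.
Proof.
move=> mr_ mr mh hi rh rcv ar e e0.
have rh' x : `|r x| <= h x.
  apply: (ler_cvg_to (cvg_norm (rcv x)) (cvg_cst (h x))).
  by apply: nearW => k; exact: rh.
have [|||||_ _ C] := @dominated_convergence _ _ _ mu setT measurableT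
  (fun k x => (`|r x - r_ k x| ^+ p)%:E) (cst 0%E) (fun x => (2 ^+ p * h x ^+ p)%:E).
- by move=> k; apply/measurable_EFinP/measurable_funX; exact: mB.
- exact: measurable_cst.
- apply/nearW => x _; apply: cvg_EFin; first exact: nearW.
  have : (fun k => `|r x - r_ k x| ^+ p) @ \oo --> (`|r x - r x| ^+ p : R).
    apply: (continuous_cvg _ (@exprn_continuous _ p _)).
    by apply: cvg_norm; apply: cvgB; [exact: cvg_cst|exact: rcv].
  by rewrite subrr normr0 expr0n gtn_eqF.
- exact: integrable_scale.
- apply/nearW => x k _ /=; rewrite lee_fin ger0_norm ?exprn_ge0// -exprMn.
  rewrite lerXn2r// ?nnegrE ?mulr_ge0 ?(le_trans _ (rh 0%N x))//.
  by apply: le_trans (ler_normB _ _) _; rewrite mulr_natl mulr2n lerD.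
have [k _ /(_ k (leqnn k)) /= rk] : \forall k \near \oo,
    (\int[mu]_x (`|r x - r_ k x| ^+ p)%:E < (e / (2 ^+ p * 2))%:E)%E.
  rewrite integral0 in C; apply: (C [set y : \bar R | (y < (e / (2 ^+ p * 2))%:E)%E]).
  by apply: (@nbhs_open_ereal_lt _ 0 (fun=> e / (2 ^+ p * 2))); exact: halve.
have [u tu ru] := ar k _ (halve e0).
exists u => //; have mu_ := rtest_measurable tu.
apply: le_trans (halvesE (ltW rk) ru).
apply: (integral_exprD_le _ _ (mB mr (mr_ k)) (mB (mr_ k) mu_)) => //; first exact: mB.
by move=> x; rewrite -[r x - u x](subrKA (r_ k x)); exact: ler_normD.
Qed.

Lemma rtest_approximable u : rtest u -> approximable u.
Proof.
move=> tu e e0; exists u => //.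
under eq_integral => x _ do rewrite subrr normr0 expr0n gtn_eqF//=.
by rewrite integral0 lee_fin ltW.
Qed.

Lemma approximable_sum (I : Type) (l : seq I) (F : I -> vec -> R) :
  (forall i, measurable_fun setT (F i)) -> (forall i, approximable (F i)) ->
  approximable (fun x => \sum_(i <- l) F i x).
Proof.
move=> mF aF; elim: l => [|i l IH].
  under eq_fun do rewrite big_nil; apply: rtest_approximable.
  by split; [move=> k; exact: Ck_cst|exists 0 => x; rewrite eqxx].
under eq_fun do rewrite big_cons; apply: approximableD => //.
exact: measurable_sum.
Qed.

Let flat_ge0 c y : 0 <= flat c 1 y :> R.
Proof. by rewrite /flat; case: ifP => // _; rewrite hornerE mul1r expR_ge0. Qed.

Let flat_le1 (c y : R) : 0 < c -> flat c 1 y <= 1.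
Proof.
move=> c0; rewrite /flat; case: ifP => // y0; rewrite hornerE mul1r.
by rewrite -[leRHS]expR0 ler_expR mulNr oppr_le0 mulr_ge0 ?invr_ge0// ltW.
Qed.

Let flat_cvg (y : R) : (fun k => flat (k.+1%:R^-1) 1 y) @ \oo --> ((0 < y)%R%:R : R).
Proof.
have [y0|y0] := ltP 0 y; last first.
  have -> : (fun k : nat => flat (k.+1%:R^-1) 1 y) = fun=> 0.
    by apply/funext => k; rewrite /flat ltNge y0.
  exact: cvg_cst.
have -> : (fun k : nat => flat (k.+1%:R^-1) 1 y) = (fun k : nat => expR (- k.+1%:R^-1 * y^-1)).
  by apply/funext => k; rewrite /flat y0 hornerE mul1r.
rewrite (_ : true%:R = expR (- 0 * y^-1)); last by rewrite oppr0 mul0r expR0.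
apply: (continuous_cvg _ (@continuous_expR _ _)).
by apply: cvgMr_tmp; apply: cvgN; exact: cvg_harmonic.
Qed.

Definition box (a b : 'I_n.+1 -> R) := [set x : vec | forall i, a i < x ord0 i < b i].

Let bump (a b : 'I_n.+1 -> R) (k : nat) (x : vec) : R :=
  \prod_i (flat (k.+1%:R^-1) 1 (x ord0 i - a i) * flat (k.+1%:R^-1) 1 (b i - x ord0 i)).

Let bump_neq0 a b k x : bump a b k x != 0 -> box a b x.
Proof.
move=> bx i; apply: contraNT bx; rewrite /bump (bigD1 i)//= /flat !subr_gt0 negb_and.
by move=> /orP[]/negbTE ->; rewrite ?(mul0r, mulr0).
Qed.

Let bump_ge0 a b k x : 0 <= bump a b k x.
Proof. by apply: prodr_ge0 => i _; rewrite mulr_ge0. Qed.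

Let bump_le1 a b k x : bump a b k x <= 1.
Proof.
apply: prodr_ile1 => i _; rewrite mulr_ge0//=.
have k0 : 0 < (k.+1%:R^-1 : R) by rewrite invr_gt0.
by rewrite mulr_ile1// flat_le1.
Qed.

Let bump_test a b k : rtest (bump a b k).
Proof.
split; last first.
  exists (\sum_i (`|a i| + `|b i|)) => x /bump_neq0 bx i.
  rewrite (bigD1 i)//=; apply: ler_wpDr; first by apply: sumr_ge0 => *; rewrite addr_ge0.
  have /andP[ai bi] := bx i; rewrite ler_norml; apply/andP; split.
    have := ler_norm (- a i); rewrite normrN => ha; have := normr_ge0 (b i); lra.
  have := ler_norm (b i) => hb; have := normr_ge0 (a i); lra.
have c0 : 0 < (k.+1%:R^-1 : R) by rewrite invr_gt0.
have dG (w : R) j x : is_derive (x : R) 1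
    (fun z => flat (k.+1%:R^-1) (iter j (flat_step (k.+1%:R^-1)) 1) (z + w))
    (flat (k.+1%:R^-1) (iter j.+1 (flat_step (k.+1%:R^-1)) 1) (x + w)).
  by apply: is_derive_shift; exact: is_derive_flat.
move=> K; apply: Ck_prod => i; apply: CkM.
  apply: (Ck_comp_linear (dG (- a i)) (l := fun x : vec => x ord0 i) _ _ K 0).
    exact: continuous_coord.
  by move=> *; rewrite !mxE.
have -> : (fun x : vec => flat (k.+1%:R^-1) 1 (b i - x ord0 i)) =
    (fun x : vec => flat (k.+1%:R^-1) 1 (- x ord0 i + b i)).
  by apply/funext => x; rewrite addrC.
apply: (Ck_comp_linear (dG (b i)) (l := fun x : vec => - x ord0 i) _ _ K 0).
  by move=> x; apply: continuousN; exact: continuous_coord.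
by move=> *; rewrite !mxE; ring.
Qed.

Let cvg_prodR (I : Type) (l : seq I) (F : nat -> I -> R) (f : I -> R) :
  (forall i, (fun k => F k i) @ \oo --> f i) ->
  (fun k => \prod_(i <- l) F k i) @ \oo --> \prod_(i <- l) f i.
Proof.
move=> Ff; elim: l => [|i l IH].
  by rewrite big_nil (_ : (fun k => _) = fun=> 1); [exact: cvg_cst|apply/funext => k; rewrite big_nil].
rewrite big_cons (_ : (fun k => _) = fun k => F k i * \prod_(j <- l) F k j); first exact: cvgM.
by apply/funext => k; rewrite big_cons.
Qed.

Lemma measurable_indic_rV (B : set vec) : measurable B -> measurable_fun [set: vec] (\1_B : vec -> R).
Proof. by move=> mB'; exact: measurable_indic. Qed.

Lemma indic_box_integrable a b : mu.-integrable setT (fun x => (\1_(box a b) x ^+ p)%:E).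
Proof.
pose M := \sum_i (`|a i| + `|b i|).
apply: (integrable_ae_dom _ (integrable_scale ((1 + M ^+ 2) ^+ n.+1) (integrable_weight R n.+1))).
  by apply: measurable_funX; apply: measurable_indic_rV; exact: measurable_box.
apply/nearW => x; rewrite indicE; have [xb|xb] := boolP (x \in box a b); last first.
  rewrite expr0n gtn_eqF// normr0; apply: mulr_ge0; last exact/ltW/weight_gt0.
  by rewrite exprn_ge0// addr_ge0// sqr_ge0.
rewrite expr1n normr1; apply: cube_le_weight => i.
rewrite /M (bigD1 i)//=; apply: ler_wpDr; first by apply: sumr_ge0 => *; rewrite addr_ge0.
have /andP[ai bi] := set_mem xb i; rewrite ler_norml; apply/andP; split.
  have := ler_norm (- a i); rewrite normrN => ha; have := normr_ge0 (b i); lra.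
have := ler_norm (b i) => hb; have := normr_ge0 (a i); lra.
Qed.

(** The smooth bumps [exp (- c / (x_i - a_i))] [exp (- c / (b_i - x_i))] increase
to the indicator function of the box as [c] decreases to [0]. *)
Lemma approximable_box a b : approximable \1_(box a b).
Proof.
have mb : measurable_fun [set: vec] (\1_(box a b) : vec -> R).
  by apply: measurable_indic_rV; exact: measurable_box.
apply: (approximable_lim (r_ := bump a b) (h := \1_(box a b))) => //.
- by move=> k; exact: rtest_measurable.
- exact: indic_box_integrable.
- move=> k x; rewrite ger0_norm// indicE.
  have [xb|xb] := boolP (x \in box a b); first exact: bump_le1.
  have [->//|/bump_neq0/mem_set] := eqVneq (bump a b k x) 0.
  by rewrite (negbTE xb).
- move=> x.
  rewrite (_ : \1_(box a b) x = \prod_i ((0 < x ord0 i - a i)%R%:R * (0 < b i - x ord0 i)%R%:R)).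
    by apply: cvg_prodR => i; apply: cvgM; exact: flat_cvg.
  rewrite indicE; have [xb|xb] := boolP (x \in box a b).
    rewrite big1// => i _; have /andP[ai bi] := set_mem xb i.
    by rewrite !subr_gt0 ai bi mulr1.
  apply/esym/eqP; rewrite prodf_seq_eq0; apply: contraNT xb => /hasPn xb.
  apply/mem_set => i; have := xb i (mem_index_enum _).
  by rewrite /= -natrM pnatr_eq0 !subr_gt0; case: (_ < _); case: (_ < _).
- by move=> k; apply: rtest_approximable.
Qed.

End approximable.

Section density.
Import HBNNSimple.
Context (R : realType) (n p : nat).
Hypothesis p_gt0 : (0 < p)%N.
Local Notation nc := ComplexField.Normc.normc.
Local Notation mu := (@lebesgue_rV R n.+1).
Local Notation vec := 'rV[R]_n.+1.

Let ray (a : 'I_n.+1 -> R) := [set x : vec | forall i, a i < x ord0 i].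

Let cvec := g_sigma_algebraType (range ray).

Let window (k : nat) : set vec := box (fun=> - k%:R) (fun=> k%:R).

Let window_near (x : vec) : exists K, forall k, (K <= k)%N -> window k x.
Proof.
have x0 : 0 <= \sum_j `|x ord0 j| by apply: sumr_ge0.
exists (Num.bound (\sum_j `|x ord0 j|)) => k Kk j.
rewrite -ltr_norml; apply: (@lt_le_trans _ _ (Num.bound (\sum_j `|x ord0 j|))%:R); last by rewrite ler_nat.
apply: le_lt_trans (archi_boundP x0).
by rewrite (bigD1 j)//= lerDl; apply: sumr_ge0.
Qed.

Let measurable_half_space (i : 'I_n.+1) (c : R) :
  <<s range ray >> [set x : vec | c < x ord0 i].
Proof.
have -> : [set x : vec | c < x ord0 i] =
    \bigcup_k ray (fun j => if j == i then c else - k%:R).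
  apply/seteqP; split => [x /= cx|x [k _ /= /(_ i)]]; last by rewrite eqxx.
  have [K HK] := window_near x; exists K => // j; case: eqP => [->//|_].
  by have /andP[] := HK K (leqnn K) j.
apply: sigma_algebra_bigcup => k; apply: sub_sigma_algebra.
by exists (fun j => if j == i then c else - k%:R).
Qed.

Let measurable_rays : @measurable _ vec = <<s range ray >>.
Proof.
apply/seteqP; split => [B mB|]; last first.
  apply: smallest_sub; first exact: sigma_algebra_measurable.
  move=> B [a _ <-].
  rewrite (_ : ray a = \bigcap_(i in [set: 'I_n.+1]) ((fun x : vec => x ord0 i : measurableTypeR R) @^-1` `]a i, +oo[%classic)).
    apply: fin_bigcap_measurable => // i _; rewrite -[X in measurable X]setTI.
    by apply: measurable_coord => //; exact: measurable_itv.
  apply/seteqP; split => x /= H i.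
    by move=> _; rewrite /= in_itv/= andbT; exact: H.
  by have := H i I; rewrite /= in_itv/= andbT.
have mid : measurable_fun [set: cvec] (fun x : cvec => x : vec).
  apply: measurable_fun_rV => i; apply: (measurability _ (RGenOInfty.measurableE R)).
  move=> /= _ [_ [c ->]] <-; rewrite setTI.
  have := measurable_half_space i c; congr (<<s _ >> _).
  by apply/seteqP; split => x /=; rewrite in_itv/= andbT.
by have := mid measurableT _ mB; rewrite setTI.
Qed.

Let indicI (A B : set vec) x : \1_(A `&` B) x = \1_A x * \1_B x :> R.
Proof. by rewrite !indicE in_setI -natrM mulnb. Qed.

(** Dynkin's theorem, for the sets whose trace on the box has an approximable
indicator function; it applies because the orthants [ray a] are stable under
intersection, generate the sigma-algebra, and cut a box in a box. *)
Lemma approximable_indic (a b : 'I_n.+1 -> R) (B : set vec) : measurable B ->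
  approximable p (\1_(B `&` box a b) : vec -> R).
Proof.
move=> mB; set W := box a b.
have mW : measurable W by exact: measurable_box.
have mI (S : set vec) : measurable S -> measurable_fun [set: vec] (\1_(S `&` W) : vec -> R).
  by move=> mS; apply: measurable_indic_rV; exact: measurableI.
have aW : approximable p (\1_W : vec -> R) by exact: approximable_box.
apply: (@dynkin_induction _ vec (range ray)
  (fun S => approximable p (\1_(S `&` W) : vec -> R)) measurable_rays) => //.
- move=> _ _ [c _ <-] [e _ <-]; exists (fun i => Num.max (c i) (e i)) => //.
  apply/seteqP; split => x /=.
    by move=> H; split => i; have := H i; rewrite gt_max => /andP[].
  by move=> [H1 H2] i; rewrite gt_max H1 H2.
- by rewrite setTI.
- move=> _ [c _ <-].
  have -> : ray c `&` W = box (fun i => Num.max (c i) (a i)) b.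
    apply/seteqP; split => x /=.
      by move=> [H1 H2] i; rewrite gt_max H1; exact: H2.
    by move=> H; split => i; have /andP[] := H i; rewrite gt_max => /andP[ca aa] xb //; rewrite aa.
  exact: approximable_box.
- move=> S mS aS.
  have -> : \1_(~` S `&` W) = (fun x => \1_W x + -1 * \1_(S `&` W) x) :> (vec -> R).
    apply/funext => x; rewrite !indicI !indicE in_setC.
    by case: (_ \in S); rewrite /= ?mul0r ?mul1r ?mulN1r ?subrr ?oppr0 ?addr0 ?mulr0 ?addr0.
  apply: approximableD => //.
  + by apply: measurable_funM => //; exact: mI.
  + by apply: approximableZ => //; exact: mI.
- move=> F mF tF aF.
  pose S k := \big[setU/set0]_(i < k) F i.
  have mS k : measurable (S k) by exact: bigsetU_measurable.
  have ndS k x : S k x -> (\bigcup_i F i) x.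
    by rewrite /S -bigcup_mkord => -[i _ Fx]; exists i.
  apply: (approximable_lim p_gt0 (r_ := fun k => \1_(S k `&` W)) (h := \1_W)) => //.
  + by move=> k; exact: mI.
  + by apply: mI; exact: bigcupT_measurable.
  + exact: indic_box_integrable.
  + move=> k x; rewrite indicI normrM !indicE.
    by case: (_ \in S k); case: (_ \in W); rewrite /= ?normr0 ?normr1 ?mul0r ?mulr0 ?mulr1.
  + move=> x; apply: cvg_near_cst.
    have [[i _ Fx]|nF] := pselect ((\bigcup_i F i) x).
      near=> k; rewrite !indicI; congr (_ * _); rewrite !indicE !mem_set//; first by exists i.
      rewrite /S -bigcup_mkord; exists i => //=.
      by near: k; exact: nbhs_infty_gt.
    apply: nearW => k; rewrite !indicI; congr (_ * _); rewrite !indicE !memNset//.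
    by move/ndS.
  + elim=> [|k IH].
      have -> : \1_(S 0%N `&` W) = (fun x => 0 * \1_W x) :> (vec -> R).
        by apply/funext => x; rewrite /S big_ord0 set0I indicE in_set0 mul0r.
      by apply: approximableZ => //; exact: measurable_indic_rV.
    have -> : \1_(S k.+1 `&` W) = (fun x => \1_(S k `&` W) x + \1_(F k `&` W) x) :> (vec -> R).
      apply/funext => x; rewrite !indicI -mulrDl; congr (_ * _).
      rewrite /S big_ord_recr/= -/(S k) !indicE in_setU.
      case: (boolP (x \in F k)) => xF; last by rewrite orbF addr0.
      rewrite orbT memNset ?add0r// /S -bigcup_mkord => -[i /= ik Fx].
      have := tF i k I I (ex_intro _ x (conj Fx (set_mem xF))).
      by move=> ik'; rewrite ik' ltnn in ik.
    by apply: approximableD => //; exact: mI.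
by rewrite -measurable_rays.
Unshelve. all: by end_near. Qed.

Let mX (r : vec -> R) : measurable_fun [set: vec] r -> measurable_fun [set: vec] (fun x => `|r x| ^+ p).
Proof. by move=> mr; apply: measurable_funX; exact: measurableT_comp. Qed.

(** Simple functions increasing to [r], cut off by the windows. *)
Let approximable_ge0 (r : vec -> R) : measurable_fun [set: vec] r -> (forall x, 0 <= r x) ->
  mu.-integrable setT (fun x => (r x ^+ p)%:E) -> approximable p r.
Proof.
move=> mr r0 ri.
have mrE : measurable_fun setT (fun x : vec => (r x)%:E) by exact/measurable_EFinP.
pose phi := nnsfun_approx measurableT mrE.
pose f k (x : vec) := phi k x * \1_(window k) x : R.
have mw k : measurable_fun [set: vec] (\1_(window k) : vec -> R).
  by apply: measurable_indic_rV; exact: measurable_box.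
have mphi k : measurable_fun [set: vec] (phi k) by exact: measurable_funPT.
have rE0 (x : vec) : setT x -> (0 <= (r x)%:E)%E by move=> _; rewrite lee_fin.
apply: (approximable_lim p_gt0 (r_ := f) (h := r)) => //.
- by move=> k; exact: measurable_funM.
- move=> k x; rewrite /f normrM ger0_norm; last exact: fun_ge0.
  have le : phi k x <= r x by rewrite -lee_fin /phi nnsfun_approxE; exact: le_approx.
  apply: le_trans le; rewrite ler_piMr ?fun_ge0// indicE.
  by case: (_ \in _); rewrite ?normr1 ?normr0.
- move=> x; have cphi : (fun k => phi k x) @ \oo --> r x.
    by have /fine_cvgP[_] := @cvg_nnsfun_approx _ _ _ _ measurableT _ mrE rE0 x I.
  have cw : (fun k => \1_(window k) x : R) @ \oo --> (1 : R).
    apply: cvg_near_cst; have [K HK] := window_near x.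
    by near=> k; rewrite indicE mem_set//; apply: HK; near: k; exact: nbhs_infty_ge.
  by rewrite -[r x]mulr1; exact: cvgM.
- move=> k.
  have -> : f k = (fun x => \sum_(y <- finmap.enum_fset (fset_set (range (phi k))))
     y * \1_(phi k @^-1` [set y] `&` window k) x).
    apply/funext => x; rewrite /f {1}(fimfunE (phi k)) fsbig_finite//= mulr_suml.
    by apply: eq_bigr => y _; rewrite indicI mulrA.
  have mI (y : R) : measurable_fun [set: vec]
      (\1_(phi k @^-1` [set y] `&` window k) : vec -> R).
    by apply: measurable_indic_rV; apply: measurableI => //; exact: measurable_box.
  apply: approximable_sum => // y.
    by apply: measurable_funM => //; exact: mI.
  by apply: approximableZ; [exact: mI|exact: approximable_indic].
Unshelve. all: by end_near. Qed.

Lemma approximable_Lp (r : vec -> R) : measurable_fun [set: vec] r ->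
  mu.-integrable setT (fun x => (`|r x| ^+ p)%:E) -> approximable p r.
Proof.
move=> mr ri.
have H (s : vec -> R) : measurable_fun [set: vec] s -> (forall x, 0 <= s x) ->
    (forall x, s x <= `|r x|) -> approximable p s.
  move=> ms s0 sr; apply: approximable_ge0 => //.
  apply: (integrable_ae_dom _ ri); first exact: measurable_funX.
  by apply/nearW => x; rewrite ger0_norm ?exprn_ge0// lerXn2r ?nnegrE.
have -> : r = (fun x => Num.max (r x) 0 + -1 * Num.max (- r x) 0).
  apply/funext => x; rewrite mulN1r; have [r0|r0] := leP 0 (r x).
    by rewrite (max_idPr _) ?oppr_le0// subr0.
  by rewrite (max_idPl _) ?oppr_ge0 ?(ltW r0)// add0r opprK.
have m1 : measurable_fun [set: vec] (fun x => Num.max (r x) 0).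
  by apply: measurable_maxr => //.
have m2 : measurable_fun [set: vec] (fun x => Num.max (- r x) 0).
  by apply: measurable_maxr => //; exact: measurableT_comp.
apply: approximableD => //.
- by apply: measurable_funM.
- apply: H => // x; first by rewrite le_max lexx orbT.
  by rewrite ge_max ler_norm normr_ge0.
- apply: approximableZ => //; apply: H => // x; first by rewrite le_max lexx orbT.
  by rewrite ge_max -normrN ler_norm normr_ge0.
Qed.

Lemma test_dense (f : vec -> R[i]) (e : R) : 0 < e -> cmeas f ->
  (\int[mu]_x (nc (f x) ^+ p)%:E < +oo)%E ->
  exists2 u, test_function u & (\int[mu]_x (nc (f x - u x) ^+ p)%:E <= e%:E)%E.
Proof.
move=> e0 mf foo; have mn := cmeas_normc mf.
have fi : mu.-integrable setT (fun x => (nc (f x) ^+ p)%:E).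
  apply/integrableP; split; first by apply/measurable_EFinP; exact: measurable_funX.
  by under eq_integral => x _ do rewrite gee0_abs ?lee_fin ?exprn_ge0 ?normc_ge0//.
have P (r : vec -> R) : measurable_fun [set: vec] r -> (forall x, `|r x| <= nc (f x)) -> approximable p r.
  move=> mr rf; apply: approximable_Lp => //; apply: (integrable_ae_dom _ fi); first exact: mX.
  apply/nearW => x; rewrite ger0_norm ?exprn_ge0//.
  by rewrite lerXn2r// ?nnegrE// (le_trans _ (rf x)).
case: (mf) => m1 m2.
have e2 : 0 < e / (2 ^+ p * 2) by rewrite divr_gt0// mulr_gt0// exprn_gt0.
have [u tu Hu] := P _ m1 (fun x => normRe_le (f x)) _ e2.
have [v tv Hv] := P _ m2 (fun x => normIm_le (f x)) _ e2.
exists (fun x => Complex (u x) (v x)); first by apply/test_functionP.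
have mu_ := rtest_measurable tu; have mv := rtest_measurable tv.
apply: (@le_trans _ _ ((2 ^+ p)%:E * ((e / (2 ^+ p * 2))%:E + (e / (2 ^+ p * 2))%:E))%E); last first.
  rewrite -EFinD -EFinM lee_fin le_eqVlt; apply/orP; left; apply/eqP.
  have : (2 : R) ^+ p != 0 by rewrite expf_neq0.
  by move=> ?; field.
apply: (@le_trans _ _ ((2 ^+ p)%:E * (\int[mu]_x (`|complex.Re (f x) - u x| ^+ p)%:E +
    \int[mu]_x (`|complex.Im (f x) - v x| ^+ p)%:E))%E); last first.
  by rewrite lee_wpmul2l ?lee_fin ?exprn_ge0// leeD.
apply: integral_exprD_le => //.
- by apply: measurableT_comp => //; exact: measurable_funB.
- by apply: measurableT_comp => //; exact: measurable_funB.
- apply: cmeas_normc; split.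
    rewrite (_ : (fun x => _) = (fun x => complex.Re (f x) - u x)); first exact: measurable_funB.
    by apply/funext => x; rewrite Re_addc Re_oppc.
  rewrite (_ : (fun x => _) = (fun x => complex.Im (f x) - v x)); first exact: measurable_funB.
  by apply/funext => x; rewrite Im_addc Im_oppc.
- by move=> x; exact: normc_ge0.
- move=> x; apply: le_trans (normc_leD _) _.
  by rewrite Re_addc Re_oppc Im_addc Im_oppc.
Qed.

End density.

(** * Bounded operators on L^p *)

Section operators.
Context (R : realType) (n p : nat).
Hypothesis p_gt0 : (0 < p)%N.
Local Notation nc := ComplexField.Normc.normc.
Local Notation mu := (@lebesgue_rV R n.+1).
Local Notation vec := 'rV[R]_n.+1.
Local Notation N := (Lp_norm (p%:R%:E : \bar R)).
Local Notation Lp := (in_Lp (p%:R%:E : \bar R)).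
Local Notation chi y x := (expi (2 * pi * dotprod x y)).
Implicit Types (f g : vec -> R[i]) (T : (vec -> R[i]) -> vec -> R[i]).

Let pR0 : p%:R != 0 :> R. Proof. by rewrite pnatr_eq0 -lt0n. Qed.

Lemma Lp_normX f : (N f `^ p%:R = \int[mu]_x (nc (f x) ^+ p)%:E)%E.
Proof.
rewrite /Lp_norm poweR_Lnorm//; apply: eq_integral => x _.
by rewrite /= ger0_norm ?normc_ge0// powR_mulrn ?normc_ge0.
Qed.

Lemma Lp_normE f : (N f = (\int[mu]_x (nc (f x) ^+ p)%:E) `^ p%:R^-1)%E.
Proof. by rewrite -Lp_normX -poweRrM divff// poweRe1// Lnorm_ge0. Qed.

Lemma Lp_norm_ge0 f : (0 <= N f)%E. Proof. exact: Lnorm_ge0. Qed.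

Lemma Lp_norm_lty f : (\int[mu]_x (nc (f x) ^+ p)%:E < +oo)%E = (N f < +oo)%E.
Proof.
apply/idP/idP; first by rewrite Lp_normE; exact: poweR_lty.
by rewrite -Lp_normX; exact: poweR_lty.
Qed.

Lemma measurable_normcX f : cmeas f -> measurable_fun setT (fun x => (nc (f x) ^+ p)%:E).
Proof. by move=> mf; apply/measurable_EFinP/measurable_funX; exact: cmeas_normc. Qed.

Lemma normcX_ge0 f x : (0 <= (nc (f x) ^+ p)%:E)%E.
Proof. by rewrite lee_fin exprn_ge0// normc_ge0. Qed.

Lemma poweR_le_inv (a b : \bar R) : (0 <= a)%E -> (a <= b)%E ->
  (a `^ p%:R^-1 <= b `^ p%:R^-1)%E.
Proof.
move=> a0 ab; have pV : 0 <= p%:R^-1 :> R by rewrite invr_ge0.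
have ai : a \in `[0%E, +oo%E] by rewrite in_itv/= a0 leey.
have bi : b \in `[0%E, +oo%E] by rewrite in_itv/= (le_trans a0 ab) leey.
exact: (gt0_ler_poweR pV ai bi ab).
Qed.

Lemma ae_eq_Lp_norm f g : cmeas f -> cmeas g -> ae_equal f g -> N f = N g.
Proof.
move=> mf mg fg; rewrite !Lp_normE; congr poweR; apply: ae_eq_integral => //.
- exact: measurable_normcX.
- exact: measurable_normcX.
- by apply: filterS fg => x /= -> _.
Qed.

Lemma eq_normc_Lp_norm f g : (forall x, nc (f x) = nc (g x)) -> N f = N g.
Proof. by move=> fg; rewrite !Lp_normE; under eq_integral => x _ do rewrite fg. Qed.

Lemma Lp_normZ (c : R[i]) f : cmeas f -> N (fun x => c * f x) = ((nc c)%:E * N f)%E.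
Proof.
move=> mf; rewrite !Lp_normE.
under eq_integral => x _ do rewrite ComplexField.Normc.normcM exprMn EFinM.
rewrite ge0_integralZl//; last 3 first.
- exact: measurable_normcX.
- by move=> x _; exact: normcX_ge0.
- by rewrite lee_fin exprn_ge0// normc_ge0.
rewrite poweRM ?lee_fin ?exprn_ge0 ?normc_ge0//; last first.
  by apply: integral_ge0 => x _; exact: normcX_ge0.
by rewrite poweR_EFin -powR_mulrn ?normc_ge0// -powRrM divff// powRr1// normc_ge0.
Qed.

Lemma Lp_normD f g : cmeas f -> cmeas g -> (N (fun x => (f x + g x)%R) <= N f + N g)%E.
Proof.
move=> mf mg.
have p1 : 1 <= p%:R :> R by rewrite ler1n.
have := minkowski_EFin mu (cmeas_normc mf) (cmeas_normc mg) p1.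
apply: le_trans; rewrite Lp_normE unlock; apply: poweR_le_inv.
  by apply: integral_ge0 => x _; rewrite lee_fin exprn_ge0// normc_ge0.
rewrite (_ : (\int[mu]_x `|(EFin \o _) x| `^ p%:R)%E =
    (\int[mu]_x ((nc (f x) + nc (g x)) ^+ p)%:E)%E); last first.
  apply: eq_integral => x _ /=.
  by rewrite ger0_norm ?addr_ge0 ?normc_ge0// powR_mulrn ?addr_ge0 ?normc_ge0.
apply: ge0_le_integral => //.
- by move=> x _; rewrite lee_fin exprn_ge0// normc_ge0.
- by apply: (measurable_normcX (f := fun x => f x + g x)); exact: cmeasD.
- apply/measurable_EFinP; apply: measurable_funX.
  by apply: measurable_funD; exact: cmeas_normc.
move=> x _; rewrite lee_fin lerXn2r ?nnegrE ?addr_ge0 ?normc_ge0//.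
exact: le_normcD.
Qed.

Lemma in_LpZ (c : R[i]) f : Lp f -> Lp (fun x => c * f x).
Proof.
move=> [mf foo]; split; first by apply: cmeasM => //; exact: cmeas_cst.
by rewrite Lp_normZ// lte_mul_pinfty ?lee_fin ?normc_ge0.
Qed.

Lemma in_LpD f g : Lp f -> Lp g -> Lp (fun x => f x + g x).
Proof.
move=> [mf foo] [mg goo]; split; first exact: cmeasD.
by apply: le_lt_trans (Lp_normD mf mg) _; rewrite lte_add_pinfty.
Qed.

Lemma Lp_norm0 : N (fun _ : vec => 0) = 0%E.
Proof.
rewrite Lp_normE.
under eq_integral => x _ do rewrite ComplexField.Normc.normc0 expr0n gtn_eqF//=.
by rewrite integral0 poweR0r// invr_eq0.
Qed.

Lemma in_Lp0 : Lp (fun _ : vec => 0).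
Proof. by split; [exact: cmeas_cst|rewrite Lp_norm0]. Qed.

Lemma in_Lp_fin f : Lp f -> N f \is a fin_num.
Proof. by move=> [_ foo]; rewrite ge0_fin_numE// Lp_norm_ge0. Qed.

Lemma opnorm_ge0 T : (0 <= opnorm p%:R%:E T)%E.
Proof.
apply: le_trans (Lp_norm_ge0 (T (fun=> 0))) _; apply: ereal_sup_ubound.
by exists (fun=> 0) => //; split; [exact: in_Lp0|rewrite Lp_norm0].
Qed.

Lemma opnorm_le T (C : \bar R) : (0 <= C)%E ->
  (forall f, Lp f -> (N (T f) <= C * N f)%E) -> (opnorm p%:R%:E T <= C)%E.
Proof.
move=> C0 TC; apply: ge_ereal_sup => _ [f [fL f1] <-].
apply: le_trans (TC f fL) _; rewrite -[leRHS]mule1.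
exact: lee_wpmul2l.
Qed.

Section bounded.
Variable T : (vec -> R[i]) -> vec -> R[i].
Hypothesis bT : bounded_operator p%:R%:E T.

Lemma bounded_operator_cmeas f : Lp f -> cmeas (T f).
Proof. by case: bT => TL _ _ /TL[]. Qed.

Lemma bounded_operatorZ (c : R[i]) f : Lp f -> ae_equal (T (fun x => c * f x)) (fun x => c * T f x).
Proof.
move=> fL; case: bT => TL Tlin Top.
have T0 : ae_equal (T (fun=> 0)) (fun=> 0).
  have := Tlin (-1) _ _ in_Lp0 in_Lp0; apply: filterS => x.
  rewrite (_ : (fun x => _) = (fun=> 0)); last by apply/funext => y; rewrite mulr0 addr0.
  by rewrite mulN1r addNr.
have := Tlin c _ _ fL in_Lp0; rewrite (_ : (fun x => c * f x + 0) = (fun x => c * f x)); last first.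
  by apply/funext => x; rewrite addr0.
by apply: filterS2 T0 => x -> ->; rewrite addr0.
Qed.

Lemma bounded_operatorB f g : Lp f -> Lp g ->
  ae_equal (T f) (fun x => T (fun x => f x - g x) x + T g x).
Proof.
move=> fL gL; case: bT => TL Tlin Top.
have dL : Lp (fun x => f x - g x).
  rewrite (_ : (fun x => _) = (fun x => f x + -1 * g x)); last by apply/funext => x; rewrite mulN1r.
  by apply: in_LpD => //; exact: in_LpZ.
have := Tlin 1 _ _ dL gL; rewrite (_ : (fun x => 1 * _ + _) = f); last first.
  by apply/funext => x; rewrite mul1r subrK.
by apply: filterS => x ->; rewrite mul1r.
Qed.

(** The norm controls [T] on the unit ball; homogeneity, which holds almost
everywhere, carries the bound to all of [L^p]. Dividing by every [c > 0] with
[N f <= c] treats the functions of norm zero at the same time. *)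
Lemma opnorm_bound f : Lp f -> (N (T f) <= opnorm p%:R%:E T * N f)%E.
Proof.
move=> fL; case: (bT) => TL Tlin Top; have mf : cmeas f by case: fL.
have Nf := in_Lp_fin fL.
have Kfin : opnorm p%:R%:E T \is a fin_num by rewrite ge0_fin_numE// opnorm_ge0.
have K0 := opnorm_ge0 T.
have H (c : R) : 0 < c -> (N f <= c%:E)%E -> (N (T f) <= opnorm p%:R%:E T * c%:E)%E.
  move=> c0 fc.
  have ncV : nc (Complex (c^-1) 0) = c^-1.
    by rewrite normcE2/= expr0n/= addr0 sqrtr_sqr gtr0_norm// invr_gt0.
  have : (N (T (fun x => (Complex (c^-1) 0 * f x)%R)) <= opnorm p%:R%:E T)%E.
    apply: ereal_sup_ubound; exists (fun x => Complex (c^-1) 0 * f x) => //.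
    split; first exact: in_LpZ.
    rewrite Lp_normZ// ncV -(fineK Nf) -EFinM lee_fin ler_pdivrMl// mulr1.
    by rewrite -lee_fin fineK.
  rewrite (ae_eq_Lp_norm _ _ (bounded_operatorZ _ fL)); last 2 first.
  - by apply: bounded_operator_cmeas; exact: in_LpZ.
  - by apply: cmeasM; [exact: cmeas_cst|exact: bounded_operator_cmeas].
  rewrite Lp_normZ ?ncV; last exact: bounded_operator_cmeas.
  by rewrite lee_pdivrMl// muleC.
rewrite -(fineK Kfin) -(fineK Nf) -EFinM.
have fK : 0 <= fine (opnorm p%:R%:E T) by rewrite fine_ge0.
have fN : 0 <= fine (N f) by rewrite fine_ge0// Lp_norm_ge0.
apply/lee_addgt0Pr => e e0.
have e1 : 0 < e / (fine (opnorm p%:R%:E T) + 1) by rewrite divr_gt0// ltr_wpDl.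
apply: (le_trans (H (fine (N f) + e / (fine (opnorm p%:R%:E T) + 1)) _ _)).
- by rewrite ltr_wpDl.
- by rewrite -[X in (X <= _)%E](fineK Nf) lee_fin lerDl ltW.
rewrite -(fineK Kfin) -EFinM -EFinD lee_fin mulrDr lerD2l mulrA ler_pdivrMr; last by rewrite ltr_wpDl.
by rewrite mulrC ler_wpM2l ?(ltW e0)// lerDl.
Qed.

(** Density of the test functions. The boundedness of [T] is used to control [T]
on the remainder of the approximation, the bound [C] on its main part. *)
Lemma opnorm_le_test (C : R) : 0 <= C ->
  (forall u, test_function u -> Lp u /\ (N (T u) <= C%:E * N u)%E) ->
  (opnorm p%:R%:E T <= C%:E)%E.
Proof.
move=> C0 TC; apply: opnorm_le => // f fL; case: (bT) => TL Tlin Top.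
have mf : cmeas f by case: fL.
have foo : (N f < +oo)%E by case: fL.
have Nf := in_Lp_fin fL.
have Kfin : opnorm p%:R%:E T \is a fin_num by rewrite ge0_fin_numE// opnorm_ge0.
set K := fine (opnorm p%:R%:E T).
have K0 : 0 <= K by rewrite fine_ge0// opnorm_ge0.
rewrite -(fineK Nf) -EFinM; apply/lee_addgt0Pr => e e0.
pose d : R := e / (C + K + 1).
have d0 : 0 < d by rewrite divr_gt0// ltr_wpDl// addr_ge0.
have [u tu Hu] := @test_dense R n p p_gt0 f _ (exprn_gt0 p d0) mf ltac:(by rewrite Lp_norm_lty).
have [uL Tu] := TC _ tu; have mu_ : cmeas u by case: uL.
have dL : Lp (fun x => f x - u x).
  rewrite (_ : (fun x => _) = (fun x => f x + -1 * u x)); last by apply/funext => x; rewrite mulN1r.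
  by apply: in_LpD => //; exact: in_LpZ.
have Nd : (N (fun x => (f x - u x)%R) <= d%:E)%E.
  rewrite Lp_normE; apply: le_trans (poweR_le_inv _ Hu) _.
    by apply: integral_ge0 => x _; rewrite lee_fin exprn_ge0// normc_ge0.
  have d0' : 0 <= d by exact: ltW.
  by rewrite poweR_EFin -powR_mulrn// -powRrM divff// powRr1.
have Nu : (N u <= N f + d%:E)%E.
  have -> : u = (fun x => f x + -1 * (f x - u x)).
    by apply/funext => x; rewrite mulN1r opprB addrC subrK.
  apply: le_trans (Lp_normD mf _) _; first by apply: cmeasM; [exact: cmeas_cst|case: dL].
  rewrite Lp_normZ; last by case: dL.
  by rewrite normcE2/= oppr0 expr0n/= addr0 sqrrN expr1n sqrtr1 mul1e leeD2l.
have mTd := bounded_operator_cmeas dL; have mTu := bounded_operator_cmeas uL.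
rewrite (ae_eq_Lp_norm _ _ (bounded_operatorB fL uL)); last 2 first.
- exact: bounded_operator_cmeas.
- exact: cmeasD.
apply: le_trans (Lp_normD mTd mTu) _.
apply: (@le_trans _ _ (K%:E * d%:E + C%:E * (N f + d%:E))%E).
  apply: leeD.
    apply: le_trans (opnorm_bound dL) _; rewrite -(fineK Kfin).
    by apply: lee_wpmul2l; rewrite ?lee_fin.
  apply: le_trans Tu _; apply: lee_wpmul2l; by rewrite ?lee_fin.
have := esym (fineK Nf); move: (fine (N f)) => a ->.
rewrite -!(EFinD, EFinM) lee_fin mulrDr addrCA lerD2l.
rewrite -mulrDl /d mulrA ler_pdivrMr; last by rewrite ltr_wpDl// addr_ge0.
by rewrite mulrC ler_wpM2l ?(ltW e0)//; lra.
Qed.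

End bounded.

Lemma in_Lp_chi (v : vec) f : Lp f -> Lp (fun x => chi v x * f x).
Proof.
move=> [mf foo]; split; first by apply: cmeasM => //; exact: cmeas_chi.
rewrite (@eq_normc_Lp_norm _ f)// => x.
by rewrite ComplexField.Normc.normcM normc_expi mul1r.
Qed.

Lemma Lp_norm_chi (v : vec) f : N (fun x => chi v x * f x) = N f.
Proof.
by apply: eq_normc_Lp_norm => x; rewrite ComplexField.Normc.normcM normc_expi mul1r.
Qed.

Lemma in_Lp_conj f : Lp f -> Lp (fun x => conjc (f x)).
Proof.
move=> [mf foo]; split; first exact: cmeas_conj.
by rewrite (@eq_normc_Lp_norm _ f)// => x; rewrite normc_conj.
Qed.

Lemma Lp_norm_conj f : N (fun x => conjc (f x)) = N f.
Proof. by apply: eq_normc_Lp_norm => x; rewrite normc_conj. Qed.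

Definition conjugate_op T f x := conjc (T (fun x => conjc (f x)) x).

Lemma opnorm_conjugate T : (opnorm p%:R%:E (conjugate_op T) <= opnorm p%:R%:E T)%E.
Proof.
apply: ge_ereal_sup => _ [f [fL f1] <-]; rewrite Lp_norm_conj.
apply: ereal_sup_ubound; exists (fun x => conjc (f x)) => //.
by split; [exact: in_Lp_conj|rewrite Lp_norm_conj].
Qed.

Lemma bounded_conjugate T : bounded_operator p%:R%:E T -> bounded_operator p%:R%:E (conjugate_op T).
Proof.
move=> [TL Tlin Top]; split.
- by move=> f fL; apply: in_Lp_conj; apply: TL; exact: in_Lp_conj.
- move=> a f g fL gL.
  have := Tlin (conjc a) _ _ (in_Lp_conj fL) (in_Lp_conj gL).
  apply: filterS => x; rewrite /conjugate_op => H.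
  rewrite (_ : (fun x => conjc (a * f x + g x)) = (fun x => conjc a * conjc (f x) + conjc (g x))).
    by rewrite H conjcD conjcM conjcK.
  by apply/funext => y; rewrite conjcD conjcM.
- exact: le_lt_trans (opnorm_conjugate T) Top.
Qed.

Definition modulate_op (v : vec) T f x := chi v x * T (fun x => chi (- v) x * f x) x.

Lemma bounded_modulate (v : vec) T : bounded_operator p%:R%:E T ->
  bounded_operator p%:R%:E (modulate_op v T).
Proof.
move=> [TL Tlin Top]; split.
- by move=> f fL; apply: in_Lp_chi; apply: TL; exact: in_Lp_chi.
- move=> a f g fL gL.
  have := Tlin a _ _ (in_Lp_chi (- v) fL) (in_Lp_chi (- v) gL).
  apply: filterS => x; rewrite /modulate_op => H.
  rewrite (_ : (fun x => chi (- v) x * (a * f x + g x)) =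
    (fun x => a * (chi (- v) x * f x) + chi (- v) x * g x)); first by rewrite H; ring.
  by apply/funext => y; ring.
- apply: le_lt_trans Top; apply: ge_ereal_sup => _ [f [fL f1] <-].
  rewrite Lp_norm_chi; apply: ereal_sup_ubound; exists (fun x => chi (- v) x * f x) => //.
  by split; [exact: in_Lp_chi|rewrite Lp_norm_chi].
Qed.

Lemma bounded_add T1 T2 : bounded_operator p%:R%:E T1 -> bounded_operator p%:R%:E T2 ->
  bounded_operator p%:R%:E (fun f x => T1 f x + T2 f x).
Proof.
move=> b1 b2; have [T1L T1lin T1op] := b1; have [T2L T2lin T2op] := b2; split.
- by move=> f fL; apply: in_LpD; [exact: T1L|exact: T2L].
- move=> a f g fL gL; apply: filterS2 (T1lin a f g fL gL) (T2lin a f g fL gL) => x -> ->; ring.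
- apply: (@le_lt_trans _ _ (opnorm p%:R%:E T1 + opnorm p%:R%:E T2)%E); last exact: lte_add_pinfty.
  apply: opnorm_le; first by rewrite adde_ge0// opnorm_ge0.
  move=> f fL; apply: le_trans (Lp_normD _ _) _; [exact: bounded_operator_cmeas..|].
  rewrite ge0_muleDl ?opnorm_ge0//.
  by apply: leeD; exact: opnorm_bound.
Qed.

(** The essential supremum is an almost everywhere bound. The supremum norm is 0
by convention when the whole space is null, but then every property holds
almost everywhere. *)
Lemma in_Loo_symbol (m : vec -> R[i]) : in_Lp +oo%E m -> symbol m.
Proof.
move=> [mm moo]; split => //; move: moo; rewrite /Lp_norm unlock.
have [mT|mT _] := ltP 0%E (mu setT).
  move=> moo.
  have mge := @ess_sup_inf.ess_sup_ge _ _ _ mu (abse \o (fun x : vec => (nc (m x))%:E)).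
  case E : (ess_sup_inf.ess_sup mu _) moo mge => [M| |] // _ mge; last first.
    exists 0; apply: filterS mge => y; by rewrite leeNy_eq.
  by exists M; apply: filterS mge => y /=; rewrite lee_fin ger0_norm ?normc_ge0.
exists 0; exists setT; split => //.
by apply/eqP; rewrite eq_le mT/=.
Qed.

End operators.

(** * The norms of the two halves and of the separated multiplier *)

Section final.
Context (R : realType) (n q : nat) (A : R) (m : 'rV[R]_n.+1 -> R[i]).
Hypothesis q_gt0 : (0 < q)%N.
Hypothesis A_ge0 : 0 <= A.
Local Notation p := q.*2.
Local Notation nc := ComplexField.Normc.normc.
Local Notation mu := (@lebesgue_rV R n.+1).
Local Notation vec := 'rV[R]_n.+1.
Local Notation N := (Lp_norm (p%:R%:E : \bar R)).
Local Notation Lp := (in_Lp (p%:R%:E : \bar R)).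
Hypothesis sm : symbol m.
Hypothesis m_supp : {ae mu, forall y, A < `|last_coord y| -> m y = 0}.
Hypothesis m_real : forall t, 0 < t -> real_to_real (shift_apart t m).
Implicit Types (f g h : vec -> R[i]) (T : (vec -> R[i]) -> vec -> R[i]).

Let p_gt0 : (0 < p)%N. Proof. by rewrite double_gt0. Qed.

(** The power [|f| ^ 2q = (Re f ^ 2 + Im f ^ 2) ^ q] is itself a test function. *)
Lemma test_in_Lp f : test_function f -> Lp f.
Proof.
move=> tf; have [f1 f2] := (test_functionP f).1 tf; split; first exact: test_cmeas.
rewrite -(Lp_norm_lty p_gt0).
have tw : rtest (fun x => nc (f x) ^+ 2).
  rewrite (_ : (fun x => _) = (fun x => complex.Re (f x) * complex.Re (f x) +
      complex.Im (f x) * complex.Im (f x))); last by apply/funext => x; rewrite normc_sqr !expr2.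
  by apply: rtestD; apply: rtestM => //; [case: f1|case: f2].
have tX k : rtest (fun x => (nc (f x) ^+ 2) ^+ k.+1).
  elim: k => [|k IH]; first by under eq_fun do rewrite expr1.
  by under eq_fun do rewrite exprSr; apply: rtestM => //; case: tw.
have /integrableP[_] := rtest_integrable (tX q.-1).
rewrite prednK//; apply: le_lt_trans; rewrite le_eqVlt; apply/orP; left; apply/eqP.
apply: eq_integral => x _ /=.
by rewrite -exprM mul2n ger0_norm// exprn_ge0// normc_ge0.
Qed.

(** The main inequality bounds [|g + h| ^ p], in integral, by
[C(p, q) / 2 (B ^ p + B ^ p)]. *)
Lemma Lp_norm_add_le (B t : R) g h : 0 <= B -> (q%:R - 1) * A <= 2 * t ->
  spec_ge t g -> spec_ge (- (t + A)) (fun x => conjc (g x)) ->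
  spec_ge (- (t + A)) h -> spec_ge t (fun x => conjc (h x)) ->
  (N g <= B%:E)%E -> (N h <= B%:E)%E ->
  (N (fun x => (g x + h x)%R) <= ('C(p, q)%:R `^ p%:R^-1 * B)%:E)%E.
Proof.
move=> B0 tA sg sgc sh shc gB hB.
have H f : cmeas f -> (N f <= B%:E)%E ->
    mu.-integrable setT (fun x => (nc (f x) ^+ p)%:E) /\
    Rintegral mu setT (fun x => nc (f x) ^+ p) <= B ^+ p.
  move=> mf fB.
  have foo : (\int[mu]_x (nc (f x) ^+ p)%:E < +oo)%E.
    by rewrite Lp_norm_lty//; apply: le_lt_trans fB _; rewrite ltry.
  have i0 : (0 <= \int[mu]_x (nc (f x) ^+ p)%:E)%E by apply: integral_ge0 => x _; exact: normcX_ge0.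
  split.
    apply/integrableP; split; first exact: measurable_normcX.
    by under eq_integral => x _ do rewrite gee0_abs ?normcX_ge0//.
  rewrite -lee_fin /Rintegral fineK ?ge0_fin_numE// -(Lp_normX p_gt0) -powR_mulrn// -poweR_EFin.
  apply: gt0_ler_poweR => //; rewrite ?in_itv/= ?Lp_norm_ge0 ?lee_fin ?B0 ?leey//.
have mg : cmeas g by case: sg.
have mh : cmeas h by case: sh.
have [ig gB'] := H _ mg gB; have [ih hB'] := H _ mh hB.
have le := Rintegral_addX_le A_ge0 tA sg sgc sh shc ig ih.
have ii := integrable_addX sg sh ig ih.
rewrite (Lp_normE p_gt0).
have pV0 : 0 <= p%:R^-1 :> R by rewrite invr_ge0.
have C0 : 0 <= 'C(p, q)%:R :> R by [].
have -> : (\int[mu]_x (nc (g x + h x) ^+ p)%:E =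
    (Rintegral mu setT (fun x => nc (g x + h x) ^+ p))%:E)%E.
  by rewrite /Rintegral fineK//; exact: integrable_fin_num ii.
rewrite poweR_EFin lee_fin.
have -> : 'C(p, q)%:R `^ p%:R^-1 * B = ('C(p, q)%:R * B ^+ p) `^ p%:R^-1.
  rewrite powRM ?exprn_ge0// -powR_mulrn// -powRrM divff ?powRr1//.
  by rewrite pnatr_eq0 -lt0n.
apply: ge0_ler_powR; rewrite ?nnegrE ?mulr_ge0 ?exprn_ge0//.
  by apply: Rintegral_ge0 => x _; rewrite exprn_ge0// normc_ge0.
apply: le_trans le _; rewrite -mulrA ler_wpM2l//; lra.
Qed.

Let plus_minus := plus_conj_minus sm m_supp m_real.

(** Complex conjugation exchanges the extensions of the two halves, which
therefore have the same norm. *)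
Lemma conjugate_extension_minus T : bounded_extension p%:R%:E (m_minus m) T ->
  bounded_extension p%:R%:E (m_plus m) (conjugate_op T).
Proof.
move=> [bT ET]; split; first exact: bounded_conjugate.
move=> f tf; apply: filterS2 (ET _ (test_conj tf)) (plus_minus tf) => x H1 H2.
by rewrite /conjugate_op H1 H2.
Qed.

Lemma conjugate_extension_plus T : bounded_extension p%:R%:E (m_plus m) T ->
  bounded_extension p%:R%:E (m_minus m) (conjugate_op T).
Proof.
move=> [bT ET]; split; first exact: bounded_conjugate.
move=> f tf; have fE : (fun x => conjc (conjc (f x))) = f by apply/funext => x; rewrite conjcK.
have P := plus_minus (test_conj tf); rewrite fE in P.
apply: filterS2 (ET _ (test_conj tf)) P => x H1 H2.
by rewrite /conjugate_op H1 H2; exact: conjcK.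
Qed.

Lemma multiplier_norm_plus_minus :
  multiplier_norm p%:R%:E (m_plus m) = multiplier_norm p%:R%:E (m_minus m).
Proof.
apply/eqP; rewrite eq_le; apply/andP; split; apply: le_ereal_inf_tmp => _ [T ET <-].
  apply: le_trans (opnorm_conjugate p_gt0 T); apply: ereal_inf_lbound.
  by exists (conjugate_op T) => //; exact: conjugate_extension_minus.
apply: le_trans (opnorm_conjugate p_gt0 T); apply: ereal_inf_lbound.
by exists (conjugate_op T) => //; exact: conjugate_extension_plus.
Qed.

(** An extension [T] of the upper half and its conjugate, which extends the lower
half, are modulated and added. The sum extends the separated multiplier, and
on test functions it is governed by the main inequality. *)
Lemma multiplier_norm_shift_le t T : (q%:R - 1) * A <= 2 * t ->
  bounded_extension p%:R%:E (m_plus m) T ->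
  (multiplier_norm p%:R%:E (shift_apart t m) <=
   ('C(p, q)%:R `^ p%:R^-1)%:E * opnorm p%:R%:E T)%E.
Proof.
move=> tA ET; have [bT Tm] := ET; have [bT' Tm'] := conjugate_extension_plus ET.
pose v : vec := t *: @e_last R n.
pose S f x := modulate_op v T f x + modulate_op (- v) (conjugate_op T) f x.
have bS : bounded_operator p%:R%:E S by apply: bounded_add => //; exact: bounded_modulate.
have upE f : test_function f -> ae_equal (modulate_op v T f) (upper m t f).
  move=> tf; apply: filterS (Tm _ (test_chi (- v) tf)) => x; rewrite /modulate_op => ->.
  by rewrite (upperE sm t x tf).
have loE f : test_function f -> ae_equal (modulate_op (- v) (conjugate_op T) f) (lower m t f).
  move=> tf; apply: filterS (Tm' _ (test_chi v tf)) => x; rewrite /modulate_op opprK => ->.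
  by rewrite (lowerE sm t x tf).
have ES : bounded_extension p%:R%:E (shift_apart t m) S.
  split=> // f tf; apply: filterS2 (upE f tf) (loE f tf) => x H1 H2.
  by rewrite /S H1 H2 (upper_lower sm t x tf).
have Kfin : opnorm p%:R%:E T \is a fin_num.
  by rewrite ge0_fin_numE ?opnorm_ge0//; case: bT.
set K := fine (opnorm p%:R%:E T).
have K0 : 0 <= K by rewrite fine_ge0// opnorm_ge0.
apply: (@le_trans _ _ (opnorm p%:R%:E S)).
  by apply: ereal_inf_lbound; exists S.
rewrite -(fineK Kfin) -/K -EFinM; apply: (opnorm_le_test p_gt0) => //.
  by rewrite mulr_ge0// powR_ge0.
move=> u tu; have uL := test_in_Lp tu; split => //.
have mu_ : cmeas u by case: uL.
have Nu := in_Lp_fin uL.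
have su := spec_upper sm m_supp t tu; have suc := spec_upper_conj sm m_supp t tu.
have sl := spec_lower sm m_supp t tu; have slc := spec_lower_conj sm m_supp t tu.
have mup : cmeas (upper m t u) by case: su.
have mlo : cmeas (lower m t u) by case: sl.
have SL : Lp (S u) by case: bS => + _ _; exact.
have -> : N (S u) = N (fun x => upper m t u x + lower m t u x).
  apply: (ae_eq_Lp_norm p_gt0) => //; [by case: SL|exact: cmeasD|].
  by apply: filterS2 (upE u tu) (loE u tu) => x; rewrite /S => -> ->.
have bd (T0 : (vec -> R[i]) -> vec -> R[i]) w g : bounded_operator p%:R%:E T0 ->
    (opnorm p%:R%:E T0 <= opnorm p%:R%:E T)%E -> cmeas g ->
    ae_equal (modulate_op w T0 u) g -> (N g <= (K * fine (N u))%:E)%E.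
  move=> b0 T0T mg E; have [M0 _ _] := bounded_modulate p_gt0 w b0.
  have [mM _] := M0 _ uL.
  rewrite -(ae_eq_Lp_norm p_gt0 mM mg E) (Lp_norm_chi p_gt0).
  apply: le_trans (opnorm_bound p_gt0 b0 (in_Lp_chi p_gt0 (- w) uL)) _.
  rewrite (Lp_norm_chi p_gt0) EFinM (fineK Nu) (fineK Kfin).
  by apply: lee_wpmul2r => //; exact: Lp_norm_ge0.
have B0 : 0 <= K * fine (N u) by rewrite mulr_ge0// fine_ge0// Lp_norm_ge0.
have hu := bd T v _ bT (lexx _) mup (upE u tu).
have hl := bd _ (- v) _ bT' (opnorm_conjugate p_gt0 T) mlo (loE u tu).
rewrite -(fineK Nu) -EFinM -mulrA.
exact: (Lp_norm_add_le B0 tA su suc sl slc hu hl).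
Qed.

End final.

(** * The norm inequality *)

(* The ambient space is R^(n+1), so that x' lies in R^n. *)
Theorem theorem4p1 (R : realType) (n p : nat) (A : R) (m : 'rV[R]_n.+1 -> R[i])
    (p_ge2 : (2 <= p)%N) (p_even : ~~ odd p) (A_gt0 : 0 < A)
    (m_mult : fourier_multiplier p%:R%:E m)
    (m_supp : {ae lebesgue_rV n.+1, forall x, A < `|last_coord x| -> m x = 0})
    (m_real : forall t : R, 0 < t -> real_to_real (shift_apart t m)) :
  forall t : R, (p%:R - 2) * A / 4 <= t ->
  (multiplier_norm p%:R%:E (shift_apart t m) <=
   ('C(p, p./2)%:R `^ (p%:R)^-1)%:E *
   (multiplier_norm p%:R%:E (m_plus m) *
    multiplier_norm p%:R%:E (m_minus m)) `^ 2^-1)%E.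
Proof.
move=> t tA; have [mL _] := m_mult; have sm := in_Loo_symbol mL.
have pE : p = p./2.*2 by rewrite even_halfK.
have q0 : (0 < p./2)%N by rewrite half_gt0.
move: (p./2) pE q0 => q pE q0; subst p.
have A0 : 0 <= A by exact: ltW.
have tA' : (q%:R - 1) * A <= 2 * t.
  by move: tA; rewrite -mul2n natrM; lra.
have p0 : (0 < q.*2)%N by rewrite double_gt0.
rewrite -(multiplier_norm_plus_minus q0 sm m_supp m_real).
set M := multiplier_norm _ (m_plus m); set c := 'C(_, _)%:R `^ _.
have c0 : 0 < c by rewrite powR_gt0// ltr0n bin_gt0 -addnn leq_addr.
have M0 : (0 <= M)%E by apply: le_ereal_inf_tmp => _ [T _ <-]; exact: opnorm_ge0.
(* The two halves have the same norm [M], so the geometric mean is [M]; this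
includes the value +oo. *)
have -> : ((M * M) `^ 2^-1 = M)%E.
  rewrite poweRM// -poweRD; last by rewrite /poweRD_def; apply/implyP => /eqP; lra.
  by rewrite (_ : 2^-1 + 2^-1 = 1) ?poweRe1//; lra.
rewrite -lee_pdivrMl//; apply: le_ereal_inf_tmp => _ [T ET <-].
by rewrite lee_pdivrMl//; exact: (multiplier_norm_shift_le q0 A0 sm m_supp m_real tA' ET).
Qed.
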